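(* Let $G$ be a Lie groupoid over $M$ with Lie algebroid $A$ and anchor $\rho$, and let $\sigma$ be an Ehresmann connection on $G$, with induced quasi-actions $\lambda$ of $G$ on $A$ and $TM$ and basic curvature $K^{\mathrm{bas}}_\sigma$. Then the operators $$R_0=\rho,\quad R_1=\lambda,\quad R_2=K^{\mathrm{bas}}_\sigma\qquad(\text{and }R_k=0\text{ for }k\ge3)$$ give the adjoint complex $\mathrm{Ad}(G):\ A\xrightarrow{\rho}TM$ ($A$ in degree $0$, $TM$ in degree $1$) the structure of a unital representation up to homotopy of $G$.
   Context: A Lie groupoid $G$ over $M$ has source and target $s,t$, multiplication $m$ and inversion. $G_k$ is the manifold of strings $(g_1,\dots,g_k)$ of composable arrows, $s(g_i)=t(g_{i+1})$; $G_0=M$; $s(g_1,\dots,g_k)=s(g_k)$, $t(g_1,\dots,g_k)=t(g_1)$. A representation up to homotopy of $G$ on a bounded graded vector bundle $E$ over $M$ is (equivalently) a sequence $R_k\in\Gamma(G_k,\mathrm{Hom}(s^*E^\bullet,t^*E^{\bullet+1-k}))$, $k\ge0$, such that for all $k\ge0$ $$\sum_{j=1}^{k-1}(-1)^jR_{k-1}(g_1,\dots,g_jg_{j+1},\dots,g_k)=\sum_{j=0}^k(-1)^jR_j(g_1,\dots,g_j)\circ R_{k-j}(g_{j+1},\dots,g_k).$$ It is unital if $R_1(g)=\mathrm{Id}$ for every unit $g$ and, for $k\ge2$, $R_k(g_1,\dots,g_k)=0$ whenever some $g_i$ is a unit. $A=\mathrm{Ker}(ds)|_M$, with anchor $\rho=dt|_A$.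 For $g\in G$, $r_g:A_{t(g)}\to T_gG$ is the differential at the unit of right multiplication by $g$, and $l_g:A_{s(g)}\to T_gG$ is the differential at the unit of $h\mapsto gh^{-1}$. An Ehresmann connection is a smooth vector bundle splitting $\sigma:s^*TM\to TG$ of $ds$ which at each unit $1_x$ is the canonical inclusion $T_xM\subset T_{1_x}G$; equivalently the sub-bundle $\mathcal H=\mathrm{Im}(\sigma)$. $\omega:TG\to t^*A$ is the corresponding left splitting: $\omega\circ r=\mathrm{Id}$, $r\circ\omega+\sigma\circ ds=\mathrm{Id}$. The quasi-actions are $\lambda_g(X)=(dt)_g(\sigma_g(X))\in T_{t(g)}M$ for $X\in T_{s(g)}M$ and $\lambda_g(\alpha)=-\omega_g(l_g(\alpha))\in A_{t(g)}$ for $\alpha\in A_{s(g)}$. The basic curvature is the section $K^{\mathrm{bas}}_\sigma\in\Gamma(G_2,\mathrm{Hom}(s^*TM,t^*A))$, $K^{\mathrm{bas}}_\sigma(g,h)v=\omega_{gh}\big((dm)_{(g,h)}(\sigma_g(\lambda_hv),\sigma_hv)\big)$, i.e. $r_{gh}(K^{\mathrm{bas}}_\sigma(g,h)v)=(dm)_{(g,h)}(\sigma_g(\lambda_hv),\sigma_hv)-\sigma_{gh}(v)$. *)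

(* Defs.v *)
From HB Require Import structures.
From mathcomp Require Import all_boot all_order all_algebra.
From mathcomp Require Import all_classical all_reals all_analysis.

Set Implicit Arguments.
Unset Strict Implicit.
Unset Printing Implicit Defensive.

Import Order.TTheory GRing.Theory Num.Theory.
Import numFieldNormedType.Exports.

Local Open Scope classical_set_scope.
Local Open Scope ring_scope.

(** * Smooth functions on open subsets of finite-dimensional spaces *)

Fixpoint Ck (R : realType) (V W : normedModType R) (k : nat) (U : set V)
    (f : V -> W) : Prop :=
  if k is k'.+1 then
    (forall x, U x -> differentiable f x) /\
    (forall v, Ck k' U (fun x => 'd f x v))
  else forall x, U x -> {for x, continuous f}.

Definition smooth_fun (R : realType) (V W : normedModType R) (U : set V)
    (f : V -> W) : Prop :=
  forall k, Ck k U f.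

(** * Manifolds *)

(* A point set with a local coordinate system [chart p], defined on [mdom p],
   around each point p.  [chartV p] is the inverse of [chart p]; the values of
   [chart p] off [mdom p], and of [chartV p] off its image, are irrelevant. *)
Record charted (R : realType) := Charted {
  mpt :> Type;
  mdim : nat;
  mdom : mpt -> set mpt;
  chart : mpt -> mpt -> 'rV[R]_mdim;
  chartV : mpt -> 'rV[R]_mdim -> mpt
}.

(* The topology of a manifold is the one determined by its atlas, so an atlas
   is required to have overlaps with open coordinate images.  Neither the
   Hausdorff property nor second countability is assumed: arrow spaces of Lie
   groupoids are often not Hausdorff. *)
Record is_manifold (R : realType) (N : charted R) : Prop := IsManifold {
  mdom_refl : forall p : N, mdom p p;
  chartK : forall p q : N, mdom p q -> chartV p (chart p q) = q;
  chart_open : forall p p' : N, open (chart p @` (mdom p `&` mdom p'));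
  chart_smooth : forall p p' : N,
    smooth_fun (chart p @` (mdom p `&` mdom p')) (chart p' \o chartV p)
}.

Record manifold (R : realType) := Manifold {
  mcharted :> charted R;
  manifoldP : is_manifold mcharted
}.

Definition mopen (R : realType) (N : charted R) (U : set N) : Prop :=
  forall p : N, open (chart p @` (mdom p `&` U)).

Definition prodm (R : realType) (N P : charted R) : charted R :=
  @Charted R (N * P)%type (mdim N + mdim P)
    (fun p => [set q | mdom p.1 q.1 /\ mdom p.2 q.2])
    (fun p q => row_mx (chart p.1 q.1) (chart p.2 q.2))
    (fun p v => (chartV p.1 (lsubmx v), chartV p.2 (rsubmx v))).

Definition powm (R : realType) (N : charted R) (k : nat) : charted R :=
  @Charted R (k.-tuple N) (k * mdim N)
    (fun p => [set q | forall i, mdom (tnth p i) (tnth q i)])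
    (fun p q => mxvec (\matrix_(i < k) chart (tnth p i) (tnth q i)))
    (fun p v => [tuple chartV (tnth p i) (row i (vec_mx v)) | i < k]).

(** * Smooth maps and differentials *)

(* F is a smooth map between coordinate spaces, defined on the open
   neighbourhood O of the point with coordinates [chart p p], that represents
   f on the points of S near p. *)
Definition local_ext (R : realType) (N P : charted R) (S : set N) (f : N -> P)
    (p : N) (O : set 'rV[R]_(mdim N))
    (F : 'rV[R]_(mdim N) -> 'rV[R]_(mdim P)) : Prop :=
  [/\ open O, O (chart p p), smooth_fun O F &
    forall q : N, S q -> mdom p q -> O (chart p q) ->
      mdom (f p) (f q) /\ chart (f p) (f q) = F (chart p q)].

(* Smoothness of a map defined on a subset S of a manifold: it extends locally
   to smooth maps on open subsets.  For S = setT this is smoothness of a map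
   between manifolds, for an embedded submanifold S it is smoothness for the
   induced manifold structure. *)
Definition smooth_map (R : realType) (N P : charted R) (S : set N)
    (f : N -> P) : Prop :=
  forall p : N, S p -> exists O F, local_ext S f p O F.

(* The tangent space at p is presented by the coordinate system [chart p]. *)
Definition tangent (R : realType) (N : charted R) (p : N) : vectType R :=
  'rV[R]_(mdim N).

(* The differential at p of a map f that is smooth on S, through a local
   smooth extension of f.  On the tangent space at p of a submanifold S it does
   not depend on the extension; only its values there are meaningful. *)
Definition mdiff (R : realType) (N P : charted R) (S : set N) (f : N -> P)
    (p : N) : 'Hom(tangent p, tangent (f p)) :=
  linfun ('d (xget (fun=> 0)
      [set F : 'rV[R]_(mdim N) -> 'rV[R]_(mdim P)
        | exists O, local_ext S f p O F]) (chart p p)).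

(** * Vector bundles *)

Record local_frame (R : realType) (N : charted R) (E : N -> vectType R) :=
  LocalFrame {
    fdom : set N;
    frank : nat;
    fvec : 'I_frank -> forall x : N, E x
  }.
Arguments fvec {R N E} _ _ _.

(* A family of vector spaces with a set of local frames, that is, of local
   trivializations. *)
Record prebundle (R : realType) (N : charted R) := Prebundle {
  fibre :> N -> vectType R;
  frames : set (local_frame fibre)
}.
Arguments frames {R N} _ _.

(* The coefficients of Phi with respect to the frames e and e' are smooth. *)
Definition smooth_coef (R : realType) (N P Q : charted R) (S : set N)
    (f : N -> P) (g : N -> Q) (E : P -> vectType R) (F : Q -> vectType R)
    (e : local_frame E) (e' : local_frame F)
    (Phi : forall q : N, 'Hom(E (f q), F (g q))) : Prop :=
  forall p : N, S p -> fdom e (f p) -> fdom e' (g p) ->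
    exists (O : set 'rV[R]_(mdim N))
           (c : 'rV[R]_(mdim N) -> 'M[R]_(frank e, frank e')),
      [/\ open O, O (chart p p), smooth_fun O c &
        forall q : N, S q -> mdom p q -> O (chart p q) ->
          fdom e (f q) -> fdom e' (g q) ->
          forall a, Phi q (fvec e a (f q)) =
            \sum_b c (chart p q) a b *: fvec e' b (g q)].

(* Phi is a smooth section over S of Hom(f^* E, g^* F). *)
Definition smooth_hom (R : realType) (N P Q : charted R) (S : set N)
    (f : N -> P) (g : N -> Q) (E : prebundle P) (F : prebundle Q)
    (Phi : forall q : N, 'Hom(E (f q), F (g q))) : Prop :=
  forall e e', frames E e -> frames F e' -> @smooth_coef R N P Q S f g E F e e' Phi.

Definition is_frame (R : realType) (N : charted R) (E : N -> vectType R)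
    (e : local_frame E) : Prop :=
  mopen (fdom e) /\
  forall x, fdom e x -> basis_of fullv [seq fvec e a x | a <- enum 'I_(frank e)].

Record is_vbundle (R : realType) (N : charted R) (E : prebundle N) : Prop :=
  IsVbundle {
    frames_frame : forall e, frames E e -> is_frame e;
    frames_cover : forall x : N, exists2 e, frames E e & fdom e x;
    frames_transition : @smooth_hom R N N N setT id id E E (fun=> \1%VF)
  }.

(* The frame of coordinate vector fields of [chart p]. *)
Definition coord_frame (R : realType) (N : charted R) (p : N) :
    local_frame (@tangent R N) :=
  @LocalFrame R N (@tangent R N) (mdom p) (mdim N)
    (fun a x => 'd (chart x \o chartV p) (chart p x) (delta_mx 0 a)).

Definition tangent_bundle (R : realType) (N : charted R) : prebundle N :=
  Prebundle (range (@coord_frame R N)).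

Definition zero_bundle (R : realType) (N : charted R) : prebundle N :=
  @Prebundle R N (fun=> 'rV[R]_0)
    [set @LocalFrame R N (fun=> 'rV[R]_0) setT 0 (fun _ _ => 0)].

(** * Lie groupoids *)

Record lie_groupoid (R : realType) := LieGroupoid {
  garr :> manifold R;
  gobj : manifold R;
  src : garr -> gobj;
  tgt : garr -> gobj;
  unt : gobj -> garr;
  inv : garr -> garr;
  (* [mul g h] is meaningful only when [src g = tgt h]. *)
  mul : garr -> garr -> garr;
  src_mul : forall g h, src g = tgt h -> src (mul g h) = src h;
  tgt_mul : forall g h, src g = tgt h -> tgt (mul g h) = tgt g;
  mulA : forall g h k, src g = tgt h -> src h = tgt k ->
    mul g (mul h k) = mul (mul g h) k;
  src_unt : forall x, src (unt x) = x;
  tgt_unt : forall x, tgt (unt x) = x;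
  mul_unt_l : forall g, mul (unt (tgt g)) g = g;
  mul_unt_r : forall g, mul g (unt (src g)) = g;
  src_inv : forall g, src (inv g) = tgt g;
  tgt_inv : forall g, tgt (inv g) = src g;
  mul_inv_r : forall g, mul g (inv g) = unt (tgt g);
  mul_inv_l : forall g, mul (inv g) g = unt (src g);
  src_smooth : smooth_map setT src;
  src_submersion : forall g, limg (mdiff setT src g) = fullv;
  tgt_smooth : smooth_map setT tgt;
  tgt_submersion : forall g, limg (mdiff setT tgt g) = fullv;
  unt_smooth : smooth_map setT unt;
  inv_smooth : smooth_map setT inv;
  mul_smooth : @smooth_map R (prodm garr garr) garr
    [set p | src p.1 = tgt p.2] (fun p => mul p.1 p.2)
}.

(* The string of arrows gs = [:: g_1; ...; g_k] is composable, with source x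
   and target y; the empty string has the same source and target. *)
Fixpoint gpath (R : realType) (G : lie_groupoid R) (x : gobj G) (gs : seq G)
    (y : gobj G) : Prop :=
  if gs is g :: gs' then tgt g = y /\ gpath x gs' (src g) else x = y.

Definition stgt (R : realType) (G : lie_groupoid R) (x : gobj G) (gs : seq G) :
    gobj G :=
  if gs is g :: _ then tgt g else x.

Definition arrows (R : realType) (G : lie_groupoid R) (k : nat)
    (q : prodm (gobj G) (powm G k)) : seq G :=
  (q.2 : k.-tuple G).

(* The strings of length k, each preceded by its source: this gives M for
   k = 0, and the source is redundant for k > 0. *)
Definition nerve (R : realType) (G : lie_groupoid R) (k : nat) :
    set (prodm (gobj G) (powm G k)) :=
  [set q | gpath q.1 (arrows q) (stgt q.1 (arrows q))].

(* [:: g_1; ...; g_j g_{j+1}; ...; g_k], for 1 <= j < k *)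
Definition contract (R : realType) (G : lie_groupoid R) (j : nat) (gs : seq G) :
    seq G :=
  take j.-1 gs ++
  (if drop j.-1 gs is g :: h :: gs' then mul g h :: gs' else [::]).

(** * Representations up to homotopy *)

Definition gprebundle (R : realType) (N : charted R) := int -> prebundle N.

Definition is_bounded_gbundle (R : realType) (N : charted R)
    (E : gprebundle N) : Prop :=
  (forall i, is_vbundle (E i)) /\
  exists b : nat, forall (i : int) (x : N), (b < `|i|)%N ->
    \dim (fullv : {vspace E i x}) = 0%N.

(* [Q k gs x y i j] is the component from degree i to degree j of the operator
   R_k at the string gs of length k, with source x and target y.  Only its
   values with [size gs = k] and [gpath x gs y] are meaningful.  Source and
   target are arguments so that, for instance, the fibres at [tgt (mul g h)]
   and at [tgt g] need no conversion. *)
Definition cochains (R : realType) (G : lie_groupoid R)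
    (E : gprebundle (gobj G)) :=
  nat -> seq G -> forall (x y : gobj G) (i j : int), 'Hom(E i x, E j y).

Record is_ruth (R : realType) (G : lie_groupoid R) (E : gprebundle (gobj G))
    (Q : cochains E) : Prop := IsRuth {
  ruth_bundle : is_bounded_gbundle E;
  ruth_degree : forall k (gs : seq G) x y (i j : int),
    size gs = k -> gpath x gs y -> j != i + 1 - k%:Z -> Q k gs x y i j = 0;
  ruth_smooth : forall k (i j : int),
    @smooth_hom R (prodm (gobj G) (powm G k)) (gobj G) (gobj G)
      (@nerve R G k) (fun q => q.1) (fun q => stgt q.1 (arrows q)) (E i) (E j)
      (fun q => Q k (arrows q) q.1 (stgt q.1 (arrows q)) i j);
  ruth_eq : forall k (gs : seq G) x y (i : int),
    size gs = k -> gpath x gs y ->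
    \sum_(1 <= j < k)
      (-1) ^+ j *: Q k.-1 (contract j gs) x y i (i + 2 - k%:Z) =
    \sum_(0 <= j < k.+1)
      (-1) ^+ j *:
        (Q j (take j gs) (stgt x (drop j gs)) y
             (i + 1 - (k - j)%N%:Z) (i + 2 - k%:Z) \o
         Q (k - j)%N (drop j gs) x (stgt x (drop j gs))
             i (i + 1 - (k - j)%N%:Z))%VF
}.

Record is_unital (R : realType) (G : lie_groupoid R) (E : gprebundle (gobj G))
    (Q : cochains E) : Prop := IsUnital {
  unital_id : forall x i, Q 1%N [:: unt x] x x i i = \1%VF;
  unital_zero : forall k (gs gs' : seq G) z x y i j,
    (2 <= k)%N -> size (gs ++ unt z :: gs') = k ->
    gpath x (gs ++ unt z :: gs') y ->
    Q k (gs ++ unt z :: gs') x y i j = 0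
}.

(** * The Lie algebroid *)

Definition algd (R : realType) (G : lie_groupoid R) (x : gobj G) : vectType R :=
  subvs_of (lker (mdiff setT (@src R G) (unt x))).

Definition algd_incl (R : realType) (G : lie_groupoid R) (x : gobj G) :
    'Hom(algd x, tangent (unt x)) :=
  linfun vsval.

(* The identity of the fibre at x when x = y (the types of the two fibres are
   then equal, but convertible only if x and y are). *)
Definition algd_cast (R : realType) (G : lie_groupoid R) (x y : gobj G) :
    'Hom(algd x, algd y) :=
  linfun (fun a : algd x => vsproj _ (algd_incl x a) : algd y).

(* The smooth structure is that of a subbundle of the restriction of TG to the
   units: a frame is smooth when it is so as a family of vector fields along
   the unit map. *)
Definition algebroid (R : realType) (G : lie_groupoid R) : prebundle (gobj G) :=
  @Prebundle R (gobj G) (@algd R G)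
    [set e | is_frame e /\
      forall e', frames (tangent_bundle G) e' ->
        @smooth_coef R (gobj G) (gobj G) G setT id (@unt R G)
          (@algd R G) (@tangent R G) e e' (@algd_incl R G)].

Definition anchor (R : realType) (G : lie_groupoid R) (x : gobj G) :
    'Hom(algd x, tangent x) :=
  (mdiff setT (@tgt R G) (unt x) \o algd_incl x)%VF.

(* Right multiplication by g is defined on the source fibre of [tgt g]. *)
Definition rtrans (R : realType) (G : lie_groupoid R) (g : G) :
    'Hom(algd (tgt g), tangent g) :=
  (mdiff [set h | src h = tgt g] (fun h => mul h g) (unt (tgt g)) \o
   algd_incl (tgt g))%VF.

Definition ltrans (R : realType) (G : lie_groupoid R) (g : G) :
    'Hom(algd (src g), tangent g) :=
  (mdiff [set h | src h = src g] (fun h => mul g (inv h)) (unt (src g)) \o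
   algd_incl (src g))%VF.

Definition dmul (R : realType) (G : lie_groupoid R) (g h : G)
    (v : tangent g) (w : tangent h) : tangent (mul g h) :=
  @mdiff R (prodm G G) G [set p | src p.1 = tgt p.2]
    (fun p => mul p.1 p.2) (g, h) (row_mx v w).

(** * Ehresmann connections *)

Record is_ehresmann (R : realType) (G : lie_groupoid R)
    (sigma : forall g : G, 'Hom(tangent (src g), tangent g)) : Prop :=
  IsEhresmann {
    ehr_smooth : @smooth_hom R G (gobj G) G setT (@src R G) id
      (tangent_bundle (gobj G)) (tangent_bundle G) sigma;
    ehr_split : forall g, (mdiff setT (@src R G) g \o sigma g)%VF = \1%VF;
    ehr_unit : forall x, sigma (unt x) = mdiff setT (@unt R G) x
  }.

Definition is_left_splitting (R : realType) (G : lie_groupoid R)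
    (sigma : forall g : G, 'Hom(tangent (src g), tangent g)) (g : G)
    (w : 'Hom(tangent g, algd (tgt g))) : Prop :=
  (w \o rtrans g)%VF = \1%VF /\
  (rtrans g \o w)%VF + (sigma g \o mdiff setT (@src R G) g)%VF = \1%VF.

(* The two equations determine the left splitting. *)
Definition left_splitting (R : realType) (G : lie_groupoid R)
    (sigma : forall g : G, 'Hom(tangent (src g), tangent g)) (g : G) :
    'Hom(tangent g, algd (tgt g)) :=
  xget 0 [set w | is_left_splitting sigma w].

Definition qact_T (R : realType) (G : lie_groupoid R)
    (sigma : forall g : G, 'Hom(tangent (src g), tangent g)) (g : G) :
    'Hom(tangent (src g), tangent (tgt g)) :=
  (mdiff setT (@tgt R G) g \o sigma g)%VF.

Definition qact_A (R : realType) (G : lie_groupoid R)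
    (sigma : forall g : G, 'Hom(tangent (src g), tangent g)) (g : G) :
    'Hom(algd (src g), algd (tgt g)) :=
  - (left_splitting sigma g \o ltrans g)%VF.

(* [qact_T sigma h v] lies in the tangent space at [tgt h], which is that at
   [src g] for composable g and h. *)
Definition basic_curv (R : realType) (G : lie_groupoid R)
    (sigma : forall g : G, 'Hom(tangent (src g), tangent g)) (g h : G) :
    'Hom(tangent (src h), algd (tgt (mul g h))) :=
  linfun (fun v : tangent (src h) =>
    left_splitting sigma (mul g h)
      (dmul (sigma g (qact_T sigma h v)) (sigma h v))).

(** * The adjoint representation *)

Definition Ad (R : realType) (G : lie_groupoid R) : gprebundle (gobj G) :=
  fun i => match i with
    | Posz 0 => algebroid G
    | Posz 1 => tangent_bundle (gobj G)
    | _ => zero_bundle (gobj G)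
    end.

Definition Ad_ops (R : realType) (G : lie_groupoid R)
    (sigma : forall g : G, 'Hom(tangent (src g), tangent g)) :
    cochains (Ad G) :=
  fun k gs x y i j =>
    match i as i, j as j return 'Hom(Ad G i x, Ad G j y) with
    | Posz 0, Posz 1 => if k is 0 then anchor x else 0
    | Posz 0, Posz 0 =>
        match k, gs return 'Hom(algd x, algd y) with
        | 1, [:: g] =>
            (algd_cast (tgt g) y \o qact_A sigma g \o algd_cast x (src g))%VF
        | _, _ => 0
        end
    | Posz 1, Posz 1 =>
        match k, gs return 'Hom(tangent x, tangent y) with
        | 1, [:: g] => qact_T sigma g
        | _, _ => 0
        end
    | Posz 1, Posz 0 =>
        match k, gs return 'Hom(tangent x, algd y) with
        | 2, [:: g; h] =>
            (algd_cast (tgt (mul g h)) y \o basic_curv sigma g h)%VF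
        | _, _ => 0
        end
    | _, _ => 0
    end.

(* Main.v *)
(* Tangent vectors are handled through curves: the differential of a map along
   a submanifold is the velocity of the image curve, and curves lift through
   submersions (a contraction argument).  So every identity of the groupoid
   holds for the differentials of its structure maps, which thus form a groupoid
   on the tangent vectors.  Right translation by [g] identifies the fibre of [A]
   at [t(g)] with the kernel of [ds] at [g]; after translation the structure
   equations become identities of the tangent groupoid, the essential one being
   [dm (l_g a, r_h a) = 0], because [(g x^-1) (x h) = g h] for all [x].
   The inverse of right translation by [g] is right translation by [g^-1], so the
   operators are composites of differentials and of [sigma], hence smooth. *)
Require Import Defs.
From HB Require Import structures.
From mathcomp Require Import all_boot all_order all_algebra.
From mathcomp Require Import all_classical all_reals all_analysis.
From mathcomp Require Import ring lra zify.

Set Implicit Arguments.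
Unset Strict Implicit.
Unset Printing Implicit Defensive.

Import Order.TTheory GRing.Theory Num.Theory.
Import numFieldNormedType.Exports.

Local Open Scope classical_set_scope.
Local Open Scope ring_scope.

Local Notation inv := Defs.inv.
Local Notation mul := Defs.mul.

(** * Smooth functions *)

(** The set of composable pairs is never made into a manifold: differentials along it come from an
    arbitrarily chosen local extension, so [Dmul] is controlled only on velocities of curves of
    composable pairs. Hence every pair of vectors with matching [Dsrc] and [Dtgt] must first be
    realised by such a curve. The lifted curve is found by solving one equation for each time
    separately, so [vel] asks for differentiability at time 0 only. Fibres of [A] over equal but not
    convertible points have different types. All vectors are therefore sent to plain row vectors
    ([aval]), and the algebra is done over abstract additive groups ([tangent_groupoid]); scalars
    return when linear maps are reconstructed. The bundle [A] needs two constructions of its own.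
    Local frames are produced by moving a basis of one kernel to the nearby kernels, and the
    coefficients of a vector in a frame are recovered from its image in [TG]. The matrix of a frame
    is not square, so it is inverted only after multiplication by a one-sided inverse taken at the
    centre. *)

Section SmoothCalculus.
Variable R : realType.
Implicit Types V W : normedModType R.

Lemma near_is_diff V W (f g : V -> W) (x : V) (df : V -> W) :
  (\forall y \near x, f y = g y) -> is_diff x f df -> is_diff x g df.
Proof.
move=> fg [dif <-].
have [cf Ef] := (diff_locallyP x f).1 dif.
have gx : g x = f x by rewrite (nbhs_singleton fg).
have Eg : g \o shift x = cst (g x) + 'd f x +o_ 0 id.
  apply/eqaddoP => e e0.
  move: Ef => /eqaddoP/(_ e e0) Ef.
  have fg0 : \forall h \near (0:V), f (h + x) = g (h + x).
    by by move: fg; rewrite (near_shift 0) subr0.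
  near=> h.
  have <- : (f \o shift x - (cst (f x) + 'd f x)) h = (g \o shift x - (cst (g x) + 'd f x)) h.
    rewrite !fctE /= gx; congr (_ - _).
    by near: h.
  by near: h.
have dg : 'd g x = 'd f x :> (V -> W) by exact: diff_unique.
apply: DiffDef; last exact: dg.
by apply/diff_locallyP; rewrite dg.
Unshelve. all: by end_near. Qed.

Lemma near_differentiable V W (f g : V -> W) (x : V) :
  (\forall y \near x, f y = g y) -> differentiable f x -> differentiable g x.
Proof. by move=> fg /differentiableP/(near_is_diff fg) []. Qed.

Lemma near_diff V W (f g : V -> W) (x : V) :
  (\forall y \near x, f y = g y) -> differentiable f x ->
  'd g x = 'd f x :> (V -> W).
Proof. by move=> fg /differentiableP/(near_is_diff fg) []. Qed.

Lemma open_near V (U : set V) (P : V -> Prop) x :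
  open U -> U x -> (forall y, U y -> P y) -> \forall y \near x, P y.
Proof. by move=> oU Ux UP; apply: filterS UP _; apply: open_nbhs_nbhs. Qed.

(** A derivative depends only on the germ, so agreement on an open set passes to all derivatives.
    Later proofs use this to replace a derivative by an explicit formula. *)
Lemma Ck_ext V W k (U : set V) (f g : V -> W) :
  open U -> (forall x, U x -> f x = g x) -> Ck k U f -> Ck k U g.
Proof.
move=> oU; elim: k f g => [|k IH] f g fg /=.
  move=> cf x Ux; have := cf x Ux; rewrite /prop_for /continuous_at (fg x Ux).
  apply: cvg_trans; apply: near_eq_cvg.
  by apply: open_near oU Ux _ => y Uy; rewrite fg.
move=> [df Cf].
have fgn x (Ux : U x) : \forall y \near x, f y = g y by apply: open_near oU Ux _.
split=> [x Ux|v]; first exact: near_differentiable (fgn x Ux) (df x Ux).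
apply: IH (Cf v) => x Ux.
by rewrite (near_diff (fgn x Ux) (df x Ux)).
Qed.

Lemma Ck_sub V W k (U U' : set V) (f : V -> W) :
  U' `<=` U -> Ck k U f -> Ck k U' f.
Proof.
move=> UU'; elim: k f => [|k IH] f /=; first by move=> cf x /UU' /cf.
by move=> [df Cf]; split=> [x /UU' /df//|v]; exact: IH.
Qed.

Lemma CkS V W k (U : set V) (f : V -> W) : Ck k.+1 U f -> Ck k U f.
Proof.
elim: k f => [|k IH] f [df Cf].
  by move=> x /df /differentiable_continuous.
by split => // v; exact: IH.
Qed.

Lemma Ck_cst V W k (U : set V) (a : W) : Ck k U (fun=> a).
Proof.
elim: k a => [|k IH] a /=; first by move=> x _; exact: cst_continuous.
split=> [x _|v]; first exact: differentiable_cst.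
rewrite (_ : (fun _ => _) = fun=> 0); first exact: IH.
by apply/funext => x; rewrite diff_cst.
Qed.

Lemma CkD V W k (U : set V) (f g : V -> W) :
  open U -> Ck k U f -> Ck k U g -> Ck k U (fun x => f x + g x).
Proof.
move=> oU; elim: k f g => [|k IH] f g /=.
  by move=> cf cg x Ux; apply: continuousD; [exact: cf|exact: cg].
move=> [df Cf] [dg Cg]; split=> [x Ux|v].
  by apply: differentiableD; [exact: df|exact: dg].
apply: Ck_ext (IH _ _ (Cf v) (Cg v)) => // x Ux.
by rewrite -[fun x => f x + g x]/(f + g) diffD//; [exact: df|exact: dg].
Qed.

Lemma Ck_sum V W k (U : set V) (I : Type) (r : seq I) (P : pred I)
    (f : I -> V -> W) :
  open U -> (forall i, P i -> Ck k U (f i)) ->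
  Ck k U (fun x => \sum_(i <- r | P i) f i x).
Proof.
move=> oU Cf; elim: r => [|i r IH].
  rewrite (_ : (fun _ => _) = fun=> 0); first exact: Ck_cst.
  by apply/funext => x; rewrite big_nil.
case: (boolP (P i)) => Pi.
  rewrite (_ : (fun _ => _) = fun x => f i x + \sum_(i <- r | P i) f i x).
    by apply: CkD => //; exact: Cf.
  by apply/funext => x; rewrite big_cons Pi.
rewrite (_ : (fun _ => _) = fun x => \sum_(i <- r | P i) f i x) //.
by apply/funext => x; rewrite big_cons (negbTE Pi).
Qed.

Lemma Ck_lin V W W' k (U : set V) (f : V -> W) (L : {linear W -> W'}) :
  continuous L -> open U -> Ck k U f -> Ck k U (L \o f).
Proof.
move=> cL oU; elim: k f => [|k IH] f /=.
  by move=> cf x Ux; apply: continuous_comp; [exact: cf|exact: cL].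
move=> [df Cf]; split=> [x Ux|v].
  by apply: differentiable_comp; [exact: df|exact: linear_differentiable].
apply: Ck_ext (IH _ (Cf v)) => // x Ux.
rewrite diff_comp/= ?diff_lin//; first exact: df.
exact: linear_differentiable.
Qed.

Lemma CkM V k (U : set V) (f g : V -> R) :
  open U -> Ck k U f -> Ck k U g -> Ck k U (fun x => f x * g x).
Proof.
move=> oU; elim: k f g => [|k IH] f g.
  by move=> cf cg x Ux; apply: continuousM; [exact: cf|exact: cg].
move=> Cf1 Cg1; have [df Cf] := Cf1; have [dg Cg] := Cg1; split=> [x Ux|v].
  by apply: differentiableM; [exact: df|exact: dg].
apply: (@Ck_ext _ _ _ _ (fun x => f x * 'd g x v + g x * 'd f x v)) => //.
  move=> x Ux.
  rewrite -[fun x => f x * g x]/(f * g) diffM//; [exact: df|exact: dg].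
by apply: CkD => //; apply: IH; [exact: CkS|exact: Cg|exact: CkS|exact: Cf].
Qed.

Lemma Ck_prod V k (U : set V) (I : Type) (r : seq I) (P : pred I)
    (f : I -> V -> R) :
  open U -> (forall i, P i -> Ck k U (f i)) ->
  Ck k U (fun x => \prod_(i <- r | P i) f i x).
Proof.
move=> oU Cf; elim: r => [|i r IH].
  rewrite (_ : (fun _ => _) = fun=> 1); first exact: Ck_cst.
  by apply/funext => x; rewrite big_nil.
case: (boolP (P i)) => Pi.
  rewrite (_ : (fun _ => _) = fun x => f i x * \prod_(i <- r | P i) f i x).
    by apply: CkM => //; exact: Cf.
  by apply/funext => x; rewrite big_cons Pi.
rewrite (_ : (fun _ => _) = fun x => \prod_(i <- r | P i) f i x) //.
by apply/funext => x; rewrite big_cons (negbTE Pi).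
Qed.

(** The derivative of [1 / f] is a product of [1 / f] with itself and with the derivative of [f]; at
    one order less, the induction hypothesis covers [1 / f], and [CkM] does the rest. *)
Lemma CkV V k (U : set V) (f : V -> R) :
  open U -> (forall x, U x -> f x != 0) -> Ck k U f ->
  Ck k U (fun x => (f x)^-1).
Proof.
move=> oU f0; elim: k => [|k IH].
  by move=> cf x Ux; apply: continuousV; [exact: f0|exact: cf].
move=> Cf1; have [df Cf] := Cf1; split=> [x Ux|v].
  by apply: differentiableV; [exact: df|exact: f0].
apply: (@Ck_ext _ _ _ _ (fun x => -1 * (((f x)^-1) * ((f x)^-1) * 'd f x v))) => //.
  move=> x Ux; rewrite diffV//; [|exact: df|exact: f0].
  by rewrite mulN1r -invfM -expr2 -mulNr.
apply: CkM => //; first exact: Ck_cst.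
have CV := IH (CkS Cf1).
by apply: CkM => //; [exact: CkM|exact: Cf].
Qed.

Definition coord_fun m n (i : 'I_m) (j : 'I_n) (N : 'M[R]_(m, n)) : R := N i j.
Lemma coord_fun_linear m n (i : 'I_m) (j : 'I_n) : linear (@coord_fun m n i j).
Proof. by move=> a x y; rewrite /coord_fun !mxE. Qed.
HB.instance Definition _ m n (i : 'I_m) (j : 'I_n) :=
  GRing.isLinear.Build _ _ _ _ (@coord_fun m n i j) (@coord_fun_linear m n i j).

Definition scale_fun W (w : W) (r : R) : W := r *: w.
Lemma scale_fun_linear W (w : W) : linear (scale_fun w : R^o -> W).
Proof. by move=> a x y; rewrite /scale_fun scalerDl scalerA. Qed.
HB.instance Definition _ W (w : W) :=
  GRing.isLinear.Build R R^o W _ (scale_fun w) (@scale_fun_linear W w).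

Lemma Ck_mxP V k (U : set V) m n (f : V -> 'M[R]_(m, n)) : open U ->
  Ck k U f <-> forall i j, Ck k U (fun x => f x i j).
Proof.
move=> oU; split=> [Cf i j|Cf].
  exact: (@Ck_lin _ _ _ _ _ _ (coord_fun i j) (@coord_continuous R m n i j) oU Cf).
apply: (@Ck_ext _ _ _ _ (fun x => \sum_i \sum_j f x i j *: (delta_mx i j : 'M[R]_(m,n)))) => //.
  by move=> x Ux; rewrite -matrix_sum_delta.
apply: Ck_sum => // i _; apply: Ck_sum => // j _.
apply: (@Ck_lin _ _ _ _ _ (fun x => f x i j) (scale_fun (delta_mx i j : 'M[R]_(m,n)) : {linear R^o -> _})) => //.
exact: scalel_continuous.
Qed.

Lemma mx_linear_continuous m n W (L : {linear 'M[R]_(m, n) -> W}) :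
  continuous L.
Proof.
move=> x.
have -> : (L : _ -> _) = (fun y => \sum_i \sum_j (coord_fun i j y) *: L (delta_mx i j)).
  apply/funext => y; rewrite {1}[y]matrix_sum_delta linear_sum.
  apply: eq_bigr => i _; rewrite linear_sum; apply: eq_bigr => j _.
  by rewrite linearZ.
(* [Ck 0 setT] is continuity everywhere, so the sum lemma for [Ck] yields continuity of a sum. *)
apply: (@Ck_sum _ _ 0 setT) => // [|i _]; first exact: openT.
apply: (@Ck_sum _ _ 0 setT) => // [|j _]; first exact: openT.
move=> y _.
apply: (@continuous_comp _ _ _ (coord_fun i j) (fun r : R^o => r *: L (delta_mx i j))).
  exact: coord_continuous.
exact: scalel_continuous.
Qed.

(* Expanding [v] along the standard basis turns the chain rule into a sum of
   products of functions of lower order. *)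
Lemma Ck_comp V n W k (U : set V) (U' : set 'rV[R]_n) (f : V -> 'rV[R]_n)
    (g : 'rV[R]_n -> W) :
  open U -> open U' -> (forall x, U x -> U' (f x)) ->
  Ck k U f -> Ck k U' g -> forall L : {linear W -> R^o}, continuous L ->
  Ck k U (fun x => L (g (f x)) : R).
Proof.
move=> oU oU' fU; elim: k g => [|k IH] g.
  move=> cf cg L cL x Ux.
  apply: (@continuous_comp _ _ _ (g \o f) L); last exact: cL.
  by apply: continuous_comp; [exact: cf|apply/cg/fU].
move=> Cf1 Cg1 L cL; have [df Cf] := Cf1; have [dg Cg] := Cg1.
have dL y : differentiable L y by exact: linear_differentiable.
have dgf x (Ux : U x) : differentiable (g \o f) x.
  by apply: differentiable_comp; [exact: df|apply/dg/fU].
split=> [x Ux|v].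
  by apply: (@differentiable_comp _ _ _ _ (g \o f) L) => //; exact: dgf.
apply: (@Ck_ext _ _ _ _ (fun x => \sum_j 'd f x v 0 j * L ('d g (f x) (delta_mx 0 j)))) => //.
  move=> x Ux.
  rewrite -[fun x => L _]/(L \o (g \o f)).
  rewrite [in RHS](diff_comp (f := g \o f) (dgf x Ux) (dL _)) /= diff_lin//.
  rewrite (diff_comp (f := f) (df x Ux) (dg _ (fU x Ux))) /=.
  rewrite [in RHS](row_sum_delta ('d f x v)) !linear_sum.
  by apply: eq_bigr => j _; rewrite !linearZ.
apply: Ck_sum => // j _; apply: CkM => //.
  by have /(Ck_mxP _ _ oU)/(_ 0 j) := Cf v.
apply: (IH (fun y => 'd g y (delta_mx 0 j))) => //; [exact: CkS|exact: Cg].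
Qed.

Lemma Ck_comp_mx V n k (U : set V) (U' : set 'rV[R]_n) (f : V -> 'rV[R]_n)
    p q (g : 'rV[R]_n -> 'M[R]_(p, q)) :
  open U -> open U' -> (forall x, U x -> U' (f x)) ->
  Ck k U f -> Ck k U' g -> Ck k U (g \o f).
Proof.
move=> oU oU' fU Cf Cg; apply/Ck_mxP => // i j.
apply: (Ck_comp oU oU' fU Cf Cg (L := coord_fun i j)).
exact: coord_continuous.
Qed.

End SmoothCalculus.

(** * Smooth matrix-valued functions: products, inverses, composition, Jacobians *)

Section SmoothFun.
Variable R : realType.
Implicit Types V W : normedModType R.

Lemma open_setI_preimage (V T : topologicalType) (U : set V) (f : V -> T)
    (B : set T) :
  open U -> (forall x, U x -> {for x, continuous f}) -> open B ->
  open (U `&` f @^-1` B).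
Proof.
move=> oU cf oB; rewrite openE => x [Ux Bfx]; apply: filterI.
  exact: open_nbhs_nbhs.
by apply: cf => //; apply: open_nbhs_nbhs.
Qed.

Lemma smooth_continuous V W (U : set V) (f : V -> W) :
  smooth_fun U f -> forall x, U x -> {for x, continuous f}.
Proof. by move=> sf; exact: (sf 0%N). Qed.

Lemma smooth_differentiable V W (U : set V) (f : V -> W) :
  smooth_fun U f -> forall x, U x -> differentiable f x.
Proof. by move=> sf; have [] := sf 1%N. Qed.

Lemma smooth_diff V W (U : set V) (f : V -> W) v :
  smooth_fun U f -> smooth_fun U (fun x => 'd f x v).
Proof. by move=> sf k; have [_] := sf k.+1; exact. Qed.

Lemma smooth_sub V W (U U' : set V) (f : V -> W) :
  U' `<=` U -> smooth_fun U f -> smooth_fun U' f.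
Proof. by move=> UU' sf k; apply: Ck_sub (sf k). Qed.

Lemma smooth_ext V W (U : set V) (f g : V -> W) :
  open U -> (forall x, U x -> f x = g x) -> smooth_fun U f -> smooth_fun U g.
Proof. by move=> oU fg sf k; apply: Ck_ext (sf k). Qed.

Lemma smooth_mxP V (U : set V) m n (f : V -> 'M[R]_(m, n)) : open U ->
  smooth_fun U f <-> forall i j, smooth_fun U (fun x => f x i j).
Proof.
move=> oU; split=> [sf i j k|sf k]; last by apply/Ck_mxP => // i j; apply: sf.
by have /(Ck_mxP _ _ oU) := sf k.
Qed.

Lemma smooth_mulmx V (U : set V) m n k (f : V -> 'M[R]_(m, n))
    (g : V -> 'M[R]_(n, k)) :
  open U -> smooth_fun U f -> smooth_fun U g -> smooth_fun U (fun x => f x *m g x).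
Proof.
move=> oU /(smooth_mxP _ oU) sf /(smooth_mxP _ oU) sg; apply/smooth_mxP => // i j l.
rewrite (_ : (fun _ => _) = fun x => \sum_h f x i h * g x h j).
  by apply: Ck_sum => // h _; apply: CkM => //; [exact: sf|exact: sg].
by apply/funext => x; rewrite mxE.
Qed.

Lemma smooth_det V (U : set V) n (f : V -> 'M[R]_n) :
  open U -> smooth_fun U f -> smooth_fun U (fun x => \det (f x)).
Proof.
move=> oU /(smooth_mxP _ oU) sf k; apply: Ck_sum => // s _.
apply: CkM => //; first exact: Ck_cst.
by apply: Ck_prod => // i _; exact: sf.
Qed.

Lemma smooth_invmx V (U : set V) n (f : V -> 'M[R]_n) :
  open U -> (forall x, U x -> f x \in unitmx) -> smooth_fun U f ->
  smooth_fun U (fun x => invmx (f x)).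
Proof.
move=> oU fU sf; apply: (@smooth_ext _ _ _ (fun x => (\det (f x))^-1 *: \adj (f x))) => //.
  by move=> x Ux; rewrite /invmx fU.
apply/smooth_mxP => // i j k.
rewrite (_ : (fun _ => _) = fun x => (\det (f x))^-1 *
   ((-1) ^+ (j + i) * \det (row' j (col' i (f x))))); last first.
  by apply/funext => x; rewrite !mxE.
apply: CkM => //.
  apply: CkV => //; last exact: smooth_det.
  by move=> x Ux; rewrite -unitfE; exact: fU.
apply: CkM => //; first exact: Ck_cst.
apply: smooth_det => //; apply/smooth_mxP => // a b.
rewrite (_ : (fun _ => _) = fun x => f x (lift j a) (lift i b)).
  by move/(smooth_mxP _ oU) : sf.
by apply/funext => x; rewrite !mxE.
Qed.

Lemma smooth_comp V n p q (U : set V) (U' : set 'rV[R]_n) (f : V -> 'rV[R]_n)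
    (g : 'rV[R]_n -> 'M[R]_(p, q)) :
  open U -> open U' -> (forall x, U x -> U' (f x)) ->
  smooth_fun U f -> smooth_fun U' g -> smooth_fun U (g \o f).
Proof. by move=> oU oU' fU sf sg k; apply: Ck_comp_mx (sf k) (sg k). Qed.

Lemma smooth_linear m n p q (U : set 'M[R]_(m, n)) (L : {linear 'M[R]_(m, n) -> 'M[R]_(p, q)}) :
  smooth_fun U L.
Proof.
have cL := @mx_linear_continuous R _ _ _ L.
case=> [x _|k /=]; first exact: cL.
split=> [x _|v]; first exact: linear_differentiable.
rewrite (_ : (fun _ => _) = fun=> L v); first exact: Ck_cst.
by apply/funext => x; rewrite diff_lin.
Qed.

Lemma mul_jacobian m n (f : 'rV[R]_m -> 'rV[R]_n) x v :
  v *m 'J f x = 'd f x v.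
Proof. exact: mul_rV_lin1. Qed.

Lemma smooth_jacobian m n (U : set 'rV[R]_m) (f : 'rV[R]_m -> 'rV[R]_n) :
  open U -> smooth_fun U f -> smooth_fun U (jacobian f).
Proof.
move=> oU sf; apply/smooth_mxP => // i j.
rewrite (_ : (fun _ => _) = fun x => 'd f x (delta_mx 0 i) 0 j).
  by have /(smooth_mxP _ oU) := smooth_diff (delta_mx 0 i) sf; exact.
by apply/funext => x; rewrite !mxE.
Qed.

End SmoothFun.

(** * Neighbourhoods of a point along a subset *)

Section Germs.
Variable R : realType.
Implicit Types N P Q : charted R.
Implicit Types V W : normedModType R.

(** The neighbourhood filter of [p] within [S], read in the single chart at [p]. Quantifying over
    the points with given coordinates avoids the inverse chart, so the filter makes sense on any
    [charted] set. Products and powers are only used as such. *)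
Definition mnbhs N (S : set N) (p : N) : set_system N :=
  [set A | \forall y \near chart p p,
    forall q, S q -> mdom p q -> chart p q = y -> A q].

Lemma mnbhsE N (S : set N) (p : N) (A : set N) : mnbhs S p A =
  \forall y \near chart p p, forall q, S q -> mdom p q -> chart p q = y -> A q.
Proof. by []. Qed.

Global Instance mnbhs_filter N (S : set N) (p : N) : Filter (mnbhs S p).
Proof.
split; first by rewrite mnbhsE; apply: (@nearW _ (nbhs (chart p p)) _).
- move=> A B; rewrite !mnbhsE => nA nB.
  by apply: filterS2 nA nB => y HA HB q Sq dq Ey; split; [exact: HA|exact: HB].
- move=> A B AB; rewrite !mnbhsE => nA.
  by apply: filterS nA => y HA q Sq dq Ey; exact/AB/HA.
Qed.

Lemma mnbhs_dom N (S : set N) (p : N) : \forall q \near mnbhs S p, mdom p q.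
Proof. by rewrite nearE mnbhsE; apply: (@nearW _ (nbhs (chart p p)) _). Qed.

Lemma mnbhs_in N (S : set N) (p : N) : \forall q \near mnbhs S p, S q.
Proof. by rewrite nearE mnbhsE; apply: (@nearW _ (nbhs (chart p p)) _). Qed.

Lemma mnbhs_chart N (S : set N) (p : N) (O : set 'rV[R]_(mdim N)) :
  open O -> O (chart p p) -> \forall q \near mnbhs S p, O (chart p q).
Proof. by move=> oO Op; apply: open_near oO Op _ => y Oy q _ _ ->. Qed.

Lemma local_ext_cvg N P (S : set N) (S' : set P) (f : N -> P) p O F :
  mdom p p -> S p -> (forall q, S q -> S' (f q)) -> local_ext S f p O F ->
  f @ mnbhs S p --> mnbhs S' (f p).
Proof.
move=> dp Sp SS' [oO Op sF EF] A nA; change (mnbhs S p (f @^-1` A)).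
rewrite mnbhsE; change (mnbhs S' (f p) A) in nA; rewrite mnbhsE in nA.
have [dfp EFp] := EF p Sp dp Op.
have cF := smooth_continuous sF Op.
rewrite EFp in nA; have {}nA := cF _ nA.
near=> y => q Sq dq Ey.
have Oy : O y by near: y; exact: open_nbhs_nbhs.
have nAy : forall r, S' r -> mdom (f p) r -> chart (f p) r = F y -> A r.
  by near: y.
rewrite -{}Ey in Oy nAy; have [df E] := EF q Sq dq Oy.
by apply: nAy => //; exact: SS'.
Unshelve. all: by end_near. Qed.

End Germs.

(** * Germs of smooth maps between manifolds *)

Section CSmooth.
Variable R : realType.
Implicit Types N P Q : charted R.
Implicit Types V W : normedModType R.

(** Smooth germs with values in one fixed space; matrices of coefficients live here, whereas
    [smooth_at] is the notion for maps into a charted set. *)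
Definition csmooth N W (S : set N) (p : N) (phi : N -> W) : Prop :=
  exists (O : set 'rV[R]_(mdim N)) (c : 'rV[R]_(mdim N) -> W),
  [/\ open O, O (chart p p), smooth_fun O c &
   forall q, S q -> mdom p q -> O (chart p q) -> phi q = c (chart p q)].

(** [O] may be shrunk to the interior of the set of coordinates where the equality holds. Thanks to
    this, identities between families need to be verified only at points close to [p]. *)
Lemma csmooth_near N W (S : set N) p (phi psi : N -> W) :
  (\forall q \near mnbhs S p, phi q = psi q) -> csmooth S p phi ->
  csmooth S p psi.
Proof.
rewrite nearE mnbhsE; move/nbhs_interior => nphi [ O [c [oO Op sc E]]].
exists (O `&` interior [set y | forall q : N, S q -> mdom p q -> chart p q = y -> phi q = psi q]), c; split.
- by apply: openI => //; exact: open_interior.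
- by split; last exact: nbhs_singleton nphi.
- by apply: smooth_sub sc; exact: subIsetl.
- move=> q Sq dq [Oq /interior_subset Hq].
  by rewrite -(E q)//; apply/esym/Hq.
Qed.

Lemma csmooth_cst N W (S : set N) p (a : W) : csmooth S p (fun=> a).
Proof.
exists setT, (fun=> a); split => //; first exact: openT.
by move=> k; exact: Ck_cst.
Qed.

Lemma csmooth_op2 N (W1 W2 W3 : normedModType R) (op : W1 -> W2 -> W3)
    (S : set N) p (phi : N -> W1) (psi : N -> W2) :
  (forall V (U : set V) f g, open U -> smooth_fun U f -> smooth_fun U g ->
    smooth_fun U (fun x => op (f x) (g x))) ->
  csmooth S p phi -> csmooth S p psi -> csmooth S p (fun q => op (phi q) (psi q)).
Proof.
move=> sop [ O [c [oO Op sc E]]] [ O' [c' [oO' Op' sc' E']]].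
exists (O `&` O'), (fun y => op (c y) (c' y)); split.
- exact: openI.
- by [].
- apply: sop; first exact: openI.
    by apply: smooth_sub sc; exact: subIsetl.
  by apply: smooth_sub sc'; exact: subIsetr.
- by move=> q Sq dq [Oq O'q]; rewrite E// E'.
Qed.

Lemma csmoothM N (S : set N) p m n k (phi : N -> 'M[R]_(m, n))
    (psi : N -> 'M[R]_(n, k)) :
  csmooth S p phi -> csmooth S p psi -> csmooth S p (fun q => phi q *m psi q).
Proof. by apply: csmooth_op2 => V U f g; exact: smooth_mulmx. Qed.

Lemma csmoothD N W (S : set N) p (phi psi : N -> W) :
  csmooth S p phi -> csmooth S p psi -> csmooth S p (fun q => phi q + psi q).
Proof.
by apply: csmooth_op2 => V U f g oU sf sg k; apply: CkD.
Qed.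

Lemma csmooth_mxP N (S : set N) p m n (phi : N -> 'M[R]_(m, n)) :
  csmooth S p phi <-> forall i j, csmooth S p (fun q => phi q i j).
Proof.
split=> [[ O [c [oO Op sc E]]] i j|].
  exists O, (fun y => c y i j); split => //.
    by move/(smooth_mxP _ oO): sc.
  by move=> q Sq dq Oq; rewrite E.
move=> H.
pose D ij (Oc : set 'rV[R]_(mdim N) * ('rV[R]_(mdim N) -> R)) :=
  [/\ open Oc.1, Oc.1 (chart p p), smooth_fun Oc.1 Oc.2
   & forall q, S q -> mdom p q -> Oc.1 (chart p q) ->
     phi q ij.1 ij.2 = Oc.2 (chart p q)].
have [h Hh] : {h & forall ij, D ij (h ij)}.
  by apply: choice => -[i j]; have [ O [c HO]] := H i j; exists (O, c).
(* One domain for all entries: there are finitely many index pairs, so the intersection of their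
   domains is still a neighbourhood. *)
pose O := interior [set y | forall ij, (h ij).1 y].
have subO ij : O `<=` (h ij).1 by move=> y /interior_subset /(_ ij).
exists O, (fun y => \matrix_(i, j) (h (i, j)).2 y); split.
- exact: open_interior.
- change (\forall y \near chart p p, forall ij, (h ij).1 y).
  apply: (@filter_forall _ _ (fun ij y => (h ij).1 y) (nbhs (chart p p)) _) => ij.
  by have [oh hp _ _] := Hh ij; apply: open_nbhs_nbhs.
- apply/smooth_mxP; first exact: open_interior.
  move=> i j; rewrite (_ : (fun _ => _) = (h (i, j)).2).
    by have [_ _ sh _] := Hh (i, j); apply: smooth_sub sh; exact: subO.
  by apply/funext => y; rewrite mxE.
- move=> q Sq dq Oq; apply/matrixP => i j; rewrite mxE.
  by have [_ _ _ ->//] := Hh (i, j); exact: subO.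
Qed.

Lemma csmooth_inv N (S : set N) p n (phi : N -> 'M[R]_n) :
  mdom p p -> S p -> phi p \in unitmx -> csmooth S p phi ->
  csmooth S p (fun q => invmx (phi q)).
Proof.
move=> dp Sp phiU [ O [c [oO Op sc E]]].
have cdet y : O y -> {for y, continuous (fun z => \det (c z))}.
  exact/smooth_continuous/smooth_det.
exists (O `&` (fun z => \det (c z)) @^-1` [set r | r != 0]),
  (fun y => invmx (c y)).
have oO' : open (O `&` (fun z => \det (c z)) @^-1` [set r | r != 0]).
  by apply: open_setI_preimage => //; exact: open_neq.
split => //.
- by split => //=; rewrite -unitfE -[_ \is a _]/(_ \in unitmx) -E.
- apply: smooth_invmx => // [y [_ /=]|]; first by rewrite -unitfE.
  by apply: smooth_sub sc; exact: subIsetl.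
- by move=> q Sq dq [Oq _]; rewrite E.
Qed.

Definition smooth_at N P (S : set N) (f : N -> P) (p : N) : Prop :=
  exists O F, local_ext S f p O F.

Lemma smooth_at_cvg N P (S : set N) (S' : set P) (f : N -> P) p :
  mdom p p -> S p -> (forall q, S q -> S' (f q)) -> smooth_at S f p ->
  f @ mnbhs S p --> mnbhs S' (f p).
Proof. by move=> dp Sp SS' [ O [F le]]; apply: local_ext_cvg le. Qed.

Lemma csmooth_comp N P (S : set N) (S' : set P) (f : N -> P) p m n
    (phi : P -> 'M[R]_(m, n)) :
  mdom p p -> S p -> (forall q, S q -> S' (f q)) -> smooth_at S f p ->
  csmooth S' (f p) phi -> csmooth S p (phi \o f).
Proof.
move=> dp Sp SS' [ O [F [oO Op sF EF]]] [ O' [c [oO' Op' sc E]]].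
have [dfp EFp] := EF p Sp dp Op.
have oO2 : open (O `&` F @^-1` O').
  by apply: open_setI_preimage => //; exact: smooth_continuous.
exists (O `&` F @^-1` O'), (c \o F); split => //.
- by split => //=; rewrite -EFp.
- apply: smooth_comp sc => // [y []//|].
  by apply: smooth_sub sF; exact: subIsetl.
- move=> q Sq dq [Oq O'q]; have [dfq EFq] := EF q Sq dq Oq.
  by rewrite /= -EFq; apply: E; [exact: SS'| |rewrite EFq].
Qed.

Lemma smooth_at_comp N P Q (S : set N) (S' : set P) (f : N -> P) (g : P -> Q) p :
  mdom p p -> S p -> (forall q, S q -> S' (f q)) -> smooth_at S f p ->
  smooth_at S' g (f p) -> smooth_at S (g \o f) p.
Proof.
move=> dp Sp SS' [ O [F [oO Op sF EF]]] [ O' [c [oO' Op' sc E]]].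
have [dfp EFp] := EF p Sp dp Op.
have oO2 : open (O `&` F @^-1` O').
  by apply: open_setI_preimage => //; exact: smooth_continuous.
exists (O `&` F @^-1` O'), (c \o F); split => //.
- by split => //=; rewrite -EFp.
- apply: smooth_comp sc => // [y []//|].
  by apply: smooth_sub sF; exact: subIsetl.
- move=> q Sq dq [Oq O'q]; have [dfq EFq] := EF q Sq dq Oq.
  by rewrite /= -EFq; apply: E; [exact: SS'| |rewrite EFq].
Qed.

Lemma smooth_at_sub N P (S S' : set N) (f : N -> P) p :
  S' `<=` S -> smooth_at S f p -> smooth_at S' f p.
Proof.
move=> SS' [ O [F [oO Op sF EF]]]; exists O, F; split => // q /SS' Sq.
exact: EF.
Qed.

Lemma smooth_at_id N (S : set N) p : smooth_at S id p.
Proof.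
exists setT, id; split => //; first exact: openT.
exact: (smooth_linear _ (idfun)).
Qed.

Lemma smooth_at_cst N P (S : set N) (x : P) p :
  mdom x x -> smooth_at S (fun=> x) p.
Proof.
move=> dx; exists setT, (fun=> chart x x); split => //; first exact: openT.
by move=> k; exact: Ck_cst.
Qed.

Lemma smooth_row_mx V (U : set V) m n1 n2 (f : V -> 'M[R]_(m, n1))
   (g : V -> 'M[R]_(m, n2)) : open U -> smooth_fun U f -> smooth_fun U g ->
   smooth_fun U (fun x => row_mx (f x) (g x)).
Proof.
move=> oU /(smooth_mxP _ oU) sf /(smooth_mxP _ oU) sg; apply/smooth_mxP => // i j.
case: (split_ordP j) => [k|k] ->.
  by rewrite (_ : (fun _ => _) = fun x => f x i k)//; apply/funext => x; rewrite row_mxEl.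
by rewrite (_ : (fun _ => _) = fun x => g x i k)//; apply/funext => x; rewrite row_mxEr.
Qed.

Lemma csmooth_row_mx N (S : set N) p m n1 n2 (f : N -> 'M[R]_(m, n1))
   (g : N -> 'M[R]_(m, n2)) : csmooth S p f -> csmooth S p g ->
   csmooth S p (fun q => row_mx (f q) (g q)).
Proof. by apply: csmooth_op2 => V U ? ?; exact: smooth_row_mx. Qed.

Lemma smooth_at_pair N P Q (S : set N) (f : N -> P) (g : N -> Q) p :
  smooth_at S f p -> smooth_at S g p ->
  @smooth_at N (prodm P Q) S (fun q => (f q, g q)) p.
Proof.
move=> [ O [F [oO Op sF EF]]] [ O' [c [oO' Op' sc E]]].
exists (O `&` O'), (fun y => row_mx (F y) (c y)); split.
- exact: openI.
- by [].
- apply: smooth_row_mx; first exact: openI.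
    by apply: smooth_sub sF; exact: subIsetl.
  by apply: smooth_sub sc; exact: subIsetr.
- move=> q Sq dq [Oq O'q]; have [dfq EFq] := EF q Sq dq Oq.
  by have [dgq Egq] := E q Sq dq O'q; rewrite /= EFq Egq.
Qed.

Lemma smooth_at_fst N P (S : set (prodm N P)) p : @smooth_at (prodm N P) N S fst p.
Proof.
exists setT, (fun v => lsubmx v); split => //; first exact: openT.
  exact: (smooth_linear _ (lsubmx)).
by move=> q Sq [dq _] _; rewrite /= row_mxKl.
Qed.

Lemma smooth_at_snd N P (S : set (prodm N P)) p : @smooth_at (prodm N P) P S snd p.
Proof.
exists setT, (fun v => rsubmx v); split => //; first exact: openT.
  exact: (smooth_linear _ (rsubmx)).
by move=> q Sq [_ dq] _; rewrite /= row_mxKr.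
Qed.

Lemma smooth_at_tnth N k (S : set (powm N k)) i p :
  @smooth_at (powm N k) N S (fun q => tnth q i) p.
Proof.
exists setT, (row i \o vec_mx); split => //; first exact: openT.
  exact: (smooth_linear _ (row i \o vec_mx)).
by move=> q Sq dq _; rewrite /= mxvecK rowK.
Qed.

End CSmooth.

(** * Curves through submersions *)

(** Completeness of the matrix spaces feeds the fixed point theorem in [perturbed_solution]. *)
HB.instance Definition _ (R : realType) m n :=
  Complete.copy 'M[R]_(m, n) 'M[R]_(m, n).

Section Submersion.
Variable R : realType.

Lemma ler_coord_norm m n (A : 'M[R]_(m, n)) i j : `|A i j| <= `|A|.
Proof. by rewrite [leRHS]/Num.norm/= mx_normrE; exact: (le_bigmax _ _ (i, j)). Qed.

Lemma mx_norm_le m n (A : 'M[R]_(m, n)) e :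
  0 <= e -> (forall i j, `|A i j| <= e) -> `|A| <= e.
Proof.
by move=> e0 H; rewrite [leLHS]/Num.norm/= mx_normrE; apply: bigmax_le => // -[i j] _; exact: H.
Qed.

(** The norm is the largest absolute value of an entry, so a product costs the factor [n], the
    length of the inner sum. It is the source of the dimension factors in the constants below. *)
Lemma norm_mulmx_le m n k (A : 'M[R]_(m, n)) (B : 'M[R]_(n, k)) :
  `|A *m B| <= n%:R * (`|A| * `|B|).
Proof.
apply: mx_norm_le => [|i j]; first by rewrite !mulr_ge0.
rewrite mxE (le_trans (ler_norm_sum _ _ _))//.
rewrite -[n in n%:R]card_ord mulr_natl -sumr_const ler_sum// => l _.
by rewrite normrM ler_pM// ler_coord_norm.
Qed.

Lemma linear_is_diff m n (W : normedModType R)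
    (L : {linear 'M[R]_(m, n) -> W}) x : is_diff x L L.
Proof.
have cL := @mx_linear_continuous R _ _ _ L.
by apply: DiffDef; [exact: linear_differentiable|rewrite diff_lin].
Qed.

Lemma is_diff_curveP (W : normedModType R) (f : R -> W) (v : W) :
  is_diff (0 : R) f (fun h => h *: v) <->
  forall e, 0 < e -> \forall t \near (0 : R), `|f t - f 0 - t *: v| <= e * `|t|.
Proof.
pose L : {linear R^o -> W} := scale_fun v.
have cL : continuous (L : R^o -> W) by exact: scalel_continuous.
split=> [[/diff_locallyP[_ /eqaddoP Ef] dfE] e e0|H].
  have := Ef e e0; rewrite dfE; apply: filterS => t.
  by rewrite !fctE /= addr0 opprD addrA.
have Ef : f \o shift (0 : R) = cst (f 0) + (L : R -> W) +o_ (0 : R) id.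
  apply/eqaddoP => e e0; apply: filterS (H e e0) => t.
  by rewrite !fctE /= addr0 opprD addrA.
have dE : 'd f (0 : R) = L :> (R -> W) by exact: (@diff_unique _ R^o W f L).
by apply: DiffDef => //; apply/diff_locallyP; rewrite dE.
Qed.

(** The mean value theorem is applied to each coordinate of [F] minus its linear part at [x0], along
    the segment from [x'] to [x]; the derivative there is small because the Jacobian is continuous
    at [x0]. *)
Lemma strict_differentiable n m (O : set 'rV[R]_n) (F : 'rV[R]_n -> 'rV[R]_m)
    (x0 : 'rV[R]_n) (e : R) :
  open O -> O x0 -> smooth_fun O F -> 0 < e ->
  exists2 d, 0 < d & forall x x', ball x0 d x -> ball x0 d x' -> O x /\
    `|F x - F x' - (x - x') *m 'J F x0| <= e * `|x - x'|.
Proof.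
move=> oO Ox0 sF e0.
have cJ : {for x0, continuous (jacobian F)}.
  exact: (smooth_continuous (smooth_jacobian oO sF)).
(* [norm_mulmx_le] costs a factor [n]; dividing by [n + 1] absorbs it and stays meaningful for
   [n = 0]. *)
pose e' := e / n.+1%:R.
have e'0 : 0 < e' by rewrite divr_gt0.
have : \forall z \near x0, O z /\ `|'J F z - 'J F x0| <= e'.
  near=> z; split; first by near: z; exact: open_nbhs_nbhs.
  by rewrite distrC; near: z; move/cvgrPdist_le : cJ; exact.
move=> /nbhs_ballP[d /= d0 Hd]; exists d => // x x' bx bx'.
split; first by have [] := Hd x bx.
have bz s : 0 <= s <= 1 -> ball x0 d (x' + s *: (x - x')).
  move=> /andP[s0 s1]; move: bx bx'; rewrite -ball_normE /= => bx bx'.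
  have -> : x0 - (x' + s *: (x - x')) = (1 - s) *: (x0 - x') + s *: (x0 - x).
    by apply/rowP => i; rewrite !mxE; ring.
  rewrite (le_lt_trans (ler_normD _ _))// !normrZ !ger0_norm ?subr_ge0//.
  set a := `|x0 - x'| in bx' *; set b := `|x0 - x| in bx *.
  have [c [ac bc cd]] : exists c, [/\ a <= c, b <= c & c < d].
    by exists (Num.max a b); rewrite !le_max !lexx orbT gt_max bx bx'.
  have h1 : (1 - s) * a <= (1 - s) * c by rewrite ler_wpM2l// subr_ge0.
  have h2 : s * b <= s * c by rewrite ler_wpM2l.
  by lra.
apply: mx_norm_le => [|i j]; first by rewrite mulr_ge0// ltW.
rewrite {i}ord1.
pose z s := x' + s *: (x - x').
have dz (s : R) : is_diff s z (fun h => h *: (x - x')).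
  have : is_diff s (cst x' + scale_fun (x - x')) (0 + scale_fun (x - x') : R -> _).
    exact: (is_diffD (is_diff_cst _ _) (is_diff_scalel _ _)).
  by rewrite add0r.
pose g (s : R) : R := (F (z s) - z s *m 'J F x0) 0 j.
pose dg (s : R) : R := ((x - x') *m ('J F (z s) - 'J F x0)) 0 j.
have Hg (s : R) : 0 <= s <= 1 -> is_diff s g (fun h => h * dg s).
  move=> s01; have [Oz _] := Hd _ (bz s s01).
  have dF := differentiableP (smooth_differentiable sF Oz).
  have dFz : is_diff s (F \o z) ('d F (z s) \o (fun h => h *: (x - x'))).
    exact: is_diff_comp.
  pose J : {linear 'rV[R]_n -> 'rV[R]_m} := mulmxr ('J F x0).
  have dJ : is_diff (z s) J J.
    exact: linear_is_diff.
  have dJz : is_diff s (J \o z) (J \o (fun h => h *: (x - x'))).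
    exact: is_diff_comp.
  have dd := is_diffB dFz dJz.
  pose C : {linear 'rV[R]_m -> R^o} := coord_fun 0 j.
  have dC : is_diff (F (z s) - J (z s)) C C.
    exact: linear_is_diff.
  have := is_diff_comp dd dC.
  rewrite (_ : C \o _ = g)//.
  rewrite (_ : C \o _ = fun h => h * dg s)//.
  apply/funext => h; rewrite /= !fctE /=.
  rewrite linearZ -scalemxAl -scalerBr /coord_fun mxE; congr (_ * _).
  rewrite /dg mulmxBr.
  by apply: (congr1 (fun A : 'rV_m => (A - (x - x') *m 'J F x0) 0 j)); rewrite mul_jacobian.
have dg1 (s : R) : 0 <= s <= 1 -> is_derive s 1 g (dg s).
  move=> /Hg [dfg gE]; apply: DeriveDef; first exact: diff_derivable.
  by rewrite deriveE// gE mul1r.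
have cg : {within `[0, 1], continuous g}.
  apply: derivable_within_continuous => s.
  by rewrite in_itv /= => /dg1 [].
have gi (s : R) : s \in `]0, 1[ -> is_derive s 1 g (dg s).
  by move=> s01; apply: dg1; rewrite !ltW// (itvP s01).
have [s s01 Eg] := MVT_segment ler01 gi cg.
have -> : (F x - F x' - (x - x') *m 'J F x0) 0 j = g 1 - g 0.
  have z1 : z 1 = x by rewrite /z scale1r addrC subrK.
  have z0 : z 0 = x' by rewrite /z scale0r addr0.
  rewrite /g z1 z0 mulmxBl; move: (x *m _) (x' *m _) => u u'.
  by rewrite !mxE; ring.
have [_ HJ] := Hd _ (bz s s01).
rewrite {}Eg subr0 mulr1 /dg.
apply: le_trans (ler_coord_norm _ _ _) _; apply: le_trans (norm_mulmx_le _ _) _.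
apply: le_trans (ler_wpM2l (ler0n _ n) (ler_wpM2l (normr_ge0 _) HJ)) _.
rewrite mulrCA [e * _]mulrC ler_wpM2l// /e' mulrCA -[leRHS]mulr1 ler_wpM2l ?ltW//.
by rewrite ltr_pdivrMr// mul1r ltr_nat.
Unshelve. all: by end_near. Qed.

(** Newton iteration with frozen derivative, in the slice [a + w *m B]. As [B *m J = 1], the map
    [w |-> F (a + w *m B)] is the identity up to a Lipschitz error of constant
    [e * (m * |B|) <= 1/2], so [phi] is a contraction whose fixed points are the solutions. *)
Lemma perturbed_solution n m (F : 'rV[R]_n -> 'rV[R]_m) (J : 'M[R]_(n, m))
    (B : 'M[R]_(m, n)) (x0 a : 'rV[R]_n) (y : 'rV[R]_m) (d e : R) :
  B *m J = 1%:M -> 0 <= e -> e * (m%:R * `|B|) <= 2^-1 ->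
  (forall x x', ball x0 d x -> ball x0 d x' ->
    `|F x - F x' - (x - x') *m J| <= e * `|x - x'|) ->
  `|x0 - a| + m%:R * `|B| * (2 * `|F a - y|) < d ->
  exists2 w, `|w| <= 2 * `|F a - y| & F (a + w *m B) = y.
Proof.
move=> BJ e0 eB HF Hd; set eta := `|F a - y| in Hd *.
(* [phi 0] has norm [eta] and [phi] contracts by [1/2], so a ball of radius [r] is preserved when
   [eta + r / 2 <= r]; this gives [r = 2 * eta]. *)
pose U : set 'rV[R]_m := [set w | `|w| <= 2 * eta].
pose phi (w : 'rV[R]_m) := w - (F (a + w *m B) - y).
have nB (w w' : 'rV[R]_m) : `|(w - w') *m B| <= m%:R * `|B| * `|w - w'|.
  by rewrite (le_trans (norm_mulmx_le _ _))// -mulrA [_ * `|B|]mulrC.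
have ball_U w : U w -> ball x0 d (a + w *m B).
  move=> Uw; rewrite -ball_normE /= (le_lt_trans _ Hd)//.
  rewrite opprD addrA (le_trans (ler_normB _ _))// lerD2l.
  have := nB w 0; rewrite !subr0 => /le_trans; apply.
  by rewrite ler_wpM2l// mulr_ge0.
have ctr w w' : U w -> U w' -> `|phi w - phi w'| <= 2^-1 * `|w - w'|.
  move=> Uw Uw'; have := HF _ _ (ball_U w Uw) (ball_U w' Uw').
  have -> : a + w *m B - (a + w' *m B) = (w - w') *m B.
    by rewrite opprD addrACA subrr add0r mulmxBl.
  rewrite -mulmxA BJ mulmx1.
  have -> : phi w - phi w' = - (F (a + w *m B) - F (a + w' *m B) - (w - w')).
    rewrite /phi; apply/rowP => i; rewrite !mxE; ring.
  rewrite normrN => /le_trans; apply.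
  apply: le_trans (ler_wpM2l e0 (nB w w')) _.
  by rewrite mulrA ler_wpM2r.
have eta0 : 0 <= eta by exact: normr_ge0.
have U0 : U 0 by rewrite /U /= normr0 mulr_ge0.
have phiU w : U w -> U (phi w).
  move=> Uw; have := ctr w 0 Uw U0; rewrite subr0 => H.
  have : `|phi w| <= `|phi w - phi 0| + `|phi 0|.
    by rewrite -[in leLHS](subrK (phi 0) (phi w)) ler_normD.
  have -> : `|phi 0| = eta by rewrite /phi mul0mx addr0 sub0r normrN.
  move=> H'.
  have Uw' : `|w| <= 2 * eta := Uw.
  by rewrite /U /=; lra.
have [] := @banach_fixed_point R _ U (mkfun_fun phiU).
- exists 2^-1%:nng; split; first by rewrite /= invf_lt1// ltr1n.
  by move=> [w w'] [Uw Uw'] /=; exact: ctr.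
- apply: (@closed_comp _ _ (fun w : 'rV[R]_m => `|w|) [set r | r <= 2 * eta]) => [w _|].
    exact: norm_continuous.
  exact: closed_le.
- by exists 0.
move=> w Uw Ew; exists w => //.
by apply/eqP; rewrite -subr_eq0; apply/eqP; move: Ew; rewrite /= /mkfun/= /phi => /eqP; rewrite eq_sym -subr_eq0 addrAC subrr sub0r oppr_eq0 => /eqP.
Qed.

(** The straight line [x0 + t *: v] is corrected by [w *m B] so as to lie over [gamma t]. The error
    [h t] to be corrected has derivative 0 at time 0, and [|w| <= 2 * |h t|], so the correction does
    not affect the velocity. *)
Lemma submersion_curve n m (O : set 'rV[R]_n) (F : 'rV[R]_n -> 'rV[R]_m)
    (B : 'M[R]_(m, n)) (x0 v : 'rV[R]_n) (gamma : R -> 'rV[R]_m) :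
  open O -> O x0 -> smooth_fun O F -> B *m 'J F x0 = 1%:M ->
  gamma 0 = F x0 -> is_diff (0 : R) gamma (fun t => t *: (v *m 'J F x0)) ->
  exists c : R -> 'rV[R]_n, [/\ c 0 = x0, is_diff (0 : R) c (fun t => t *: v) &
    \forall t \near (0 : R), O (c t) /\ F (c t) = gamma t].
Proof.
move=> oO Ox0 sF BJ g0 dgamma.
pose K := m%:R * `|B|; have K0 : 0 <= K by rewrite mulr_ge0.
(* Chosen so that [e * K <= 1/2]; the summand 1 covers [K = 0]. *)
pose e : R := (2 * (K + 1))^-1.
have e0 : 0 < e by rewrite invr_gt0 mulr_gt0// ltr_wpDl.
have eK : e * K <= 2^-1.
  by rewrite /e invfM -mulrA ler_piMr// ler_pdivrMl ?ltr_wpDl// mulr1 lerDl.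
have [d d0 Hd] := strict_differentiable oO Ox0 sF e0.
pose a (t : R) := x0 + t *: v.
pose h t := F (a t) - gamma t.
have h0 : h 0 = 0 by rewrite /h /a scale0r addr0 g0 subrr.
have dh : is_diff (0 : R) h (fun t => t *: 0).
  have da : is_diff (0 : R) a (fun t => t *: v).
    have : is_diff (0 : R) (cst x0 + scale_fun v) (0 + scale_fun v : R -> _).
      exact: (is_diffD (is_diff_cst _ _) (is_diff_scalel _ _)).
    by rewrite add0r.
  have Oa0 : O (a 0) by rewrite /a scale0r addr0.
  have dF := differentiableP (smooth_differentiable sF Oa0).
  have := is_diffB (is_diff_comp da dF) dgamma.
  rewrite (_ : _ \o _ - gamma = h)//.
  rewrite (_ : (_ - _ : R -> 'rV_m) = fun t => t *: 0)//.
  apply/funext => t; rewrite !fctE /= scaler0 linearZ -scalerBr mul_jacobian.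
  by rewrite /a scale0r addr0 subrr scaler0.
have nh (r : R) : 0 < r -> \forall t \near (0 : R), `|h t| <= r * `|t|.
  move=> r0; have /is_diff_curveP/(_ r r0) := dh.
  by apply: filterS => t; rewrite h0 scaler0 !subr0.
pose P t x := exists w, [/\ x = a t + w *m B, `|w| <= 2 * `|h t|, F x = gamma t & O x].
(* Once [|h t| <= |t|], the distance required by [perturbed_solution] is at most
   [|t| * (|v| + 2 * K)]; the summand 1 keeps the divisor positive. *)
have q0 : 0 < `|v| + K * 2 + 1 by rewrite ltr_wpDl// addr_ge0// mulr_ge0.
have tsmall : \forall t \near (0 : R), `|t| < d / (`|v| + K * 2 + 1).
  by apply: nbhs0_lt; rewrite divr_gt0.
have nP : \forall t \near (0 : R), exists x, P t x.
  near=> t.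
  have Ht : `|x0 - a t| + m%:R * `|B| * (2 * `|F (a t) - gamma t|) < d.
    rewrite opprD addrA subrr add0r normrN normrZ -/K.
    have h1 : K * (2 * `|h t|) <= K * (2 * (1 * `|t|)).
      by rewrite ler_wpM2l// ler_wpM2l//; near: t; exact: nh.
    apply: le_lt_trans (lerD (lexx _) h1) _.
    have -> : `|t| * `|v| + K * (2 * (1 * `|t|)) = `|t| * (`|v| + K * 2) by ring.
    have tq : `|t| < d / (`|v| + K * 2 + 1) by near: t; exact: tsmall.
    apply: (@le_lt_trans _ _ (`|t| * (`|v| + K * 2 + 1))).
      by rewrite ler_wpM2l// lerDl.
    by rewrite -ltr_pdivlMr.
  have [w wle Fw] := perturbed_solution BJ (ltW e0) eK (fun x x' bx bx' => (Hd x x' bx bx').2) Ht.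
  exists (a t + w *m B), w; split => //.
  have bx : ball x0 d (a t + w *m B).
    rewrite -ball_normE /= (le_lt_trans _ Ht)//.
    rewrite opprD addrA (le_trans (ler_normB _ _))// lerD2l.
    apply: le_trans (norm_mulmx_le _ _) _.
    by rewrite -mulrA ler_wpM2l// mulrC ler_wpM2l.
  by have [] := Hd _ _ bx bx.
(* Solutions at different times are chosen independently; the bound on [w] alone gives
   differentiability at 0, and [h 0 = 0] forces [c 0 = x0]. *)
pose c t := xget x0 (P t).
have Pc : \forall t \near (0 : R), P t (c t).
  by apply: filterS nP => t; exact: xgetPex.
have c0 : c 0 = x0.
  have [w [-> ]] := nbhs_singleton Pc.
  rewrite h0 normr0 mulr0 normr_le0 => /eqP -> _ _.
  by rewrite mul0mx addr0 /a scale0r addr0.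
exists c; split => //; last by apply: filterS Pc => t [w []].
apply/is_diff_curveP => r r0.
(* With [|h t|] below this multiple of [|t|], the correction is at most
   [r * (K / (K + 1)) * |t|]. *)
have r'0 : 0 < r / (2 * (K + 1)).
  by rewrite divr_gt0// mulr_gt0// ltr_wpDl.
near=> t.
have [w [-> wle _ _]] : P t (c t) by near: t.
have -> : a t + w *m B - c 0 - t *: v = w *m B.
  by rewrite c0 /a; apply/rowP => i; rewrite !mxE; ring.
have ht : `|h t| <= r / (2 * (K + 1)) * `|t| by near: t; exact: nh.
apply: le_trans (norm_mulmx_le _ _) _.
rewrite mulrCA mulrC -/K.
apply: le_trans (ler_wpM2l K0 (le_trans wle (ler_wpM2l (ler0n _ 2) ht))) _.
have -> : K * (2 * (r / (2 * (K + 1)) * `|t|)) = (r * `|t|) * (K / (K + 1)).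
  field. by rewrite gt_eqF// ltr_wpDl.
rewrite ler_piMr// ?mulr_ge0// ?ltW//.
by rewrite ltr_pdivrMr ?ltr_wpDl// mul1r ltrDl.
Unshelve. all: by end_near. Qed.

End Submersion.

(** * Velocities *)

Section Curves.
Variable R : realType.
Implicit Types N P Q : charted R.

Lemma near0W (A : R -> Prop) : (forall t, A t) -> \forall t \near (0 : R), A t.
Proof. by move=> H; exact: (@nearW _ (nbhs (0 : R)) _). Qed.

(** The chart [r] need not be centred at [c 0], so one velocity can be compared in several
    charts. *)
Definition vel_in N (r : N) (c : R -> N) (v : 'rV[R]_(mdim N)) : Prop :=
  (\forall t \near (0 : R), mdom r (c t)) /\
  is_diff (0 : R) (fun t => chart r (c t)) (fun t => t *: v).

Definition vel N (c : R -> N) (p : N) (v : 'rV[R]_(mdim N)) : Prop :=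
  c 0 = p /\ vel_in p c v.

Lemma vel_in_uniq N (r : N) c c' v w :
  (\forall t \near (0 : R), c t = c' t) -> vel_in r c v -> vel_in r c' w -> v = w.
Proof.
move=> cc' [_ [_ E]] [_ dw].
have [_ E'] : is_diff (0 : R) (fun t => chart r (c t)) (fun t => t *: w).
  by apply: near_is_diff dw; apply: filterS cc' => t ->.
have : 1 *: v = 1 *: w by rewrite -[LHS](congr1 (fun f => f 1) E) E'.
by rewrite !scale1r.
Qed.

Lemma vel_uniq N p c c' v w :
  (\forall t \near (0 : R), c t = c' t) -> @vel N c p v -> @vel N c' p w -> v = w.
Proof. by move=> cc' [_ cv] [_ cw]; exact: vel_in_uniq cc' cv cw. Qed.

Lemma vel_in_continuous N (r : N) c v :
  vel_in r c v -> {for (0 : R), continuous (fun t => chart r (c t))}.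
Proof. by move=> [_ [dc _]]; exact: differentiable_continuous. Qed.

Lemma is_diff_curve_comp m n (O : set 'rV[R]_m) (F : 'rV[R]_m -> 'rV[R]_n)
    (gamma : R -> 'rV[R]_m) v :
  smooth_fun O F -> O (gamma 0) -> is_diff (0 : R) gamma (fun t => t *: v) ->
  is_diff (0 : R) (fun t => F (gamma t)) (fun t => t *: (v *m 'J F (gamma 0))).
Proof.
move=> sF Og dg.
have := is_diff_comp dg (differentiableP (smooth_differentiable sF Og)).
rewrite (_ : 'd F _ \o _ = fun t => t *: (v *m 'J F (gamma 0)))//.
by apply/funext => t /=; rewrite linearZ mul_jacobian.
Qed.

Lemma vel_in_map N P (S : set N) (f : N -> P) (r : N) O F c v :
  local_ext S f r O F -> (\forall t \near (0 : R), S (c t)) ->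
  O (chart r (c 0)) -> vel_in r c v ->
  vel_in (f r) (fun t => f (c t)) (v *m 'J F (chart r (c 0))).
Proof.
move=> [oO Or sF EF] Sc Oc vc; have cc := vel_in_continuous vc.
have [dc dfc] := vc.
have nO : \forall t \near (0 : R), O (chart r (c t)).
  by apply: cc; apply: open_nbhs_nbhs.
have nF : \forall t \near (0 : R),
    mdom (f r) (f (c t)) /\ chart (f r) (f (c t)) = F (chart r (c t)).
  near=> t.
  have Sct : S (c t) by near: t.
  have dct : mdom r (c t) by near: t.
  have Oct : O (chart r (c t)) by near: t.
  exact: EF.
split; first by apply: filterS nF => t [].
apply: near_is_diff (is_diff_curve_comp sF Oc dfc).
by apply: filterS nF => t [].
Unshelve. all: by end_near. Qed.

(** Exposes the extension chosen by [mdiff]. Nothing is known of it beyond [local_ext], so its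
    Jacobian has to be pinned down through curves. *)
Lemma mdiff_local_ext N P (S : set N) (f : N -> P) p :
  smooth_at S f p -> exists O F, local_ext S f p O F /\
    forall v : 'rV[R]_(mdim N), mdiff S f p v = v *m 'J F (chart p p).
Proof.
move=> [ O0 [F0 le0]].
set A := [set F : 'rV[R]_(mdim N) -> 'rV[R]_(mdim P) | exists O, local_ext S f p O F].
have [ O le] : A (xget (fun=> 0) A) by apply: xgetPex; exists F0, O0.
exists O, (xget (fun=> 0) A); split => // v.
by rewrite /mdiff lfunE mul_jacobian.
Qed.

(** Along a curve that stays in [S] all extensions agree with [f]. Combined with [vel_uniq], this
    turns an identity between maps into one between their differentials. *)
Lemma vel_map N P (S : set N) (f : N -> P) p c v :
  smooth_at S f p -> (\forall t \near (0 : R), S (c t)) -> vel c p v ->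
  vel (fun t => f (c t)) (f p) (mdiff S f p v).
Proof.
move=> /mdiff_local_ext[ O [F [le ->]]] Sc [c0 vc].
split; first by rewrite c0.
have Oc : O (chart p (c 0)) by rewrite c0; case: le.
by have := vel_in_map le Sc Oc vc; rewrite c0.
Qed.

Lemma vel_cst N (p : N) : mdom p p -> vel (fun=> p) p 0.
Proof.
move=> dp; split => //; split; first by apply: near0W.
have E : 0 = (fun t => t *: 0) :> (R -> 'rV[R]_(mdim N)).
  by apply/funext => t; rewrite scaler0.
by have := @is_diff_cst R R^o _ (chart p p) (0 : R); rewrite E.
Qed.

Lemma vel_in_pair N P (r : N) (r' : P) c c' v v' :
  vel_in r c v -> vel_in r' c' v' ->
  @vel_in (prodm N P) (r, r') (fun t => (c t, c' t)) (row_mx v v').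
Proof.
move=> [dc vc] [dc' vc']; split; first by near=> t; split; near: t.
pose L1 : {linear 'rV[R]_(mdim N) -> 'rV[R]_(mdim N + mdim P)} :=
  mulmxr (row_mx 1%:M 0).
pose L2 : {linear 'rV[R]_(mdim P) -> 'rV[R]_(mdim N + mdim P)} :=
  mulmxr (row_mx 0 1%:M).
have dd := is_diffD (is_diff_comp vc (linear_is_diff L1 _))
  (is_diff_comp vc' (linear_is_diff L2 _)).
have addrow m n1 n2 (A : 'M[R]_(m, n1)) (B : 'M[R]_(m, n2)) :
    A *m row_mx 1%:M 0 + B *m row_mx 0 1%:M = row_mx A B.
  by rewrite !mul_mx_row !mulmx1 !mulmx0 add_row_mx addr0 add0r.
move: dd; set f := (X in is_diff _ X _); set g := (X in is_diff _ _ X).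
rewrite (_ : f = fun t => chart ((r, r') : prodm N P) (c t, c' t)); last first.
  by apply/funext => t; rewrite /f !fctE /= addrow.
rewrite (_ : g = fun t => t *: row_mx v v')//.
by apply/funext => t; rewrite /g !fctE /= addrow scale_row_mx.
Unshelve. all: by end_near. Qed.

Lemma vel_pair N P (p : N) (p' : P) c c' v v' :
  vel c p v -> vel c' p' v' ->
  @vel (prodm N P) (fun t => (c t, c' t)) (p, p') (row_mx v v').
Proof.
by move=> [c0 vc] [c0' vc']; split; [rewrite c0 c0'|exact: vel_in_pair].
Qed.

End Curves.

(** * Change of chart and lifting of curves *)

Section CurvesInManifolds.
Variable R : realType.
Implicit Types N P : manifold R.

Lemma chart_inj N (r x y : N) :
  mdom r x -> mdom r y -> chart r x = chart r y -> x = y.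
Proof.
by move=> dx dy E; rewrite -(chartK (manifoldP N) dx) E (chartK (manifoldP N) dy).
Qed.

Lemma chart_image N (r : N) (r' : N) (y : 'rV[R]_(mdim N)) :
  (chart r @` (mdom r `&` mdom r')) y ->
  [/\ mdom r (chartV r y), mdom r' (chartV r y) & chart r (chartV r y) = y].
Proof. by move=> [x [dx dx'] <-]; rewrite (chartK (manifoldP N) dx). Qed.

Lemma chart_image_in N (r r' x : N) : mdom r x -> mdom r' x ->
  (chart r @` (mdom r `&` mdom r')) (chart r x).
Proof. by exists x. Qed.

(** Acts on row vectors from the right, from components in [r] to components in [r']. *)
Definition ctrans N (r r' x : N) : 'M[R]_(mdim N) :=
  'J (chart r' \o chartV r) (chart r x).

Lemma vel_in_exists N (r x : N) v : mdom r x ->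
  exists c, c 0 = x /\ vel_in r c v.
Proof.
move=> dx; exists (fun t => chartV r (chart r x + t *: v)).
have MN := manifoldP N.
have cE : chartV r (chart r x) = x by rewrite (chartK MN).
split; first by rewrite scale0r addr0.
have da : is_diff (0 : R) (fun t => chart r x + t *: v) (fun t => t *: v).
  have : is_diff (0 : R) (cst (chart r x) + scale_fun v) (0 + scale_fun v : R -> _).
    exact: (is_diffD (is_diff_cst _ _) (is_diff_scalel _ _)).
  by rewrite add0r.
have ni : \forall t \near (0 : R), (chart r @` (mdom r `&` mdom r)) (chart r x + t *: v).
  have [dda _] := da.
  apply: (differentiable_continuous dda); rewrite scale0r addr0.
  by apply: open_nbhs_nbhs; split; [exact: chart_open|exact: chart_image_in].
split; first by apply: filterS ni => t /chart_image[].
by apply: near_is_diff da; apply: filterS ni => t /chart_image[].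
Qed.

Lemma vel_exists N (p : N) v : exists c, vel c p v.
Proof.
have [c [c0 vc]] := vel_in_exists v (mdom_refl (manifoldP N) p).
by exists c.
Qed.

Lemma vel_in_chart N (r r' : N) c v : vel_in r c v -> mdom r' (c 0) ->
  vel_in r' c (v *m ctrans r r' (c 0)).
Proof.
move=> vc dr'; have cc := vel_in_continuous vc; have [dc dfc] := vc.
have MN := manifoldP N.
have d0 : mdom r (c 0) := nbhs_singleton dc.
have ni : \forall t \near (0 : R), (chart r @` (mdom r `&` mdom r')) (chart r (c t)).
  apply: cc; apply: open_nbhs_nbhs; split; first exact: chart_open.
  exact: chart_image_in.
split.
  near=> t; have [_ + _] : [/\ mdom r (chartV r (chart r (c t))),
      mdom r' (chartV r (chart r (c t))) & chart r (chartV r (chart r (c t))) = chart r (c t)].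
    by apply: chart_image; near: t.
  by rewrite (chartK MN)//; near: t.
have := is_diff_curve_comp (chart_smooth MN r r') (chart_image_in d0 dr') dfc.
apply: near_is_diff; apply: filterS dc => t dct /=.
by rewrite (chartK MN).
Unshelve. all: by end_near. Qed.

Lemma rmul_inj m n (A B : 'M[R]_(m, n)) :
  (forall v : 'rV_m, v *m A = v *m B) -> A = B.
Proof. by move=> AB; apply/row_matrixP => i; rewrite !rowE AB. Qed.

Lemma ctrans_id N (r x : N) : mdom r x -> ctrans r r x = 1%:M.
Proof.
move=> dx; apply: rmul_inj => v; have [c [c0 vc]] := vel_in_exists v dx.
have d0 : mdom r (c 0) by rewrite c0.
have := vel_in_chart vc d0; rewrite c0 mulmx1 => vc'.
by apply: (vel_in_uniq (c := c) (c' := c) _ vc' vc); apply: near0W.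
Qed.

(** Both sides compute the velocity of one and the same curve in the chart [r'']. *)
Lemma ctransM N (r r' r'' x : N) : mdom r x -> mdom r' x -> mdom r'' x ->
  ctrans r r' x *m ctrans r' r'' x = ctrans r r'' x.
Proof.
move=> dx dx' dx''; apply: rmul_inj => v.
have [c [c0 vc]] := vel_in_exists v dx.
have d' : mdom r' (c 0) by rewrite c0.
have d'' : mdom r'' (c 0) by rewrite c0.
have vc' := vel_in_chart vc d'; have vc'' := vel_in_chart vc d''.
have vc2 := vel_in_chart vc' d''; rewrite c0 -mulmxA in vc2 vc''.
by apply: (vel_in_uniq (c := c) (c' := c) _ vc2 vc''); apply: near0W.
Qed.

Lemma ctransK N (r r' x : N) : mdom r x -> mdom r' x ->
  ctrans r r' x *m ctrans r' r x = 1%:M.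
Proof. by move=> dx dx'; rewrite ctransM// ctrans_id. Qed.

(* Here [f] may live on a product, of which only charts are available; the
   velocity of the curve is therefore given in both charts. *)
Lemma mdiff_coord (N' : charted R) P (S : set N') (f : N' -> P) r O F x c v v' :
  local_ext S f r O F -> mdom r x -> O (chart r x) -> S x ->
  smooth_at S f x -> (\forall t \near (0 : R), S (c t)) ->
  vel c x v -> vel_in r c v' ->
  mdiff S f x v *m ctrans (f x) (f r) (f x) = v' *m 'J F (chart r x).
Proof.
move=> le dx Ox Sx sx Sc vc vc'; have [c0 _] := vc.
have Oc : O (chart r (c 0)) by rewrite c0.
have := vel_in_map le Sc Oc vc'; rewrite c0 => v1.
have [_ v2] := vel_map sx Sc vc.
have dfx : mdom (f r) (f x) by case: le => _ _ _ /(_ x Sx dx Ox)[].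
have dfc : mdom (f r) (f (c 0)) by rewrite c0.
have := vel_in_chart v2 dfc; rewrite c0 => v3.
by apply: (vel_in_uniq (c := fun t => f (c t)) _ v3 v1); apply: near0W.
Qed.

Lemma submersion_right_inverse (N' P' : charted R) (f : N' -> P') p
    (J : 'M[R]_(mdim N', mdim P')) :
  limg (mdiff setT f p) = fullv ->
  (forall v : 'rV[R]_(mdim N'), mdiff setT f p v = v *m J) ->
  exists B : 'M[R]_(mdim P', mdim N'), B *m J = 1%:M.
Proof.
move=> fsurj dE.
exists (\matrix_i (((mdiff setT f p)^-1)%VF (delta_mx 0 i : tangent (f p)) : 'rV_(mdim N'))).
apply/row_matrixP => i; rewrite row_mul rowK rowE mulmx1 -dE.
by apply: limg_lfunVK; rewrite fsurj memvf.
Qed.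

Lemma vel_lift N P (f : N -> P) p v gamma :
  smooth_at setT f p -> limg (mdiff setT f p) = fullv ->
  vel gamma (f p) (mdiff setT f p v) ->
  exists2 c, vel c p v & \forall t \near (0 : R), f (c t) = gamma t.
Proof.
move=> sf fsurj [g0 [dg vg]].
have [ O [F [[oO Op sF EF] dE]]] := mdiff_local_ext sf.
have MN := manifoldP N; have MP := manifoldP P.
have dp := mdom_refl MN p.
(* Restricting to coordinates in the image of the chart ensures that [chartV p] brings the lifted
   coordinates back to actual points. *)
have dom_op : open (O `&` chart p @` (mdom p `&` mdom p)).
  by apply: openI => //; exact: chart_open.
have [B BJ] := submersion_right_inverse fsurj dE.
have Op' : (O `&` chart p @` (mdom p `&` mdom p)) (chart p p).
  by split => //; exact: chart_image_in.
have sF' : smooth_fun (O `&` chart p @` (mdom p `&` mdom p)) F.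
  by apply: smooth_sub sF; exact: subIsetl.
have [dfp Fp] := EF p I dp Op.
have [||c [c0 dc Fc]] := submersion_curve (v := v) (gamma := fun t => chart (f p) (gamma t)) dom_op Op' sF' BJ.
- by rewrite g0.
- by rewrite -dE.
have chc : \forall t \near (0 : R), chart p (chartV p (c t)) = c t.
  by apply: filterS Fc => t [[_ /chart_image[_ _ ->]]].
exists (fun t => chartV p (c t)).
- split; first by rewrite c0 (chartK MN).
  split; first by apply: filterS Fc => t [[_ /chart_image[]]].
  by apply: near_is_diff dc; apply: filterS chc => t ->.
- near=> t.
  have [[Oct /chart_image[dct _ ch]] Fct] :
    (O `&` chart p @` (mdom p `&` mdom p)) (c t) /\ F (c t) = chart (f p) (gamma t) by near: t.
  have [dfc Ec] := EF (chartV p (c t)) I dct (eq_ind_r O Oct ch).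
  have dgt : mdom (f p) (gamma t) by near: t.
  by apply: chart_inj dfc dgt _; rewrite Ec ch.
Unshelve. all: by end_near. Qed.

End CurvesInManifolds.

(** * The tangent groupoid *)

Section TangentGroupoid.
Variables (R : realType) (G : lie_groupoid R).
Local Notation dG := (mdim (garr G)).
Local Notation dM := (mdim (gobj G)).
Implicit Types (g h k : G) (x y : gobj G) (a b u v w : 'rV[R]_dG).

Definition composable : set (prodm G G) := [set p | src p.1 = tgt p.2].

(** All tangent spaces of a manifold are one row space. Typing the differentials over it removes the
    base point from the types, so that equations such as [src (mul g h) = src h] do not obstruct
    rewriting. *)
Definition Dsrc g (v : 'rV[R]_dG) : 'rV[R]_dM := mdiff setT (@src R G) g v.
Definition Dtgt g (v : 'rV[R]_dG) : 'rV[R]_dM := mdiff setT (@tgt R G) g v.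
Definition Dunt x (v : 'rV[R]_dM) : 'rV[R]_dG := mdiff setT (@unt R G) x v.
Definition Dinv g (v : 'rV[R]_dG) : 'rV[R]_dG := mdiff setT (@inv R G) g v.
Definition Dmul g h (v w : 'rV[R]_dG) : 'rV[R]_dG :=
  @mdiff R (prodm G G) G composable (fun p => mul p.1 p.2) (g, h) (row_mx v w).

Lemma Dsrc_linear g : linear (Dsrc g).
Proof. by move=> a u v; rewrite /Dsrc linearP. Qed.
HB.instance Definition _ g := GRing.isLinear.Build _ _ _ _ (Dsrc g) (Dsrc_linear g).
Lemma Dtgt_linear g : linear (Dtgt g).
Proof. by move=> a u v; rewrite /Dtgt linearP. Qed.
HB.instance Definition _ g := GRing.isLinear.Build _ _ _ _ (Dtgt g) (Dtgt_linear g).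
Lemma Dunt_linear x : linear (Dunt x).
Proof. by move=> a u v; rewrite /Dunt linearP. Qed.
HB.instance Definition _ x := GRing.isLinear.Build _ _ _ _ (Dunt x) (Dunt_linear x).

Lemma DmulD g h v w v' w' :
  Dmul g h (v + v') (w + w') = Dmul g h v w + Dmul g h v' w'.
Proof. by rewrite /Dmul -add_row_mx linearD. Qed.

Lemma DmulZ g h (a : R) v w : Dmul g h (a *: v) (a *: w) = a *: Dmul g h v w.
Proof. by rewrite /Dmul -scale_row_mx linearZ. Qed.

Lemma DmulN g h v w : Dmul g h (- v) (- w) = - Dmul g h v w.
Proof. by have := DmulZ g h (-1) v w; rewrite !scaleN1r. Qed.

Lemma DmulB g h v w v' w' :
  Dmul g h (v - v') (w - w') = Dmul g h v w - Dmul g h v' w'.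
Proof. by rewrite DmulD DmulN. Qed.

#[local] Opaque Dsrc Dtgt Dunt Dinv Dmul.

Let MG := manifoldP (garr G).
Let MM := manifoldP (gobj G).

Lemma vel_src g c v : vel c g v -> vel (fun t => src (c t)) (src g) (Dsrc g v).
Proof. by apply: vel_map; [exact: src_smooth|exact: near0W]. Qed.

Lemma vel_tgt g c v : vel c g v -> vel (fun t => tgt (c t)) (tgt g) (Dtgt g v).
Proof. by apply: vel_map; [exact: tgt_smooth|exact: near0W]. Qed.

Lemma vel_unt x c (v : 'rV[R]_dM) : vel c x v -> vel (fun t => unt (c t)) (unt x) (Dunt x v).
Proof. by apply: vel_map; [exact: unt_smooth|exact: near0W]. Qed.

Lemma vel_inv g c v : vel c g v -> vel (fun t => inv (c t)) (inv g) (Dinv g v).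
Proof. by apply: vel_map; [exact: inv_smooth|exact: near0W]. Qed.

Lemma vel_mul g h c c' v w : vel c g v -> vel c' h w ->
  (\forall t \near (0 : R), src (c t) = tgt (c' t)) ->
  vel (fun t => mul (c t) (c' t)) (mul g h) (Dmul g h v w).
Proof.
move=> vc vc' cc'.
have gh : src g = tgt h.
  by have := nbhs_singleton cc'; case: vc => -> _; case: vc' => ->.
have := vel_pair vc vc'.
by apply: vel_map => //; exact: mul_smooth.
Qed.

Lemma vel_cast (N : charted R) (p q : N) c (v : 'rV[R]_(mdim N)) : p = q -> vel c p v -> vel c q v.
Proof. by move=> ->. Qed.

Lemma src_lift g v gamma : vel gamma (src g) (Dsrc g v) ->
  exists2 c, vel c g v & \forall t \near (0 : R), src (c t) = gamma t.
Proof. by apply: vel_lift; [exact: src_smooth|exact: src_submersion]. Qed.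

(** The curve of targets of [c'] is lifted through the submersion [src]. Every matching pair of
    vectors thus becomes the velocity of a curve of composable pairs, on which [Dmul] is
    determined. *)
Lemma composable_lift g h c' v w : src g = tgt h -> Dsrc g v = Dtgt h w ->
  vel c' h w ->
  exists2 c, vel c g v & \forall t \near (0 : R), src (c t) = tgt (c' t).
Proof.
move=> gh vw vc'; apply: src_lift; rewrite vw.
by apply: vel_cast (vel_tgt vc').
Qed.

Lemma Dsrc_mul g h v w : src g = tgt h -> Dsrc g v = Dtgt h w ->
  Dsrc (mul g h) (Dmul g h v w) = Dsrc h w.
Proof.
move=> gh vw; have [c' vc'] := vel_exists h w.
have [c vc cc'] := composable_lift gh vw vc'.
have := vel_src (vel_mul vc vc' cc'); move/(vel_cast (src_mul gh)) => v1.
apply: vel_uniq v1 (vel_src vc'); apply: filterS cc' => t; exact: src_mul.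
Qed.

Lemma Dtgt_mul g h v w : src g = tgt h -> Dsrc g v = Dtgt h w ->
  Dtgt (mul g h) (Dmul g h v w) = Dtgt g v.
Proof.
move=> gh vw; have [c' vc'] := vel_exists h w.
have [c vc cc'] := composable_lift gh vw vc'.
have := vel_tgt (vel_mul vc vc' cc'); move/(vel_cast (tgt_mul gh)) => v1.
apply: vel_uniq v1 (vel_tgt vc); apply: filterS cc' => t; exact: tgt_mul.
Qed.

Lemma DmulA g h k u v w : src g = tgt h -> src h = tgt k ->
  Dsrc g u = Dtgt h v -> Dsrc h v = Dtgt k w ->
  Dmul g (mul h k) u (Dmul h k v w) = Dmul (mul g h) k (Dmul g h u v) w.
Proof.
(* Curves are chosen from right to left, since a lift through [src] adjusts the left factor to the
   right one. *)
move=> gh hk uv vw; have [c3 vc3] := vel_exists k w.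
have [c2 vc2 c23] := composable_lift hk vw vc3.
have [c1 vc1 c12] := composable_lift gh uv vc2.
have c1_23 : \forall t \near (0 : R), src (c1 t) = tgt (mul (c2 t) (c3 t)).
  by near=> t; rewrite tgt_mul; near: t.
have c12_3 : \forall t \near (0 : R), src (mul (c1 t) (c2 t)) = tgt (c3 t).
  by near=> t; rewrite src_mul; near: t.
have := vel_mul vc1 (vel_mul vc2 vc3 c23) c1_23; move/(vel_cast (Defs.mulA gh hk)) => v1.
apply: vel_uniq v1 (vel_mul (vel_mul vc1 vc2 c12) vc3 c12_3).
by near=> t; apply: Defs.mulA; near: t.
Unshelve. all: by end_near. Qed.

Lemma Dsrc_unt x (v : 'rV[R]_dM) : Dsrc (unt x) (Dunt x v) = v.
Proof.
have [c vc] := vel_exists x v.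
apply: vel_uniq (vel_cast (src_unt x) (vel_src (vel_unt vc))) vc.
by apply: near0W => t; rewrite src_unt.
Qed.

Lemma Dtgt_unt x (v : 'rV[R]_dM) : Dtgt (unt x) (Dunt x v) = v.
Proof.
have [c vc] := vel_exists x v.
apply: vel_uniq (vel_cast (tgt_unt x) (vel_tgt (vel_unt vc))) vc.
by apply: near0W => t; rewrite tgt_unt.
Qed.

Lemma Dmul_unt_l g v : Dmul (unt (tgt g)) g (Dunt (tgt g) (Dtgt g v)) v = v.
Proof.
have [c vc] := vel_exists g v.
have cc : \forall t \near (0 : R), src (unt (tgt (c t))) = tgt (c t).
  by apply: near0W => t; rewrite src_unt.
apply: vel_uniq (vel_cast (mul_unt_l g) (vel_mul (vel_unt (vel_tgt vc)) vc cc)) vc.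
by apply: near0W => t; rewrite mul_unt_l.
Qed.

Lemma Dmul_unt_r g v : Dmul g (unt (src g)) v (Dunt (src g) (Dsrc g v)) = v.
Proof.
have [c vc] := vel_exists g v.
have cc : \forall t \near (0 : R), src (c t) = tgt (unt (src (c t))).
  by apply: near0W => t; rewrite tgt_unt.
apply: vel_uniq (vel_cast (mul_unt_r g) (vel_mul vc (vel_unt (vel_src vc)) cc)) vc.
by apply: near0W => t; rewrite mul_unt_r.
Qed.

Lemma Dtgt_inv g v : Dtgt (inv g) (Dinv g v) = Dsrc g v.
Proof.
have [c vc] := vel_exists g v.
apply: vel_uniq (vel_cast (tgt_inv g) (vel_tgt (vel_inv vc))) (vel_src vc).
by apply: near0W => t; rewrite tgt_inv.
Qed.

Lemma Dmul_inv_r g v : Dmul g (inv g) v (Dinv g v) = Dunt (tgt g) (Dtgt g v).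
Proof.
have [c vc] := vel_exists g v.
have cc : \forall t \near (0 : R), src (c t) = tgt (inv (c t)).
  by apply: near0W => t; rewrite tgt_inv.
apply: vel_uniq (vel_cast (mul_inv_r g) (vel_mul vc (vel_inv vc) cc)) (vel_unt (vel_tgt vc)).
by apply: near0W => t; rewrite mul_inv_r.
Qed.

Lemma inv_unt x : inv (unt x) = unt x.
Proof.
have := mul_unt_l (inv (unt x)); rewrite tgt_inv src_unt => <-.
by rewrite mul_inv_r tgt_unt.
Qed.

Lemma vel_fixed_src g v : Dsrc g v = 0 ->
  exists2 c, vel c g v & \forall t \near (0 : R), src (c t) = src g.
Proof.
move=> v0; apply: src_lift; rewrite v0.
exact: vel_cst (mdom_refl MM _).
Qed.

(** The two sides use unrelated extensions, one on a source fibre and one on composable pairs; both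
    give the velocity of [c t] times [g] for a curve [c] inside the source fibre. *)
Lemma mdiff_rmul g a : Dsrc (unt (tgt g)) a = 0 ->
  mdiff [set h | src h = tgt g] (fun h => mul h g) (unt (tgt g)) a = Dmul (unt (tgt g)) g a 0
    :> 'rV[R]_dG.
Proof.
move=> a0; have dg := mdom_refl MG g; have du := mdom_refl MG (unt (tgt g)).
have [c vc cc] := vel_fixed_src a0; rewrite src_unt in cc.
have vm := vel_mul vc (vel_cst dg) cc.
have sm : smooth_at [set h | src h = tgt g] (fun h => mul h g) (unt (tgt g)).
  apply: (@smooth_at_comp _ _ _ _ _ composable
    (fun h => (h, g) : prodm G G) (fun p => mul p.1 p.2)) => //=.
  - exact: src_unt.
  - by apply: smooth_at_pair; [exact: smooth_at_id|exact: smooth_at_cst].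
  - by apply: mul_smooth => /=; rewrite src_unt.
have vm' := vel_map sm cc vc.
by apply: vel_uniq vm' vm; exact: near0W.
Qed.

Lemma mdiff_lmul g a : Dsrc (unt (src g)) a = 0 ->
  mdiff [set h | src h = src g] (fun h => mul g (inv h)) (unt (src g)) a = Dmul g (unt (src g)) 0 (Dinv (unt (src g)) a)
    :> 'rV[R]_dG.
Proof.
move=> a0; have dg := mdom_refl MG g; have du := mdom_refl MG (unt (src g)).
have [c vc cc] := vel_fixed_src a0; rewrite src_unt in cc.
have cc' : \forall t \near (0 : R), src g = tgt (inv (c t)).
  by apply: filterS cc => t <-; rewrite tgt_inv.
have := vel_mul (vel_cst dg) (vel_inv vc) cc'; rewrite inv_unt => vm.
have sm : smooth_at [set h | src h = src g] (fun h => mul g (inv h)) (unt (src g)).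
  apply: (@smooth_at_comp _ _ _ _ _ composable
    (fun h => (g, inv h) : prodm G G) (fun p => mul p.1 p.2)) => //=.
  - exact: src_unt.
  - by move=> h /= hg; rewrite /composable /= tgt_inv.
  - apply: smooth_at_pair; first exact: smooth_at_cst.
    by apply: (@smooth_at_sub _ _ _ setT) => //; exact: inv_smooth.
  - by apply: mul_smooth => /=; rewrite tgt_inv src_unt.
have vm' := vel_map sm cc vc; rewrite inv_unt in vm'.
by apply: vel_uniq vm' vm; exact: near0W.
Qed.

End TangentGroupoid.

(* Elements of [V] and [W] stand for the coordinates of tangent vectors of the
   arrow space and of the base.  [dm g h v w] is meaningful only when
   [src g = tgt h] and [ds g v = dt h w]. *)
Record tangent_groupoid (R : realType) (G : lie_groupoid R) (V W : zmodType) :=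
  TangentGroupoid {
    ds : G -> {additive V -> W};
    dt : G -> {additive V -> W};
    du : gobj G -> {additive W -> V};
    di : G -> V -> V;
    dm : G -> G -> V -> V -> V;
    dmB : forall g h v w v' w',
      dm g h (v - v') (w - w') = dm g h v w - dm g h v' w';
    ds_mul : forall g h v w, src g = tgt h -> ds g v = dt h w ->
      ds (mul g h) (dm g h v w) = ds h w;
    dt_mul : forall g h v w, src g = tgt h -> ds g v = dt h w ->
      dt (mul g h) (dm g h v w) = dt g v;
    dmA : forall g h k u v w, src g = tgt h -> src h = tgt k ->
      ds g u = dt h v -> ds h v = dt k w ->
      dm g (mul h k) u (dm h k v w) = dm (mul g h) k (dm g h u v) w;
    ds_unt : forall x v, ds (unt x) (du x v) = v;
    dt_unt : forall x v, dt (unt x) (du x v) = v;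
    dm_unt_l : forall g v, dm (unt (tgt g)) g (du (tgt g) (dt g v)) v = v;
    dm_unt_r : forall g v, dm g (unt (src g)) v (du (src g) (ds g v)) = v;
    dt_inv : forall g v, dt (inv g) (di g v) = ds g v;
    dm_inv_r : forall g v, dm g (inv g) v (di g v) = du (tgt g) (dt g v)
  }.

(** * Translations, quasi-actions and basic curvature in a tangent groupoid *)

Section TangentAlgebra.
Variables (R : realType) (G : lie_groupoid R) (V W : zmodType).
Variable tg : tangent_groupoid G V W.
Implicit Types (g h k : G) (x y : gobj G) (a b u v w : V) (e : W).
Local Notation ds := (ds tg).
Local Notation dt := (dt tg).
Local Notation du := (du tg).
Local Notation di := (di tg).
Local Notation dm := (dm tg).

Lemma dm0 g h : dm g h 0 0 = 0.
Proof. by have := dmB tg g h 0 0 0 0; rewrite !subrr. Qed.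

Lemma dmN g h v w : dm g h (- v) (- w) = - dm g h v w.
Proof. by have := dmB tg g h 0 0 v w; rewrite dm0 !sub0r. Qed.

Lemma dmD g h v w v' w' : dm g h (v + v') (w + w') = dm g h v w + dm g h v' w'.
Proof. by rewrite -[v']opprK -[w']opprK dmB !dmN !opprK. Qed.

(** The record does not ask [di] to be additive. Subtracting [dm a 0 = a] from
    [dm a (di a) = du (dt a)] leaves [dm 0 (di a)], which is [di a] because
    [dt (di a) = ds a = 0]. *)
Lemma di_algd x a : ds (unt x) a = 0 -> di (unt x) a = du x (dt (unt x) a) - a.
Proof.
move=> a0; have E := dm_inv_r tg (unt x) a; rewrite inv_unt tgt_unt in E.
have b0 : dt (unt x) (di (unt x) a) = 0.
  by have := dt_inv tg (unt x) a; rewrite inv_unt a0.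
have El := dm_unt_l tg (unt x) (di (unt x) a).
have Er := dm_unt_r tg (unt x) a.
rewrite tgt_unt b0 raddf0 in El; rewrite src_unt a0 raddf0 in Er.
by rewrite -E -[X in _ = _ - X]Er -dmB subrr subr0 El.
Qed.

Lemma ds_di_algd x a : ds (unt x) a = 0 ->
  ds (unt x) (di (unt x) a) = dt (unt x) a.
Proof. by move=> a0; rewrite di_algd// raddfB /= ds_unt a0 subr0. Qed.

Lemma dt_di_algd x a : ds (unt x) a = 0 -> dt (unt x) (di (unt x) a) = 0.
Proof. by move=> a0; rewrite di_algd// raddfB /= dt_unt subrr. Qed.

(* Right translation by [g] on [A], and its inverse on [ker ds]. *)
Definition rmulA g (a : V) := dm (unt (tgt g)) g a 0.
Definition rdivA g (v : V) := dm g (inv g) v 0.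

Lemma rmulAB g a b : rmulA g (a - b) = rmulA g a - rmulA g b.
Proof. by have := dmB tg (unt (tgt g)) g a 0 b 0; rewrite subr0. Qed.
Lemma rmulAD g a b : rmulA g (a + b) = rmulA g a + rmulA g b.
Proof. by have := dmD (unt (tgt g)) g a 0 b 0; rewrite addr0. Qed.
Lemma rdivAD g a b : rdivA g (a + b) = rdivA g a + rdivA g b.
Proof. by have := dmD g (inv g) a 0 b 0; rewrite addr0. Qed.
Lemma ds_rmulA g a : ds (unt (tgt g)) a = 0 -> ds g (rmulA g a) = 0.
Proof.
move=> a0; have := @ds_mul _ _ _ _ tg (unt (tgt g)) g a 0.
by rewrite mul_unt_l src_unt !raddf0 a0; exact.
Qed.

Lemma dt_rmulA g a : ds (unt (tgt g)) a = 0 ->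
  dt g (rmulA g a) = dt (unt (tgt g)) a.
Proof.
move=> a0; have := @dt_mul _ _ _ _ tg (unt (tgt g)) g a 0.
by rewrite mul_unt_l src_unt !raddf0 a0; exact.
Qed.

Lemma ds_rdivA g v : ds g v = 0 -> ds (unt (tgt g)) (rdivA g v) = 0.
Proof.
move=> v0; have := @ds_mul _ _ _ _ tg g (inv g) v 0.
by rewrite mul_inv_r tgt_inv !raddf0 v0 ?raddf0; exact.
Qed.

Lemma rmulA_mul g h a : src g = tgt h -> ds (unt (tgt g)) a = 0 ->
  rmulA (mul g h) a = dm g h (rmulA g a) 0.
Proof.
(* The zero vector at [mul g h] is written as a product of zero vectors, so that associativity
   applies. *)
move=> gh a0; rewrite /rmulA tgt_mul// -[in LHS](dm0 g h) dmA ?mul_unt_l//.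
- by rewrite src_unt.
- by rewrite a0 !raddf0.
- by rewrite !raddf0.
Qed.

Lemma rmulAK g a : ds (unt (tgt g)) a = 0 -> rdivA g (rmulA g a) = a.
Proof.
move=> a0; rewrite /rdivA -rmulA_mul// ?tgt_inv// mul_inv_r.
have := dm_unt_r tg (unt (tgt g)) a.
by rewrite src_unt a0 !raddf0 /rmulA tgt_unt.
Qed.

Lemma rdivAK g v : ds g v = 0 -> rmulA g (rdivA g v) = v.
Proof.
move=> v0; rewrite /rmulA /rdivA -mul_inv_r -dmA ?tgt_inv ?src_inv//.
- by rewrite dm0 mul_inv_l; have := dm_unt_r tg g v; rewrite v0 raddf0.
- by rewrite v0 !raddf0.
- by rewrite !raddf0.
Qed.

Lemma rmulA_inj g a b : ds (unt (tgt g)) a = 0 -> ds (unt (tgt g)) b = 0 ->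
  rmulA g a = rmulA g b -> a = b.
Proof. by move=> a0 b0 ab; rewrite -(rmulAK a0) ab rmulAK. Qed.

(* The differential of [h |-> g h^-1] at the unit. *)
Definition lmulA g (a : V) := dm g (unt (src g)) 0 (di (unt (src g)) a).

Section QuasiActions.
Variable hl : G -> {additive W -> V}.
Hypothesis ds_hl : forall g e, ds g (hl g e) = e.
Hypothesis hl_unt : forall x e, hl (unt x) e = du x e.

Definition actT g e : W := dt g (hl g e).
(** The left splitting is right division of the vertical part [v - hl g (ds g v)]. Since
    [ds g (lmulA g a) = dt (unt (src g)) a], this formula is minus the splitting of [lmulA g a];
    [bcurv] arises likewise from the product of two horizontal lifts. *)
Definition actA g a : V := rdivA g (hl g (dt (unt (src g)) a) - lmulA g a).
Definition bcurv g h e : V := rdivA (mul g h)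
  (dm g h (hl g (actT h e)) (hl h e) - hl (mul g h) e).

(** The source of [g x^-1] is the target of [x]. *)
Lemma ds_lmulA g a : ds (unt (src g)) a = 0 ->
  ds g (lmulA g a) = dt (unt (src g)) a.
Proof.
move=> a0; have := @ds_mul _ _ _ _ tg g (unt (src g)) 0 (di (unt (src g)) a).
by rewrite mul_unt_r tgt_unt !raddf0 dt_di_algd// ds_di_algd//; exact.
Qed.

Lemma dt_lmulA g a : ds (unt (src g)) a = 0 -> dt g (lmulA g a) = 0.
Proof.
move=> a0; have := @dt_mul _ _ _ _ tg g (unt (src g)) 0 (di (unt (src g)) a).
by rewrite mul_unt_r tgt_unt !raddf0 dt_di_algd//; exact.
Qed.

Lemma ds_actA_arg g a : ds (unt (src g)) a = 0 ->
  ds g (hl g (dt (unt (src g)) a) - lmulA g a) = 0.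
Proof. by move=> a0; rewrite raddfB /= ds_hl ds_lmulA// subrr. Qed.

Lemma actA_src g a : ds (unt (src g)) a = 0 -> ds (unt (tgt g)) (actA g a) = 0.
Proof. by move=> a0; apply: ds_rdivA; exact: ds_actA_arg. Qed.

Lemma rmulA_actA g a : ds (unt (src g)) a = 0 ->
  rmulA g (actA g a) = hl g (dt (unt (src g)) a) - lmulA g a.
Proof. by move=> a0; apply: rdivAK; exact: ds_actA_arg. Qed.

Lemma ds_bcurv_arg g h e : src g = tgt h ->
  ds (mul g h) (dm g h (hl g (actT h e)) (hl h e) - hl (mul g h) e) = 0.
Proof.
move=> gh; rewrite raddfB /= ds_hl ds_mul// ?ds_hl//.
by rewrite subrr.
Qed.

Lemma bcurv_src g h e : src g = tgt h -> ds (unt (tgt g)) (bcurv g h e) = 0.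
Proof.
move=> gh; have := ds_rdivA (ds_bcurv_arg e gh).
by rewrite tgt_mul.
Qed.

Lemma rmulA_bcurv g h e : src g = tgt h -> rmulA (mul g h) (bcurv g h e) =
  dm g h (hl g (actT h e)) (hl h e) - hl (mul g h) e.
Proof. by move=> gh; apply: rdivAK; exact: ds_bcurv_arg. Qed.

(** Right translation preserves [dt], and [lmulA g a] has zero target, so only the horizontal term
    contributes. *)
Lemma anchor_actA g a : ds (unt (src g)) a = 0 ->
  dt (unt (tgt g)) (actA g a) = actT g (dt (unt (src g)) a).
Proof.
move=> a0; rewrite -dt_rmulA ?actA_src// rmulA_actA// raddfB /=.
by rewrite dt_lmulA// subr0.
Qed.

Lemma anchor_bcurv g h e : src g = tgt h ->
  dt (unt (tgt g)) (bcurv g h e) = actT g (actT h e) - actT (mul g h) e.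
Proof.
move=> gh; have K0 := bcurv_src e gh.
have := @dt_rmulA (mul g h) (bcurv g h e); rewrite tgt_mul// => <-//.
by rewrite rmulA_bcurv// raddfB /= dt_mul// ds_hl.
Qed.

(* [g x^-1] multiplied by [x h] does not depend on [x]. *)
Lemma dm_lmulA_rmulA g h a : src g = tgt h -> ds (unt (tgt h)) a = 0 ->
  dm g h (lmulA g a) (rmulA h a) = 0.
Proof.
move=> gh a0; rewrite /lmulA /rmulA gh; set x := tgt h in a0 gh *.
have b0 : dt (unt x) (di (unt x) a) = 0.
  exact: dt_di_algd.
have b1 : ds (unt x) (di (unt x) a) = dt (unt x) a.
  exact: ds_di_algd.
have su := src_unt x; have tu := tgt_unt x.
have uu : mul (unt x) (unt x) = unt x by have := mul_unt_r (unt x); rewrite su.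
have muh : mul g (unt x) = g by rewrite -gh mul_unt_r.
have hE : mul (unt x) h = h by exact: mul_unt_l.
(* The middle factor [x^-1 x] of the product: with [di a = du (dt a) - a] it equals [a - a]. *)
have E : dm (unt x) (unt x) (di (unt x) a) a = 0.
  rewrite di_algd//.
  have := dm_unt_l tg (unt x) a; have := dm_unt_r tg (unt x) a.
  rewrite su tu a0 !raddf0 => E1 E2.
  by rewrite -[X in dm _ _ _ X]subr0 dmB E1 E2 subrr.
have E1 := @dmA _ _ _ _ tg g (unt x) h 0 (di (unt x) a) (dm (unt x) h a 0).
rewrite muh hE in E1; rewrite -E1 ?raddf0 ?b0 ?tu//; last first.
  have := @dt_mul _ _ _ _ tg (unt x) h a 0.
  by rewrite hE b1 => ->//; rewrite ?a0 ?raddf0.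
have E2 := @dmA _ _ _ _ tg (unt x) (unt x) h (di (unt x) a) a 0.
rewrite uu hE in E2; rewrite E2 ?su ?tu ?a0 ?raddf0 //.
by rewrite E !dm0.
Qed.

(** The differential in [x] of [g (h x^-1) = (g h) x^-1]. *)
Lemma dm0_lmulA g h a : src g = tgt h -> ds (unt (src h)) a = 0 ->
  dm g h 0 (lmulA h a) = lmulA (mul g h) a.
Proof.
move=> gh a0; rewrite /lmulA src_mul//.
have := @dmA _ _ _ _ tg g h (unt (src h)) 0 0 (di (unt (src h)) a).
by rewrite mul_unt_r dm0 tgt_unt => ->//; rewrite !raddf0// dt_di_algd.
Qed.

(** After translation to [g h], the definition of [b] splits [hl h e] as [rmulA h b + lmulA h a].
    Multiplied by the lift over [g], the first part yields the translate of [actA g b] and the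
    second yields [lmulA (mul g h) a]. *)
Lemma actA_mul g h a : src g = tgt h -> ds (unt (src h)) a = 0 ->
  actA g (actA h a) - actA (mul g h) a = bcurv g h (dt (unt (src h)) a).
Proof.
move=> gh a0; set e := dt _ a; set b := actA h a.
have sgh := src_mul gh; have tgh := tgt_mul gh.
have b0' : ds (unt (tgt h)) b = 0 by exact: actA_src.
have b0 : ds (unt (src g)) b = 0 by rewrite gh.
have a0' : ds (unt (src (mul g h))) a = 0 by rewrite sgh.
have c0 := actA_src a0'; rewrite tgh in c0.
apply: (@rmulA_inj (mul g h)); rewrite ?tgh ?bcurv_src//.
  by rewrite raddfB /= actA_src// c0 subrr.
rewrite rmulAB rmulA_bcurv// rmulA_mul// ?actA_src// !rmulA_actA// sgh -/e.
have -> : dt (unt (src g)) b = actT h e by rewrite gh anchor_actA.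
have -> : hl h e = rmulA h b + lmulA h a by rewrite rmulA_actA// subrK.
(* [lmulA g b] is moved out of the left factor so that it meets [rmulA h b]; that product vanishes
   by [dm_lmulA_rmulA]. *)
have -> X : dm g h X (rmulA h b + lmulA h a) =
    dm g h (X - lmulA g b) 0 + (dm g h (lmulA g b) (rmulA h b) + dm g h 0 (lmulA h a)).
  by rewrite -!dmD addr0 subrK add0r.
by rewrite dm_lmulA_rmulA// add0r dm0_lmulA// opprB addrA.
Qed.

(** Translated to [g h k], both sides equal the product of the three horizontal lifts minus the lift
    over [g h k]. On the right this is associativity ([ER]); on the left the product over [h k]
    differs from the lift by a curvature term. *)
Lemma bcurv_cocycle g h k e : src g = tgt h -> src h = tgt k ->
  bcurv g (mul h k) e + actA g (bcurv h k e) =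
  bcurv (mul g h) k e + bcurv g h (actT k e).
Proof.
move=> gh hk.
have ghk : src g = tgt (mul h k) by rewrite tgt_mul.
have gh_k : src (mul g h) = tgt k by rewrite src_mul.
have kap0' : ds (unt (tgt h)) (bcurv h k e) = 0 by exact: bcurv_src.
have kap0 : ds (unt (src g)) (bcurv h k e) = 0 by rewrite gh.
have kap0'' : ds (unt (tgt (mul h k))) (bcurv h k e) = 0 by rewrite tgt_mul.
have tgh := tgt_mul gh.
have c1 := bcurv_src e ghk; have c2 := actA_src kap0.
have c3 := bcurv_src e gh_k; have c4 := bcurv_src (actT k e) gh.
rewrite tgh in c3.
apply: (@rmulA_inj (mul g (mul h k))); rewrite ?(tgt_mul ghk).
- by rewrite raddfD /= c1 c2 addr0.
- by rewrite raddfD /= c3 c4 addr0.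
rewrite 2!rmulAD rmulA_bcurv// [rmulA _ (actA _ _)]rmulA_mul// rmulA_actA//.
have c4' : ds (unt (tgt (mul g h))) (bcurv g h (actT k e)) = 0 by rewrite tgh.
rewrite [in RHS]Defs.mulA// rmulA_bcurv// rmulA_mul// rmulA_bcurv//.
have -> : dt (unt (src g)) (bcurv h k e) = actT h (actT k e) - actT (mul h k) e.
  by rewrite gh anchor_bcurv.
set p := hl (mul (mul g h) k) e.
have ER : dm (mul g h) k (hl (mul g h) (actT k e)) (hl k e) - p +
    dm (mul g h) k (dm g h (hl g (actT h (actT k e))) (hl h (actT k e)) -
      hl (mul g h) (actT k e)) 0 =
    dm g (mul h k) (hl g (actT h (actT k e))) (dm h k (hl h (actT k e)) (hl k e)) - p.
  by rewrite addrAC -dmD addr0 [X in dm _ _ X _]addrC subrK dmA// ?ds_hl.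
have -> : hl (mul g (mul h k)) e = p by rewrite /p Defs.mulA.
rewrite {}ER addrAC -dmD addr0; congr (_ - p).
have -> : dm h k (hl h (actT k e)) (hl k e) =
    hl (mul h k) e + rmulA (mul h k) (bcurv h k e) by rewrite rmulA_bcurv// addrC subrK.
set c := actT h _; set c' := actT (mul h k) _; set L := lmulA g _.
have -> : hl g c' + (hl g (c - c') - L) = hl g c - L.
  by rewrite raddfB /= addrA [hl g c' + _]addrC subrK.
(* Writing the left factor as [(hl g c - L) + L] pairs [L] with the curvature term, and this product
   is zero. *)
rewrite -[in RHS](subrK L (hl g c)) dmD dm_lmulA_rmulA// addr0//.
Qed.

Lemma actT_unt x e : actT (unt x) e = e.
Proof. by rewrite /actT hl_unt dt_unt. Qed.

(** At a unit [hl] is [du] and [lmulA] is [di], so [di_algd] leaves exactly [a]. *)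
Lemma actA_unt x a : ds (unt x) a = 0 -> actA (unt x) a = a.
Proof.
move=> a0.
have s0 : ds (unt (src (unt x))) a = 0 by rewrite src_unt.
have t0 : ds (unt (tgt (unt x))) a = 0 by rewrite tgt_unt.
apply: (@rmulA_inj (unt x)) => //; first exact: actA_src.
rewrite rmulA_actA// src_unt hl_unt.
have := dm_unt_r tg (unt x) a; rewrite src_unt a0 raddf0 => Er.
rewrite /rmulA tgt_unt Er /lmulA src_unt.
have := dm_unt_l tg (unt x) (di (unt x) a).
rewrite tgt_unt dt_di_algd// raddf0 => ->.
by rewrite di_algd// opprB addrC subrK.
Qed.

Lemma bcurv_unt_l h e : bcurv (unt (tgt h)) h e = 0.
Proof.
by rewrite /bcurv hl_unt /actT dm_unt_l mul_unt_l subrr /rdivA dm0.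
Qed.

Lemma bcurv_unt_r g e : bcurv g (unt (src g)) e = 0.
Proof.
have := dm_unt_r tg g (hl g e); rewrite ds_hl => E.
rewrite /bcurv hl_unt actT_unt E mul_unt_r subrr.
by rewrite /rdivA dm0.
Qed.

End QuasiActions.
End TangentAlgebra.

(** * The given operators in terms of the tangent groupoid *)

Section Operators.
Variables (R : realType) (G : lie_groupoid R).
Local Notation dG := (mdim (garr G)).
Local Notation dM := (mdim (gobj G)).
Implicit Types (g h k : G) (x y : gobj G).

Definition tangent_groupoid_of : tangent_groupoid G 'rV[R]_dG 'rV[R]_dM :=
  @TangentGroupoid R G 'rV[R]_dG 'rV[R]_dM
    (@Dsrc R G) (@Dtgt R G) (@Dunt R G) (@Dinv R G) (@Dmul R G)
    (@DmulB R G) (@Dsrc_mul R G) (@Dtgt_mul R G) (@DmulA R G)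
    (@Dsrc_unt R G) (@Dtgt_unt R G) (@Dmul_unt_l R G) (@Dmul_unt_r R G)
    (@Dtgt_inv R G) (@Dmul_inv_r R G).
Local Notation TG := tangent_groupoid_of.

Variable sigma : forall g : G, 'Hom(tangent (src g), tangent g).
Hypothesis hsigma : is_ehresmann sigma.

Definition hlift g (v : 'rV[R]_dM) : 'rV[R]_dG := sigma g v.

Lemma hlift_linear g : linear (hlift g).
Proof. by move=> a u v; rewrite /hlift linearP. Qed.
HB.instance Definition _ g := GRing.isLinear.Build _ _ _ _ (hlift g) (hlift_linear g).

Definition hl g : {additive 'rV[R]_dM -> 'rV[R]_dG} := hlift g.

Lemma Dsrc_hlift g v : Dsrc g (hlift g v) = v.
Proof.
have := congr1 (fun f : 'Hom(_, _) => f v) (ehr_split hsigma g).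
by rewrite comp_lfunE id_lfunE.
Qed.

Lemma hlift_unt x v : hlift (unt x) v = Dunt x v.
Proof. by rewrite /hlift (ehr_unit hsigma). Qed.

(** [linfun] of a bare function has the expected values only once the function is known to be
    linear; the linear structure is packed on the spot. *)
Lemma linfun_linearE (U V : vectType R) (f : U -> V) : linear f -> linfun f =1 f.
Proof.
move=> lf u; pose fM := GRing.isLinear.Build _ _ _ _ f lf.
pose fL : {linear U -> V} := HB.pack f fM.
exact: (lfunE fL).
Qed.

(** Forgets membership in the kernel, so that elements of fibres over different points are compared
    in one row space. *)
Definition aval x (a : algd x) : 'rV[R]_dG := vsval a.

Lemma avalP x (a : algd x) : Dsrc (unt x) (aval a) = 0.
Proof. by have := subvsP a; rewrite memv_ker => /eqP. Qed.

Lemma avalN x (a : algd x) : aval (- a) = - aval a.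
Proof. exact: (raddfN vsval). Qed.

Lemma aval_inj x : injective (@aval x).
Proof. exact: val_inj. Qed.

Lemma aval_proj x (v : 'rV[R]_dG) : Dsrc (unt x) v = 0 ->
  aval (vsproj _ v : algd x) = v.
Proof. by move=> v0; apply: vsprojK; rewrite memv_ker; apply/eqP. Qed.

Lemma algd_inclE x (a : algd x) : algd_incl x a = aval a :> 'rV[R]_dG.
Proof. by rewrite /algd_incl lfunE. Qed.

Lemma algd_castE x (a : algd x) : algd_cast x x a = a.
Proof.
rewrite /algd_cast linfun_linearE; first by apply: aval_inj; rewrite aval_proj algd_inclE// avalP.
by move=> r u v; rewrite !linearP.
Qed.

Lemma anchorE x (a : algd x) : anchor x a = Dtgt (unt x) (aval a) :> 'rV[R]_dM.
Proof. by rewrite /anchor comp_lfunE algd_inclE. Qed.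

Lemma rtransE g (a : algd (tgt g)) : rtrans g a = rmulA TG g (aval a) :> 'rV[R]_dG.
Proof.
rewrite /rtrans comp_lfunE algd_inclE; apply: mdiff_rmul; exact: avalP.
Qed.

Lemma ltransE g (a : algd (src g)) : ltrans g a = lmulA TG g (aval a) :> 'rV[R]_dG.
Proof.
rewrite /ltrans comp_lfunE algd_inclE; apply: mdiff_lmul; exact: avalP.
Qed.

Lemma rdivA_linear g : linear (rdivA TG g).
Proof.
move=> r u v; rewrite rdivAD /rdivA /=.
have := DmulZ g (inv g) r u 0.
by rewrite scaler0 => ->.
Qed.

Definition vertical g (v : 'rV[R]_dG) : 'rV[R]_dG := v - hlift g (Dsrc g v).

Lemma vertical_linear g : linear (vertical g).
Proof.
move=> r u v; rewrite /vertical Dsrc_linear hlift_linear.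
move: (hlift _ _) (hlift _ _) => x y.
by rewrite scalerBr opprD addrACA.
Qed.

Lemma Dsrc_vertical g v : Dsrc g (vertical g v) = 0.
Proof. by rewrite /vertical linearB /= Dsrc_hlift subrr. Qed.

(** [left_splitting] is a choice with default 0, so a witness is required: right division of the
    vertical part. *)
Lemma is_left_splitting_exists g : exists w, @is_left_splitting R G sigma g w.
Proof.
pose f (v : 'rV[R]_dG) : algd (tgt g) := vsproj _ (rdivA TG g (vertical g v)).
have fE v : aval (f v) = rdivA TG g (vertical g v).
  apply: aval_proj; apply: (ds_rdivA (tg := TG)); exact: Dsrc_vertical.
have lf : linear (f : tangent g -> algd (tgt g)).
  by move=> r u v; rewrite /f vertical_linear rdivA_linear linearP.
exists (linfun f); split; apply/lfunP => v.
  rewrite comp_lfunE id_lfunE linfun_linearE//; apply: aval_inj.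
  rewrite fE rtransE /vertical (ds_rmulA (tg := TG) (avalP v)) linear0 subr0.
  exact: (rmulAK (tg := TG) (avalP v)).
rewrite add_lfunE (comp_lfunE (rtrans g)) (comp_lfunE (sigma g)) id_lfunE.
rewrite (linfun_linearE lf) rtransE fE.
rewrite (rdivAK (tg := TG) (Dsrc_vertical g v)) /vertical.
exact: subrK.
Qed.

Lemma left_splittingP g : @is_left_splitting R G sigma g (left_splitting sigma g).
Proof. by apply: xgetPex; exact: is_left_splitting_exists. Qed.

(** The second splitting equation says that right translation takes the value to the vertical part,
    and right translation is injective on [A]. *)
Lemma left_splittingE g (v : 'rV[R]_dG) :
  aval (left_splitting sigma g v) = rdivA TG g (vertical g v).
Proof.
have [_ /(congr1 (fun f : 'Hom(_, _) => f v))] := left_splittingP g.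
rewrite add_lfunE (comp_lfunE (rtrans g)) (comp_lfunE (sigma g)) id_lfunE rtransE => E.
have -> : vertical g v = rmulA TG g (aval (left_splitting sigma g v)).
  by rewrite /vertical -[X in X - _]E addrK.
by rewrite (rmulAK (tg := TG) (avalP _)).
Qed.

Lemma qact_TE g v : qact_T sigma g v = actT TG hl g v :> 'rV[R]_dM.
Proof. by rewrite /qact_T comp_lfunE. Qed.

Lemma qact_AE g (a : algd (src g)) :
  aval (qact_A sigma g a) = actA TG hl g (aval a).
Proof.
rewrite /qact_A opp_lfunE avalN (comp_lfunE (left_splitting sigma g)).
rewrite left_splittingE ltransE /vertical (ds_lmulA (tg := TG) (avalP a)).
have := dmN TG g (inv g) (lmulA TG g (aval a) - hl g (Dtgt (unt (src g)) (aval a))) 0.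
by rewrite oppr0 opprB => E; exact: (esym E).
Qed.

Lemma basic_curvE g h v : src g = tgt h ->
  aval (basic_curv sigma g h v) = bcurv TG hl g h v.
Proof.
move=> gh.
have arg e : vertical (mul g h) (dmul (sigma g (qact_T sigma h e)) (sigma h e)) =
    Dmul g h (hl g (actT TG hl h e)) (hl h e) - hl (mul g h) e.
  rewrite qact_TE /vertical (@Dsrc_mul _ G g h) ?Dsrc_hlift//.
rewrite /basic_curv linfun_linearE.
  by rewrite left_splittingE arg.
move=> r u w; apply: aval_inj.
have avalP' x (a b : algd x) : aval (r *: a + b) = r *: aval a + aval b.
  exact: (linearP vsval).
rewrite avalP' !left_splittingE -rdivA_linear; congr (rdivA _ _ _).
rewrite -vertical_linear; congr (vertical _ _).
have -> : sigma h (r *: u + w) = r *: hlift h u + hlift h w :> 'rV_dG.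
  exact: hlift_linear.
have -> : sigma g (qact_T sigma h (r *: u + w)) =
    r *: hlift g (qact_T sigma h u) + hlift g (qact_T sigma h w) :> 'rV_dG.
  by rewrite linearP; exact: hlift_linear.
by rewrite -[LHS]/(Dmul g h _ _) DmulD DmulZ.
Qed.

End Operators.

(** * Smooth families of tangent vectors *)

Section Frames.
Variables (R : realType) (V : vectType R) (k : nat) (b : 'I_k -> V).

Let X := [tuple b i | i < k].

Let XE : [seq b a | a <- enum 'I_k] = X.
Proof. by []. Qed.

Let nthX (i : 'I_k) : X`_i = b i.
Proof. by rewrite -tnth_nth tnth_mktuple. Qed.

Lemma frame_span v : basis_of fullv [seq b a | a <- enum 'I_k] ->
  exists al : 'rV[R]_k, v = \sum_i al 0 i *: b i.
Proof.
rewrite XE => /span_basis sX; exists (\row_i coord X i v).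
have {1}-> := @coord_span _ _ _ X v; last by rewrite sX memvf.
by apply: eq_bigr => i _; rewrite mxE nthX.
Qed.

Lemma frame_free (al : 'rV[R]_k) : basis_of fullv [seq b a | a <- enum 'I_k] ->
  \sum_i al 0 i *: b i = 0 -> al = 0.
Proof.
rewrite XE => /basis_free/freeP fX al0; apply/rowP => i; rewrite mxE.
by apply: (fX (fun i => al 0 i)); rewrite -[RHS]al0; apply: eq_bigr => j _; rewrite nthX.
Qed.

Lemma frame_basis :
  (forall v, exists al : 'rV[R]_k, v = \sum_i al 0 i *: b i) ->
  (forall al : 'rV[R]_k, \sum_i al 0 i *: b i = 0 -> al = 0) ->
  basis_of fullv [seq b a | a <- enum 'I_k].
Proof.
move=> hs hf; rewrite XE; apply/andP; split.
  rewrite eqEsubv subvf /=; apply/subvP => v _; have [al ->] := hs v.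
  by apply: memv_suml => i _; apply: memvZ; rewrite -nthX; apply: memv_span; rewrite mem_nth ?size_tuple.
apply/freeP => c c0 i; have := hf (\row_i c i).
move=> /(_ _)/rowP/(_ i); rewrite !mxE; apply; rewrite -[RHS]c0.
by apply: eq_bigr => j _; rewrite mxE nthX.
Qed.

End Frames.

Section VectorFamilies.
Variable R : realType.
Implicit Types N : charted R.
Implicit Types P Q : manifold R.

Lemma csmooth_fun N (S : set N) p m k1 k2 (W : set 'rV[R]_m)
    (g : 'rV[R]_m -> 'M[R]_(k1, k2)) (u : N -> 'rV[R]_m) :
  mdom p p -> S p -> open W -> W (u p) -> smooth_fun W g -> csmooth S p u ->
  csmooth S p (fun q => g (u q)).
Proof.
move=> dp Sp oW Wu sg [ O [c [oO Op sc E]]].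
have oO' : open (O `&` c @^-1` W).
  by apply: open_setI_preimage => //; exact: smooth_continuous.
exists (O `&` c @^-1` W), (g \o c); split => //.
- by split => //=; rewrite -E.
- apply: (smooth_comp oO' oW _ _ sg) => [y []//|].
  by apply: smooth_sub sc; exact: subIsetl.
- by move=> q Sq dq [Oq _]; rewrite E.
Qed.

Lemma mnbhs_mdom P (r x : P) : mdom r x -> \forall y \near mnbhs setT x, mdom r y.
Proof.
move=> dx; have dxx := mdom_refl (manifoldP P) x.
rewrite nearE mnbhsE.
have oW : open_nbhs (chart x x) (chart x @` (mdom x `&` mdom r)).
  by split; [exact: (chart_open (manifoldP P))|exact: chart_image_in].
apply: filterS (open_nbhs_nbhs oW) => y /chart_image[dxy dry chy] z _ dxz Ez.
by rewrite (chart_inj dxz dxy)// chy.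
Qed.

Lemma csmooth_chart P (r x : P) : mdom r x -> csmooth setT x (chart r).
Proof.
move=> dx; have dxx := mdom_refl (manifoldP P) x.
exists (chart x @` (mdom x `&` mdom r)), (chart r \o chartV x); split.
- exact: chart_open (manifoldP P) _ _.
- exact: chart_image_in.
- exact: chart_smooth (manifoldP P) _ _.
- by move=> q _ dq _ /=; rewrite (chartK (manifoldP P)).
Qed.

Lemma csmooth_ctrans P (r r' x : P) : mdom r x -> mdom r' x ->
  csmooth setT x (ctrans r r').
Proof.
move=> dx dx'; have MP := manifoldP P.
apply: (csmooth_fun (W := chart r @` (mdom r `&` mdom r')) (u := chart r)) => //.
- exact: mdom_refl.
- exact: chart_open.
- exact: chart_image_in.
- apply: smooth_jacobian; [exact: chart_open|exact: chart_smooth].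
- exact: csmooth_chart.
Qed.

(* Smoothness of a family of tangent vectors [X q] at [f q]: the components of
   [X q] in the chart around [f p] are smooth. *)
Definition vsmooth N P (S : set N) (f : N -> P) (p : N)
    (X : N -> 'rV[R]_(mdim P)) : Prop :=
  csmooth S p (fun q => X q *m ctrans (f q) (f p) (f q)).

Section AtPoint.
Variables (N : charted R) (S : set N) (p : N).
Hypotheses (dp : mdom p p) (Sp : S p).

Lemma smooth_at_mdom P (f : N -> P) r : smooth_at S f p -> mdom r (f p) ->
  \forall q \near mnbhs S p, mdom r (f q).
Proof.
move=> sf dr; exact: (smooth_at_cvg (S' := setT) dp Sp (fun _ _ => I) sf (mnbhs_mdom dr)).
Qed.

Lemma csmooth_along P (f : N -> P) m n (phi : P -> 'M[R]_(m, n)) :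
  smooth_at S f p -> csmooth setT (f p) phi -> csmooth S p (fun q => phi (f q)).
Proof. by move=> sf sphi; exact: csmooth_comp sphi. Qed.

Lemma vsmooth_near P (f : N -> P) X Y :
  (\forall q \near mnbhs S p, X q = Y q) -> vsmooth S f p X -> vsmooth S f p Y.
Proof. by move=> XY; apply: csmooth_near; apply: filterS XY => q ->. Qed.

Lemma vsmoothD P (f : N -> P) X Y : vsmooth S f p X -> vsmooth S f p Y ->
  vsmooth S f p (fun q => X q + Y q).
Proof.
move=> sX sY; apply: csmooth_near (csmoothD sX sY).
by apply: nearW => q; rewrite mulmxDl.
Qed.

Lemma vsmoothN P (f : N -> P) X : vsmooth S f p X ->
  vsmooth S f p (fun q => - X q).
Proof.
move=> sX; have := csmoothM sX (csmooth_cst S p (- 1%:M)).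
by apply: csmooth_near; apply: nearW => q; rewrite mulmxN mulmx1 mulNmx.
Qed.

Lemma vsmooth0 P (f : N -> P) : vsmooth S f p (fun=> 0).
Proof.
apply: csmooth_near (csmooth_cst S p 0).
by apply: nearW => q; rewrite mul0mx.
Qed.

(** [mdiff] picks a new extension at every [f q], without any uniformity. Near [p] its values are
    nevertheless given by the Jacobian of one extension at [f p], as a curve with velocity [X q]
    shows through [mdiff_coord]. *)
Lemma vsmooth_mdiff P Q (f : N -> P) (phi : P -> Q) X :
  smooth_at S f p -> smooth_map setT phi -> vsmooth S f p X ->
  vsmooth S (fun q => phi (f q)) p (fun q => mdiff setT phi (f q) (X q)).
Proof.
move=> sf sphi sX; have [ O [F le]] := sphi (f p) I; have [oO Op sF EF] := le.
have dfp := mdom_refl (manifoldP P) (f p).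
have s1 : csmooth S p (fun q => 'J F (chart (f p) (f q))).
  apply: csmooth_fun (smooth_jacobian oO sF) _ => //.
  by apply: csmooth_along => //; exact: csmooth_chart.
have s2 := csmoothM sX s1.
apply: csmooth_near s2.
have n1 := smooth_at_mdom sf dfp.
have n2 : \forall q \near mnbhs S p, O (chart (f p) (f q)).
  have n0 : \forall y \near mnbhs setT (f p), O (chart (f p) y) by exact: mnbhs_chart.
  exact: (smooth_at_cvg (S' := setT) dp Sp (fun _ _ => I) sf n0).
near=> q.
have d1 : mdom (f p) (f q) by near: q.
have [c vc] := vel_exists (f q) (X q); have [c0 vc1] := vc.
have d2 : mdom (f p) (c 0) by rewrite c0.
have := vel_in_chart vc1 d2; rewrite c0 => vc2.
apply/esym; apply: (mdiff_coord le) vc vc2 => //; first by near: q.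
  exact: sphi.
exact: near0W.
Unshelve. all: by end_near. Qed.

Lemma vsmooth_coord P (f : N -> P) r a : smooth_at S f p -> mdom r (f p) ->
  vsmooth S f p (fun q => fvec (coord_frame r) a (f q)).
Proof.
move=> sf dr; have dfp := mdom_refl (manifoldP P) (f p).
have s1 := csmooth_along sf (csmooth_ctrans dr dfp).
apply: csmooth_near (csmoothM (csmooth_cst S p (delta_mx 0 a)) s1).
have n1 := smooth_at_mdom sf dfp; have n2 := smooth_at_mdom sf dr.
near=> q.
have d1 : mdom (f p) (f q) by near: q.
have d2 : mdom r (f q) by near: q.
have d3 := mdom_refl (manifoldP P) (f q).
have -> : fvec (coord_frame r) a (f q) = delta_mx 0 a *m ctrans r (f q) (f q) :> 'rV_(mdim P).
  by rewrite mul_jacobian.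
by rewrite -mulmxA ctransM.
Unshelve. all: by end_near. Qed.

Lemma coord_frame_decomp P (r x : P) (v : 'rV[R]_(mdim P)) : mdom r x ->
  v = \sum_b (v *m ctrans x r x) 0 b *: (fvec (coord_frame r) b x : 'rV[R]_(mdim P)).
Proof.
move=> dr; have dx := mdom_refl (manifoldP P) x.
rewrite -[LHS]mulmx1 -(ctransK dx dr) mulmxA; set u := v *m _.
rewrite {1}[u]row_sum_delta mulmx_suml; apply: eq_bigr => b _.
by rewrite -scalemxAl mul_jacobian.
Qed.

Lemma vsmooth_coef P (f : N -> P) r X : smooth_at S f p -> mdom r (f p) ->
  vsmooth S f p X -> csmooth S p (fun q => X q *m ctrans (f q) r (f q)).
Proof.
move=> sf dr sX; have dfp := mdom_refl (manifoldP P) (f p).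
have s1 := csmooth_along sf (csmooth_ctrans dfp dr).
apply: csmooth_near (csmoothM sX s1).
have n1 := smooth_at_mdom sf dfp; have n2 := smooth_at_mdom sf dr.
near=> q.
have d1 : mdom (f p) (f q) by near: q.
have d2 : mdom r (f q) by near: q.
have d3 := mdom_refl (manifoldP P) (f q).
by rewrite -mulmxA ctransM.
Unshelve. all: by end_near. Qed.

End AtPoint.
End VectorFamilies.

(** * Smoothness of products and of horizontal lifts of families *)

Section GroupoidSmoothness.
Variables (R : realType) (G : lie_groupoid R).
Local Notation dG := (mdim (garr G)).
Local Notation dM := (mdim (gobj G)).
Local Notation MG := (manifoldP (garr G)).
Local Notation MM := (manifoldP (gobj G)).

Section AtPoint.
Variables (N : charted R) (S : set N) (p : N).
Hypotheses (dp : mdom p p) (Sp : S p).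

Lemma smooth_at_mul (f g : N -> G) : smooth_at S f p -> smooth_at S g p ->
  (forall q, S q -> src (f q) = tgt (g q)) ->
  smooth_at S (fun q => mul (f q) (g q)) p.
Proof.
move=> sf sg fg.
apply: (@smooth_at_comp _ _ _ _ _ (@composable R G)
    (fun q => (f q, g q) : prodm G G) (fun p => mul p.1 p.2)) => //.
  exact: smooth_at_pair.
by apply: mul_smooth; exact: fg.
Qed.

Lemma smooth_at_setT (P Q : charted R) (f : N -> P) (phi : P -> Q) :
  smooth_at S f p -> smooth_map setT phi -> smooth_at S (fun q => phi (f q)) p.
Proof.
move=> sf sphi; apply: (@smooth_at_comp _ _ _ _ _ setT f phi) => //.
exact: sphi.
Qed.

(** Same comparison with a single extension as for [vsmooth_mdiff]. Composability of the vectors at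
    each point of [S] supplies the curve of composable pairs that the comparison uses. *)
Lemma vsmooth_Dmul (f g : N -> G) X Y :
  smooth_at S f p -> smooth_at S g p ->
  (forall q, S q -> src (f q) = tgt (g q)) ->
  (forall q, S q -> Dsrc (f q) (X q) = Dtgt (g q) (Y q)) ->
  vsmooth S f p X -> vsmooth S g p Y ->
  vsmooth S (fun q => mul (f q) (g q)) p
    (fun q => Dmul (f q) (g q) (X q) (Y q)).
Proof.
move=> sf sg fg XY sX sY.
have [ O [F le]] := @mul_smooth R G (f p, g p) (fg p Sp); have [oO Op sF EF] := le.
have dfp := mdom_refl MG (f p); have dgp := mdom_refl MG (g p).
pose u q := row_mx (chart (f p) (f q)) (chart (g p) (g q)).
have su : csmooth S p u.
  by apply: csmooth_row_mx; apply: csmooth_along => //; exact: csmooth_chart.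
have s1 : csmooth S p (fun q => 'J F (u q)).
  exact: csmooth_fun (smooth_jacobian oO sF) _.
apply: csmooth_near (csmoothM (csmooth_row_mx sX sY) s1).
have nf := smooth_at_mdom dp Sp sf dfp; have ng := smooth_at_mdom dp Sp sg dgp.
have nS := mnbhs_in S p.
have nO : \forall q \near mnbhs S p, O (u q).
  have sfg : @smooth_at R N (prodm G G) S (fun q => (f q, g q)) p by exact: smooth_at_pair.
  have n0 : \forall y \near mnbhs setT ((f p, g p) : prodm G G), O (chart ((f p, g p) : prodm G G) y).
    exact: mnbhs_chart.
  exact: (smooth_at_cvg (S' := setT) dp Sp (fun _ _ => I) sfg n0).
near=> q.
have Sq : S q by near: q.
have d1 : mdom (f p) (f q) by near: q.
have d2 : mdom (g p) (g q) by near: q.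
have Oq : O (u q) by near: q.
have [c' vc'] := vel_exists (g q) (Y q).
have [c vc cc] := composable_lift (fg q Sq) (XY q Sq) vc'.
have [c0 vc1] := vc; have [c0' vc1'] := vc'.
have e1 : mdom (f p) (c 0) by rewrite c0.
have e2 : mdom (g p) (c' 0) by rewrite c0'.
have := vel_in_chart vc1 e1; rewrite c0 => vc2.
have := vel_in_chart vc1' e2; rewrite c0' => vc2'.
have := vel_in_pair vc2 vc2'; have := vel_pair vc vc' => v1 v2.
apply/esym; apply: (mdiff_coord (x := (f q, g q) : prodm G G) le) v1 v2 => //.
- exact: fg.
- apply: mul_smooth; exact: fg.
Unshelve. all: by end_near. Qed.

Variable sigma : forall g : G, 'Hom(tangent (src g), tangent g).
Hypothesis hsigma : is_ehresmann sigma.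

(** Smoothness of [sigma] is given by a matrix between two coordinate frames, so [X q] is expanded
    in the frame at [src (f p)]. *)
Lemma vsmooth_hlift (f : N -> G) X : smooth_at S f p ->
  vsmooth S (fun q => src (f q)) p X ->
  vsmooth S f p (fun q => hlift sigma (f q) (X q)).
Proof.
move=> sf sX; set r := src (f p).
have dfp := mdom_refl MG (f p); have dr := mdom_refl MM r.
have fr : frames (tangent_bundle (gobj G)) (coord_frame r) by exists r.
have fr' : frames (tangent_bundle (garr G)) (coord_frame (f p)) by exists (f p).
have [ O [c [oO Op sc Ec]]] := ehr_smooth hsigma fr fr' (p := f p) I dr dfp.
have s1 : csmooth S p (fun q => c (chart (f p) (f q))).
  apply: csmooth_fun sc _ => //.
  by apply: csmooth_along => //; exact: csmooth_chart.
apply: csmooth_near (csmoothM sX s1).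
have ssf : smooth_at S (fun q => src (f q)) p by apply: smooth_at_setT => //; exact: src_smooth.
have nf := smooth_at_mdom dp Sp sf dfp; have ns := smooth_at_mdom dp Sp ssf dr.
have nO : \forall q \near mnbhs S p, O (chart (f p) (f q)).
  have n0 : \forall y \near mnbhs setT (f p), O (chart (f p) y) by exact: mnbhs_chart.
  exact: (smooth_at_cvg (S' := setT) dp Sp (fun _ _ => I) sf n0).
near=> q.
have d1 : mdom (f p) (f q) by near: q.
have d2 : mdom r (src (f q)) by near: q.
have Oq : O (chart (f p) (f q)) by near: q.
have dfq := mdom_refl MG (f q).
have -> : hlift sigma (f q) (X q) = \sum_a (X q *m ctrans (src (f q)) r (src (f q))) 0 a *:
    hlift sigma (f q) (fvec (coord_frame r) a (src (f q))).
  rewrite [X in hlift _ _ X](coord_frame_decomp _ d2) linear_sum.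
  by apply: eq_bigr => a _; rewrite linearZ.
rewrite [X in X *m c _ = _]row_sum_delta !mulmx_suml; apply: eq_bigr => a _.
rewrite -!scalemxAl; congr (_ *: _).
have -> : hlift sigma (f q) (fvec (coord_frame r) a (src (f q))) =
    row a (c (chart (f p) (f q))) *m ctrans (f p) (f q) (f q).
  rewrite /hlift (Ec (f q) I d1 Oq d2 d1 a) [row a _]row_sum_delta mulmx_suml.
  by apply: eq_bigr => b _; rewrite -scalemxAl mul_jacobian mxE.
by rewrite -mulmxA ctransK// mulmx1 rowE.
Unshelve. all: by end_near. Qed.

End AtPoint.
End GroupoidSmoothness.

(** * Smooth sections in local frames *)

Section SmoothFamilies.
Variable R : realType.

(** Smoothness of a section of [Hom] is tested on one frame vector at a time; this is the condition
    on its image. *)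
Definition smooth_family (N P : charted R) (S : set N) (g : N -> P)
    (F : P -> vectType R) (e : local_frame F) (p : N)
    (Z : forall q, F (g q)) : Prop :=
  exists2 d : N -> 'rV[R]_(frank e), csmooth S p d &
    \forall q \near mnbhs S p, Z q = \sum_b d q 0 b *: fvec e b (g q).

Lemma smooth_coef_family (N P Q : charted R) (S : set N)
    (f : N -> P) (g : N -> Q) (E : P -> vectType R) (F : Q -> vectType R)
    (e : local_frame E) (e' : local_frame F)
    (Phi : forall q : N, 'Hom(E (f q), F (g q))) :
  (forall p, S p -> fdom e (f p) -> fdom e' (g p) -> forall a,
    smooth_family S e' p (fun q => Phi q (fvec e a (f q)))) ->
  smooth_coef S e e' Phi.
Proof.
move=> H p Sp ep ep'.
pose D a (d : N -> 'rV[R]_(frank e')) := csmooth S p d /\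
  \forall q \near mnbhs S p, Phi q (fvec e a (f q)) = \sum_b d q 0 b *: fvec e' b (g q).
have [d Hd] : {d & forall a, D a (d a)}.
  by apply: choice => a; have [d sd nd] := H p Sp ep ep' a; exists d.
have [ O [c [oO Op sc Ec]]] : csmooth S p (fun q => \matrix_(a, b) d a q 0 b).
  apply/csmooth_mxP => a b; have [/csmooth_mxP/(_ 0 b) + _] := Hd a.
  by apply: csmooth_near; apply: nearW => q; rewrite mxE.
have : \forall q \near mnbhs S p, forall a,
    Phi q (fvec e a (f q)) = \sum_b d a q 0 b *: fvec e' b (g q).
  by apply: filter_forall => a; have [] := Hd a.
rewrite nearE mnbhsE; move/nbhs_interior; set I := interior _ => nI.
exists (O `&` I), c; split.
- by apply: openI => //; exact: open_interior.
- by split; last exact: nbhs_singleton nI.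
- by apply: smooth_sub sc; exact: subIsetl.
- move=> q Sq dq [Oq /interior_subset Iq] _ _ a; rewrite (Iq q)//.
  by apply: eq_bigr => b _; rewrite -(Ec q)// mxE.
Qed.

Lemma smooth_family0 (N P : charted R) (S : set N) (g : N -> P)
    (F : P -> vectType R) (e : local_frame F) (p : N) :
  smooth_family S e p (fun q => 0 : F (g q)).
Proof.
exists (fun=> 0); first exact: csmooth_cst.
by apply: nearW => q; rewrite big1// => b _; rewrite mxE scale0r.
Qed.

Lemma smooth_family_near (N P : charted R) (S : set N) (g : N -> P)
    (F : P -> vectType R) (e : local_frame F) (p : N) (Z Z' : forall q, F (g q)) :
  (\forall q \near mnbhs S p, Z q = Z' q) -> smooth_family S e p Z ->
  smooth_family S e p Z'.
Proof.
move=> ZZ' [d sd nd]; exists d => //.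
by apply: filterS2 ZZ' nd => q ->.
Qed.

Lemma smooth_family_tangent (N : charted R) (P : manifold R) (S : set N) (g : N -> P)
    (r : P) (p : N) (Z : forall q, tangent (g q)) :
  mdom p p -> S p -> smooth_at S g p -> mdom r (g p) ->
  vsmooth S g p (fun q => Z q) -> smooth_family S (coord_frame r) p Z.
Proof.
move=> dp Sp sg dr sZ.
exists (fun q => (Z q : 'rV_(mdim P)) *m ctrans (g q) r (g q)).
  exact: vsmooth_coef.
have ng := smooth_at_mdom dp Sp sg dr.
by apply: filterS ng => q dq; exact: (coord_frame_decomp (Z q) dq).
Qed.

Lemma mopen_near (P : manifold R) (U : set P) x : mopen U -> U x ->
  \forall y \near mnbhs setT x, U y.
Proof.
move=> oU Ux; have dx := mdom_refl (manifoldP P) x.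
rewrite nearE mnbhsE.
have oW : open_nbhs (chart x x) (chart x @` (mdom x `&` U)).
  by split; [exact: oU|exists x].
apply: filterS (open_nbhs_nbhs oW) => y [z [dz Uz] <-] w _ dw Ew.
by rewrite (chart_inj dw dz Ew).
Qed.

Lemma tangent_is_frame (P : manifold R) (r : P) : is_frame (coord_frame r).
Proof.
split; first by move=> q; exact: (chart_open (manifoldP P)).
move=> x dr; have dx := mdom_refl (manifoldP P) x.
have sumE (al : 'rV[R]_(mdim P)) :
    \sum_i al 0 i *: fvec (coord_frame r) i x = al *m ctrans r x x :> 'rV_(mdim P).
  rewrite [al in RHS]row_sum_delta mulmx_suml; apply: eq_bigr => i _.
  by rewrite -scalemxAl mul_jacobian.
apply: frame_basis => [v|al].
  exists ((v : 'rV_(mdim P)) *m ctrans x r x); exact: coord_frame_decomp.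
move=> /(etrans (esym (sumE al))) al0.
by rewrite -[al]mulmx1 -(ctransK dr dx) mulmxA al0 mul0mx.
Qed.

Lemma tangent_vbundle (P : manifold R) : is_vbundle (tangent_bundle P).
Proof.
split.
- by move=> _ [r _ <-]; exact: tangent_is_frame.
- move=> x; exists (coord_frame x); first by exists x.
  exact: mdom_refl (manifoldP P) x.
- move=> _ _ [r _ <-] [r' _ <-]; apply: smooth_coef_family => x _ dr dr' a.
  have dx := mdom_refl (manifoldP P) x.
  have sid : @smooth_at R P P setT id x by exact: smooth_at_id.
  apply: smooth_family_near (smooth_family_tangent dx I sid dr' (vsmooth_coord dx I a sid dr)).
  by apply: nearW => q; rewrite id_lfunE.
Qed.

Lemma zero_vbundle (P : manifold R) : is_vbundle (zero_bundle P).
Proof.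
have z (u v : 'rV[R]_0) : u = v by apply/rowP => -[].
split.
- move=> _ ->; split => [q|x _].
    by rewrite setIT -(setIid (mdom q)); exact: (chart_open (manifoldP P)).
  apply: frame_basis => [v|al _]; last exact: z.
  by exists 0; exact: z.
- by move=> x; eexists.
- by move=> _ _ -> ->; apply: smooth_coef_family => p _ _ _ [].
Qed.

End SmoothFamilies.

(** * Smooth families in the Lie algebroid *)

Section Algebroid.
Variables (R : realType) (G : lie_groupoid R).
Local Notation dG := (mdim (garr G)).
Local Notation dM := (mdim (gobj G)).
Local Notation MG := (manifoldP (garr G)).
Local Notation MM := (manifoldP (gobj G)).

Section AtPoint.
Variables (N : charted R) (S : set N) (p : N).
Hypotheses (dp : mdom p p) (Sp : S p).

Lemma algd_frame_vsmooth (f : N -> gobj G) e a : frames (algebroid G) e ->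
  smooth_at S f p -> fdom e (f p) ->
  vsmooth S (fun q => unt (f q)) p (fun q => aval (fvec e a (f q))).
Proof.
move=> [[oe _] se] sf ep; set x0 := f p.
have du := mdom_refl MG (unt x0).
have fr : frames (tangent_bundle (garr G)) (coord_frame (unt x0)) by exists (unt x0).
have [ O [c [oO Op sc Ec]]] := se _ fr x0 I ep du.
have s1 : csmooth S p (fun q => c (chart x0 (f q))).
  apply: csmooth_fun sc _ => //.
  by apply: csmooth_along => //; apply: csmooth_chart; exact: mdom_refl MM _.
apply: csmooth_near (csmoothM (csmooth_cst S p (delta_mx 0 a)) s1).
have suf : smooth_at S (fun q => unt (f q)) p.
  by apply: smooth_at_setT => //; exact: unt_smooth.
have nf := smooth_at_mdom dp Sp sf (mdom_refl MM x0).
have nu := smooth_at_mdom dp Sp suf du.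
have nO : \forall q \near mnbhs S p, O (chart x0 (f q)).
  have n0 : \forall y \near mnbhs setT x0, O (chart x0 y) by exact: mnbhs_chart.
  exact: (smooth_at_cvg (S' := setT) dp Sp (fun _ _ => I) sf n0).
have ne : \forall q \near mnbhs S p, fdom e (f q).
  exact: (smooth_at_cvg (S' := setT) dp Sp (fun _ _ => I) sf (mopen_near oe ep)).
near=> q.
have d1 : mdom x0 (f q) by near: q.
have d2 : mdom (unt x0) (unt (f q)) by near: q.
have d3 : fdom e (f q) by near: q.
have Oq : O (chart x0 (f q)) by near: q.
have := Ec (f q) I d1 Oq d3 d2 a; rewrite algd_inclE => ->.
have duq := mdom_refl MG (unt (f q)).
rewrite -rowE [LHS]row_sum_delta mulmx_suml; apply: eq_bigr => b _.
rewrite mxE -scalemxAl; congr (_ *: _).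
rewrite [X in X *m _](_ : _ = delta_mx 0 b *m ctrans (unt x0) (unt (f q)) (unt (f q))).
  by rewrite -mulmxA ctransK// mulmx1.
by rewrite mul_jacobian.
Unshelve. all: by end_near. Qed.

Lemma csmooth_near_unit n (phi : N -> 'M[R]_n) : csmooth S p phi ->
  phi p \in unitmx -> \forall q \near mnbhs S p, phi q \in unitmx.
Proof.
move=> [ O [c [oO Op sc Ec]]] Up.
have oO' : open (O `&` (fun z => \det (c z)) @^-1` [set r | r != 0]).
  have cdet y : O y -> {for y, continuous (fun z => \det (c z))}.
    exact/smooth_continuous/smooth_det.
  by apply: open_setI_preimage => //; exact: open_neq.
have Op' : (O `&` (fun z => \det (c z)) @^-1` [set r | r != 0]) (chart p p).
  by split => //=; rewrite -unitfE -[_ \is a _]/(_ \in unitmx) -Ec.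
have nO := mnbhs_chart S oO' Op'; have nd := mnbhs_dom S p; have nS := mnbhs_in S p.
near=> q.
have [Oq] : (O `&` (fun z => \det (c z)) @^-1` [set r | r != 0]) (chart p q) by near: q.
have dq : mdom p q by near: q.
have Sq : S q by near: q.
by rewrite /= Ec// -unitfE.
Unshelve. all: by end_near. Qed.

Lemma aval_sum (x : gobj G) (I : finType) (c : I -> R) (a : I -> algd x) :
  aval (\sum_i c i *: a i) = \sum_i c i *: aval (a i).
Proof.
rewrite /aval (raddf_sum vsval); apply: eq_bigr => i _.
exact: (linearZZ vsval).
Qed.

(** Converse to [algd_frame_vsmooth]: a family in [A] that is smooth in [TG] has smooth
    coefficients. The rows of [C q] are the frame vectors in a fixed chart, so the coefficients [al]
    solve [al *m C q = aval (Y q) *m T q]. *)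
Lemma smooth_family_algd (g : N -> gobj G) e (Y : forall q, algd (g q)) :
  frames (algebroid G) e -> smooth_at S g p -> fdom e (g p) ->
  vsmooth S (fun q => unt (g q)) p (fun q => aval (Y q)) ->
  smooth_family S e p Y.
Proof.
move=> fe sg ep sY; have [[oe be] se] := fe; set x0 := g p.
pose T q := ctrans (unt (g q)) (unt x0) (unt (g q)).
pose C q := \matrix_b (aval (fvec e b (g q)) *m T q).
have sC : csmooth S p C.
  apply/csmooth_mxP => b j.
  have /csmooth_mxP/(_ 0 j) := algd_frame_vsmooth b fe sg ep.
  by apply: csmooth_near; apply: nearW => q; rewrite [RHS]mxE.
have Csum q (al : 'rV[R]_(frank e)) :
    al *m C q = aval (\sum_b al 0 b *: fvec e b (g q)) *m T q.
  rewrite aval_sum mulmx_suml mulmx_sum_row; apply: eq_bigr => b _.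
  by rewrite rowK scalemxAl.
have du := mdom_refl MG (unt x0).
have Cfree : row_free (C p).
  apply/row_freeP; apply/row_freeP; rewrite -kermx_eq0; apply/eqP/row_matrixP => i.
  rewrite row0; apply: (frame_free (be _ ep)).
  apply: aval_inj; rewrite [RHS](raddf0 vsval).
  have : row i (kermx (C p)) *m C p = 0 by rewrite -row_mul mulmx_ker row0.
  by rewrite Csum /T ctrans_id// mulmx1.
(* [C q] is rectangular. Its right inverse [D] at [p] makes [C q *m D] square, and invertible for
   [q] near [p], which gives a smooth formula for the coefficients. *)
have [D CD] := row_freeP Cfree.
have CDU : C p *m D \in unitmx by rewrite CD unitmx1.
have sCD : csmooth S p (fun q => C q *m D) by apply: csmoothM => //; exact: csmooth_cst.
exists (fun q => (aval (Y q) *m T q) *m D *m invmx (C q *m D)).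
  apply: csmoothM; last exact: (csmooth_inv dp Sp CDU sCD).
  by apply: csmoothM => //; exact: csmooth_cst.
have ne : \forall q \near mnbhs S p, fdom e (g q).
  exact: (smooth_at_cvg (S' := setT) dp Sp (fun _ _ => I) sg (mopen_near oe ep)).
have nU := csmooth_near_unit sCD CDU.
near=> q.
have eq : fdom e (g q) by near: q.
have Uq : C q *m D \in unitmx by near: q.
have [al ->] := frame_span (Y q) (be _ eq).
by rewrite -Csum -(mulmxA al) mulmxK.
Unshelve. all: by end_near. Qed.

End AtPoint.
End Algebroid.

(** * Local frames of the Lie algebroid *)

(* [1 - S (B S)^-1 B] projects onto the kernel of [S], and the kernel of [S0]
   is mapped isomorphically by it. *)
Section KernelFrame.
Variables (F : fieldType) (n m : nat) (S0 S : 'M[F]_(n, m)) (B : 'M[F]_(m, n)).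
Hypotheses (BS0 : B *m S0 = 1%:M) (BSU : B *m S \in unitmx).

Definition kernel_proj := 1%:M - S *m invmx (B *m S) *m B.
Definition kernel_frame := row_base (kermx S0) *m kernel_proj.

Lemma kernel_frameK : kernel_frame *m S = 0.
Proof.
rewrite /kernel_frame -mulmxA mulmxBl mul1mx -!mulmxA mulVmx// mulmx1 subrr.
by rewrite !mulmx0.
Qed.

(** [w - w *m S0 *m B] is in the kernel of [S0], while [kernel_proj] kills [B] and fixes [w]. *)
Lemma kernel_frame_span (w : 'rV[F]_n) : w *m S = 0 ->
  exists al, w = al *m kernel_frame.
Proof.
move=> wS.
have wP : w *m kernel_proj = w.
  by rewrite mulmxBr mulmx1 !mulmxA wS !mul0mx subr0.
have BP : B *m kernel_proj = 0.
  by rewrite mulmxBr mulmx1 !mulmxA mulmxV// mul1mx subrr.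
have : (w - w *m S0 *m B <= row_base (kermx S0))%MS.
  by rewrite eq_row_base; apply/sub_kermxP; rewrite mulmxBl -[_ *m B *m S0]mulmxA BS0 mulmx1 subrr.
move=> /submxP[al E]; exists al; rewrite mulmxA -E mulmxBl wP -[w *m S0 *m B *m _]mulmxA BP.
by rewrite mulmx0 subr0.
Qed.

(** If the projection kills a vector of the kernel of [S0], that vector is a multiple of [B];
    multiplication by [S0] shows that the multiplier is 0. *)
Lemma kernel_frame_free (al : 'rV[F]_(\rank (kermx S0))) :
  al *m kernel_frame = 0 -> al = 0.
Proof.
rewrite mulmxA mulmxBr mulmx1 => /eqP; rewrite subr_eq0 => /eqP E.
have KS : row_base (kermx S0) *m S0 = 0.
  by apply/sub_kermxP; rewrite eq_row_base.
have z0 : al *m row_base (kermx S0) *m (S *m invmx (B *m S)) = 0.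
  have := congr1 (fun A => A *m S0) E; rewrite -[LHS]mulmxA KS mulmx0.
  by rewrite !mulmxA -[_ *m B *m S0]mulmxA BS0 mulmx1 => <-.
apply: (row_free_inj (row_base_free (kermx S0))).
by rewrite mul0mx E mulmxA z0 mul0mx.
Qed.

End KernelFrame.

Section AlgebroidBundle.
Variables (R : realType) (G : lie_groupoid R).
Local Notation dG := (mdim (garr G)).
Local Notation dM := (mdim (gobj G)).
Local Notation MG := (manifoldP (garr G)).
Local Notation MM := (manifoldP (gobj G)).

Lemma mopen_chart (P : manifold R) (x0 : P) (W : set 'rV[R]_(mdim P)) :
  open W -> mopen [set x | mdom x0 x /\ W (chart x0 x)].
Proof.
move=> oW p; have MP := manifoldP P.
have -> : chart p @` (mdom p `&` [set x | mdom x0 x /\ W (chart x0 x)]) =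
    (chart p @` (mdom p `&` mdom x0)) `&` (chart x0 \o chartV p) @^-1` W.
  apply/seteqP; split=> [y [x [dx [dx0 Wx]] <-]|y [/chart_image[dy dy0 ch] Wy]].
    by split; [exists x|rewrite /= (chartK MP)].
  by exists (chartV p y).
have cf := smooth_continuous (chart_smooth MP p x0).
exact: (open_setI_preimage (@chart_open _ _ MP p x0) cf oW).
Qed.

Section LocalFrame.
Variables (x0 : gobj G) (O1 : set 'rV[R]_dM) (U1 : 'rV[R]_dM -> 'rV[R]_dG).
Hypothesis le1 : local_ext setT (@unt R G) x0 O1 U1.
Variables (O : set 'rV[R]_dG) (F : 'rV[R]_dG -> 'rV[R]_dM).
Hypothesis le : local_ext setT (@src R G) (unt x0) O F.
Let u0 := unt x0.
Variable B : 'M[R]_(dM, dG).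
Hypothesis BJ : B *m 'J F (chart u0 u0) = 1%:M.

(** Where [B *m 'J F] is invertible, as the kernel frame requires; [W] pulls this back to the base
    along the unit map. *)
Let W2 := O `&` (fun y => \det (B *m 'J F y)) @^-1` [set r | r != 0].
Let W := O1 `&` U1 @^-1` W2.

Let E x := kernel_frame ('J F (chart u0 u0)) ('J F (chart u0 (unt x))) B.

(** The rows of [E x] are components in the chart around [unt x0]; [ctrans] converts them to the
    chart centred at [unt x], in which the fibre is presented. On [fdom] they lie in the kernel, so
    [vsproj] does not alter them. *)
Definition algd_local_frame : local_frame (@algd R G) :=
  @LocalFrame R (gobj G) (@algd R G) [set x | mdom x0 x /\ W (chart x0 x)]
    (\rank (kermx ('J F (chart u0 u0))))
    (fun a x => vsproj _ (row a (E x) *m ctrans u0 (unt x) (unt x))).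
Local Notation e := algd_local_frame.

Let oW : open W.
Proof.
have [oO1 _ sU _] := le1; have [oO _ sF _] := le.
have oW2 : open W2.
  have cdet y : O y -> {for y, continuous (fun z => \det (B *m 'J F z))}.
    apply/smooth_continuous/smooth_det => //; apply: smooth_mulmx => //.
      by move=> k; exact: Ck_cst.
    exact: smooth_jacobian.
  exact: (open_setI_preimage oO cdet (@open_neq _ _)).
exact: (open_setI_preimage oO1 (smooth_continuous sU) oW2).
Qed.

Let e_dom x : fdom e x -> [/\ mdom u0 (unt x), O (chart u0 (unt x)) &
  B *m 'J F (chart u0 (unt x)) \in unitmx].
Proof.
move=> [dx [ O1x [/= Ox /= Ux]]]; have [_ _ _ /(_ x I dx O1x)[du Eu]] := le1.
rewrite -Eu in Ox Ux; split => //.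
by rewrite unitmxE unitfE.
Qed.

Lemma algd_local_frame_center : fdom e x0.
Proof.
have dx := mdom_refl MM x0; have [_ O1x _ /(_ x0 I dx O1x)[du Eu]] := le1.
have [_ Ou _ _] := le.
split => //; split => //; rewrite /= -Eu; split => //=.
by rewrite BJ det1 oner_neq0.
Qed.

Let Dsrc_coord x (v : 'rV[R]_dG) : fdom e x ->
  Dsrc (unt x) v *m ctrans (src (unt x)) (src u0) (src (unt x)) =
  v *m ctrans (unt x) u0 (unt x) *m 'J F (chart u0 (unt x)).
Proof.
move=> /e_dom[du Ou _].
have [c vc] := vel_exists (unt x) v; have [c0 vc1] := vc.
have d0 : mdom u0 (c 0) by rewrite c0.
have := vel_in_chart vc1 d0; rewrite c0 => vc2.
apply: (mdiff_coord le) vc vc2 => //; first exact: src_smooth.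
exact: near0W.
Qed.

Let Dsrc_ker x (w : 'rV[R]_dG) : fdom e x ->
  Dsrc (unt x) (w *m ctrans u0 (unt x) (unt x)) = 0 <->
  w *m 'J F (chart u0 (unt x)) = 0.
Proof.
move=> ex; have [du Ou _] := e_dom ex; have dux := mdom_refl MG (unt x).
have := Dsrc_coord (w *m ctrans u0 (unt x) (unt x)) ex.
rewrite -(mulmxA w) ctransK// mulmx1 => Ew.
have d1 := mdom_refl MM (src (unt x)).
have d2 : mdom (src u0) (src (unt x)).
  by have [_ _ _ /(_ _ I du Ou)[]] := le.
split => [w0|w0]; first by rewrite -Ew w0 mul0mx.
rewrite -[LHS]mulmx1 -(ctransK d1 d2) mulmxA Ew w0 mul0mx//.
Qed.

Let avalE a x : fdom e x ->
  aval (fvec e a x) = row a (E x) *m ctrans u0 (unt x) (unt x).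
Proof.
move=> ex; have [_ _ BU] := e_dom ex; apply: aval_proj; apply/(Dsrc_ker _ ex).
by rewrite -row_mul kernel_frameK// row0.
Qed.

Let aval_sumE (al : 'rV_(frank e)) x : fdom e x ->
  aval (\sum_i al 0 i *: fvec e i x) = (al *m E x) *m ctrans u0 (unt x) (unt x).
Proof.
move=> ex; rewrite aval_sum [al *m _]mulmx_sum_row mulmx_suml; apply: eq_bigr => i _.
by rewrite avalE// -scalemxAl.
Qed.

Lemma algd_local_frame_frames : frames (algebroid G) e.
Proof.
have [oO1 _ sU _] := le1; have [oO _ sF _] := le.
split.
  split=> [|x ex]; first exact: mopen_chart.
  have [du Ou BU] := e_dom ex; have dux := mdom_refl MG (unt x).
  apply: frame_basis => [v|al].
    have vE : aval v = (aval v *m ctrans (unt x) u0 (unt x)) *m ctrans u0 (unt x) (unt x).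
      by rewrite -mulmxA ctransK// mulmx1.
    have := avalP v; rewrite vE => /(Dsrc_ker _ ex).
    move=> /(kernel_frame_span BJ BU)[al Eal]; exists al; apply: aval_inj.
    by rewrite aval_sumE// -Eal.
  move=> /(congr1 (@aval R G x)); rewrite aval_sumE// [RHS](raddf0 vsval) => al0.
  apply: (kernel_frame_free BJ (S := 'J F (chart u0 (unt x)))).
  by rewrite -[LHS]mulmx1 -(ctransK du dux) mulmxA al0 mul0mx.
move=> _ [r _ <-]; apply: smooth_coef_family => x _ ex dr a.
have dx := mdom_refl MM x; have dux := mdom_refl MG (unt x).
have [du Ou BU] := e_dom ex.
apply: smooth_family_tangent => //; first exact: unt_smooth.
have su : smooth_at setT (@unt R G) x by exact: unt_smooth.
have sJ : csmooth setT x (fun q => 'J F (chart u0 (unt q))).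
  apply: (csmooth_along (phi := fun y => 'J F (chart u0 y)) dx I su).
  apply: (csmooth_fun _ _ oO Ou (smooth_jacobian oO sF)) => //.
  exact: csmooth_chart.
have sE : csmooth setT x E.
  apply: csmoothM; first exact: csmooth_cst.
  apply: csmoothD; first exact: csmooth_cst.
  have sBJ : csmooth setT x (fun q => B *m 'J F (chart u0 (unt q))).
    by apply: csmoothM => //; exact: csmooth_cst.
  have sI := csmooth_inv dx I BU sBJ.
  have := csmoothM (csmoothM sJ sI) (csmooth_cst setT x (- B)).
  by apply: csmooth_near; apply: nearW => q; rewrite mulmxN.
have sT := csmooth_along dx I su (csmooth_ctrans du dux).
apply: csmooth_near (csmoothM (csmoothM (csmooth_cst setT x (delta_mx 0 a)) sE) sT).
have ne := mopen_near (mopen_chart (x0 := x0) oW) ex.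
have nu := smooth_at_mdom dx I su dux.
near=> q.
have eq : fdom e q by near: q.
have d1 : mdom (unt x) (unt q) by near: q.
have [d2 _ _] := e_dom eq.
have d3 := mdom_refl MG (unt q).
rewrite (algd_inclE (fvec e a q)) (avalE a eq) -(mulmxA (row a (E q))).
by rewrite (ctransM d2 d3 d1) rowE.
Unshelve. all: by end_near. Qed.

End LocalFrame.

Lemma algebroid_vbundle : is_vbundle (algebroid G).
Proof.
split.
- by move=> e [].
- move=> x0; have [ O1 [U1 le1]] := @unt_smooth R G x0 I.
  have [ O [F [le dE]]] := mdiff_local_ext (@src_smooth R G (unt x0) I).
  have [B BJ] := submersion_right_inverse (src_submersion (unt x0)) dE.
  exists (algd_local_frame x0 O1 U1 O F B).
    exact: (algd_local_frame_frames le1 le BJ).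
  exact: (algd_local_frame_center le1 le BJ).
- move=> e e' fe fe'; apply: smooth_coef_family => x _ ex ex' a.
  have dx := mdom_refl MM x.
  have sid : @smooth_at R (gobj G) (gobj G) setT id x by exact: smooth_at_id.
  apply: smooth_family_near (smooth_family_algd dx I fe' sid ex' (algd_frame_vsmooth dx I a fe sid ex)).
  by apply: nearW => q; rewrite id_lfunE.
Qed.

End AlgebroidBundle.

(** * The adjoint representation *)

Section AdjointAlgebra.
Variables (R : realType) (G : lie_groupoid R).
Local Notation dG := (mdim (garr G)).
Local Notation dM := (mdim (gobj G)).
Local Notation TG := (tangent_groupoid_of G).
Variable sigma : forall g : G, 'Hom(tangent (src g), tangent g).
Hypothesis hsigma : is_ehresmann sigma.
Local Notation hl := (hl sigma).
Local Notation Q := (Ad_ops sigma).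

Let ds_hl g (e : 'rV[R]_dM) : ds TG g (hl g e) = e.
Proof. exact: Dsrc_hlift. Qed.
Let hl_unt x (e : 'rV[R]_dM) : hl (unt x) e = du TG x e.
Proof. exact: hlift_unt. Qed.

Lemma avalD (x : gobj G) (a b : algd x) : aval (a + b) = aval a + aval b.
Proof. exact: (raddfD vsval). Qed.

Lemma aval_cast (x y : gobj G) (a : algd x) : x = y ->
  aval (algd_cast x y a) = aval a.
Proof. by move=> xy; subst y; rewrite algd_castE. Qed.

(** [hom_A], [hom_T] and [hom_K] name the nonzero components of [Ad_ops] on one or two arrows, to
    which they are convertible, with source and target left free as in [cochains]. *)
Definition hom_A (g : G) (x y : gobj G) : 'Hom(algd x, algd y) :=
  (algd_cast (tgt g) y \o qact_A sigma g \o algd_cast x (src g))%VF.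
Definition hom_T (g : G) (x y : gobj G) : 'Hom(tangent x, tangent y) :=
  qact_T sigma g.
Definition hom_K (g h : G) (x y : gobj G) : 'Hom(tangent x, algd y) :=
  (algd_cast (tgt (mul g h)) y \o basic_curv sigma g h)%VF.

Lemma hom_AE (g : G) (x y : gobj G) (a : algd x) : x = src g -> tgt g = y ->
  aval (hom_A g x y a) = actA TG hl g (aval a).
Proof.
move=> xg gy.
have -> : hom_A g x y a = algd_cast (tgt g) y (qact_A sigma g (algd_cast x (src g) a)).
  by rewrite /hom_A [LHS]comp_lfunE [LHS]comp_lfunE.
by rewrite (aval_cast _ gy) (qact_AE hsigma) aval_cast.
Qed.

Lemma hom_TE (g : G) (x y : gobj G) (v : tangent x) :
  hom_T g x y v = actT TG hl g v :> 'rV[R]_dM.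
Proof. exact: qact_TE. Qed.

Lemma hom_KE (g h : G) (x y : gobj G) (v : tangent x) : src g = tgt h ->
  tgt g = y -> aval (hom_K g h x y v) = bcurv TG hl g h v.
Proof.
move=> gh gy.
have -> : hom_K g h x y v = algd_cast (tgt (mul g h)) y (basic_curv sigma g h v).
  by rewrite /hom_K [LHS]comp_lfunE.
rewrite (aval_cast _ (etrans (tgt_mul gh) gy)).
exact: (basic_curvE hsigma v gh).
Qed.

#[local] Opaque anchor hom_A hom_T hom_K.

Lemma hom_anchor_A (g : G) x y : x = src g -> tgt g = y ->
  (anchor y \o hom_A g x y)%VF = (hom_T g x y \o anchor x)%VF.
Proof.
move=> xg gy; subst x y; apply/lfunP => a; rewrite [LHS]comp_lfunE [RHS]comp_lfunE.
apply: etrans (anchorE _) _; apply/esym; apply: etrans (hom_TE _ _ _) _.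
apply: etrans (congr1 (actT TG hl g) (anchorE a)) _.
rewrite (hom_AE a erefl erefl); apply/esym.
exact: (anchor_actA (tg := TG) ds_hl (avalP a)).
Qed.

Lemma aval_subE (V : vectType R) (y : gobj G) (f f' : 'Hom(V, algd y)) v :
  aval ((f - f') v) = aval (f v) - aval (f' v).
Proof. by rewrite add_lfunE opp_lfunE avalD avalN. Qed.

Lemma aval_addE (V : vectType R) (y : gobj G) (f f' : 'Hom(V, algd y)) v :
  aval ((f + f') v) = aval (f v) + aval (f' v).
Proof. by rewrite add_lfunE avalD. Qed.

Lemma aval_compE (V W : vectType R) (y : gobj G) (f : 'Hom(W, algd y))
    (f' : 'Hom(V, W)) v : aval ((f \o f')%VF v) = aval (f (f' v)).
Proof. by rewrite comp_lfunE. Qed.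

Lemma sub_lfunE (V W : vectType R) (f f' : 'Hom(V, W)) v :
  (f - f') v = f v - f' v.
Proof. by rewrite add_lfunE opp_lfunE. Qed.

Let subC2 (V : zmodType) (a a' b b' : V) : a = a' -> b = b' -> a - b = a' - b'.
Proof. by move=> -> ->. Qed.

Let addC2 (V : zmodType) (a a' b b' : V) : a = a' -> b = b' -> a + b = a' + b'.
Proof. by move=> -> ->. Qed.

Lemma hom_A_mul (g h : G) x y : src g = tgt h -> x = src h -> tgt g = y ->
  (hom_A g (tgt h) y \o hom_A h x (tgt h))%VF - hom_A (mul g h) x y =
  (hom_K g h x y \o anchor x)%VF.
Proof.
move=> gh xh gy; subst x y; apply/lfunP => a; apply: aval_inj.
have E1 : aval ((hom_A g (tgt h) (tgt g) \o hom_A h (src h) (tgt h))%VF a) =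
    actA TG hl g (actA TG hl h (aval a)).
  apply: etrans (aval_compE _ _ _) _; apply: etrans (hom_AE _ (esym gh) erefl) _.
  by apply: (congr1 (actA TG hl g)); exact: hom_AE.
have E2 : aval (hom_A (mul g h) (src h) (tgt g) a) = actA TG hl (mul g h) (aval a).
  exact: hom_AE (esym (src_mul gh)) (tgt_mul gh).
have E3 : aval ((hom_K g h (src h) (tgt g) \o anchor (src h))%VF a) =
    bcurv TG hl g h (Dtgt (unt (src h)) (aval a)).
  apply: etrans (aval_compE _ _ _) _; apply: etrans (hom_KE _ gh erefl) _.
  by apply: (congr1 (bcurv TG hl g h)); exact: anchorE.
apply: etrans (aval_subE _ _ _) _; apply: etrans (subC2 E1 E2) _.
apply: etrans _ (esym E3); exact: (actA_mul (tg := TG) ds_hl gh (avalP a)).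
Qed.

Lemma hom_anchor_K (g h : G) x y : src g = tgt h -> x = src h -> tgt g = y ->
  (anchor y \o hom_K g h x y)%VF =
  (hom_T g (tgt h) y \o hom_T h x (tgt h))%VF - hom_T (mul g h) x y.
Proof.
move=> gh xh gy; subst x y; apply/lfunP => v.
have E1 : (hom_T g (tgt h) (tgt g) \o hom_T h (src h) (tgt h))%VF v =
    actT TG hl g (actT TG hl h v) :> 'rV[R]_dM.
  apply: etrans (comp_lfunE _ _ _) _; apply: etrans (hom_TE _ _ _) _.
  by apply: (congr1 (actT TG hl g)); exact: hom_TE.
apply: etrans _ (esym (sub_lfunE _ _ _)).
apply: etrans _ (esym (subC2 E1 (hom_TE (mul g h) (tgt g) v))).
apply: etrans (comp_lfunE _ _ _) _; apply: etrans (anchorE _) _.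
rewrite (hom_KE _ gh erefl).
exact: (anchor_bcurv (tg := TG) ds_hl v gh).
Qed.

Lemma hom_K_cocycle (g h k : G) x y : src g = tgt h -> src h = tgt k ->
  x = src k -> tgt g = y ->
  hom_K g (mul h k) x y + (hom_A g (tgt h) y \o hom_K h k x (tgt h))%VF =
  hom_K (mul g h) k x y + (hom_K g h (tgt k) y \o hom_T k x (tgt k))%VF.
Proof.
move=> gh hk xk gy; subst x y; apply/lfunP => v; apply: aval_inj.
have ghk : src g = tgt (mul h k) by rewrite tgt_mul.
have gh_k : src (mul g h) = tgt k by rewrite src_mul.
have E1 := hom_KE v ghk erefl.
have E2 : aval ((hom_A g (tgt h) (tgt g) \o hom_K h k (src k) (tgt h))%VF v) =
    actA TG hl g (bcurv TG hl h k v).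
  apply: etrans (aval_compE _ _ _) _; apply: etrans (hom_AE _ (esym gh) erefl) _.
  by apply: (congr1 (actA TG hl g)); exact: hom_KE.
have E3 := hom_KE v gh_k (tgt_mul gh).
have E4 : aval ((hom_K g h (tgt k) (tgt g) \o hom_T k (src k) (tgt k))%VF v) =
    bcurv TG hl g h (actT TG hl k v).
  apply: etrans (aval_compE _ _ _) _; apply: etrans (hom_KE _ gh erefl) _.
  by apply: (congr1 (bcurv TG hl g h)); exact: hom_TE.
apply: etrans (aval_addE _ _ _) _; apply: etrans _ (esym (aval_addE _ _ _)).
apply: etrans (addC2 E1 E2) _; apply: etrans _ (esym (addC2 E3 E4)).
exact: (bcurv_cocycle (tg := TG) ds_hl v gh hk).
Qed.

Lemma zero_dom (V : vectType R) (i : int) x (f g : 'Hom(Ad G i x, V)) :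
  i != 0 -> i != 1 -> f = g.
Proof.
have z (u : 'rV[R]_0) : u = 0 by apply/rowP => -[].
case: i f g => [[|[|n]]|n]//= f g _ _; apply/lfunP => u.
  by rewrite (z u) !linear0.
by rewrite (z u) !linear0.
Qed.

Lemma zero_cod (V : vectType R) (i : int) x (f g : 'Hom(V, Ad G i x)) :
  i != 0 -> i != 1 -> f = g.
Proof.
by case: i f g => [[|[|n]]|n]//= f g _ _; apply/lfunP => u; apply/rowP => -[].
Qed.

End AdjointAlgebra.

(** * Degrees, structure equations and unitality *)

Section AdjointEquations.
Variables (R : realType) (G : lie_groupoid R).
Variable sigma : forall g : G, 'Hom(tangent (src g), tangent g).
Hypothesis hsigma : is_ehresmann sigma.
Local Notation Q := (Ad_ops sigma).

Lemma Ad_degree k (gs : seq G) x y (i j : int) :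
  j != i + 1 - k%:Z -> Q k gs x y i j = 0.
Proof.
case: i => [[|[|i]]|i]; case: j => [[|[|j]]|j] //.
- by case: k => [|[|k]].
- by case: k => [|k].
- by case: k => [|[|[|k]]].
- by case: k => [|[|k]].
Qed.

Let sum11 (V : zmodType) (F : nat -> V) : \sum_(1 <= j < 2) F j = F 1%N.
Proof. by rewrite big_nat1. Qed.
Let sum12 (V : zmodType) (F : nat -> V) : \sum_(1 <= j < 3) F j = F 1%N + F 2%N.
Proof. by rewrite big_ltn// big_nat1. Qed.
Let sum2 (V : zmodType) (F : nat -> V) : \sum_(0 <= j < 2) F j = F 0%N + F 1%N.
Proof. by rewrite big_ltn// big_nat1. Qed.
Let sum3 (V : zmodType) (F : nat -> V) :
  \sum_(0 <= j < 3) F j = F 0%N + F 1%N + F 2%N.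
Proof. by rewrite big_nat_recr //= sum2. Qed.
Let sum4 (V : zmodType) (F : nat -> V) :
  \sum_(0 <= j < 4) F j = F 0%N + F 1%N + F 2%N + F 3%N.
Proof. by rewrite big_nat_recr //= sum3. Qed.

Let sgn0 (V : lmodType R) (v : V) : (-1) ^+ 0 *: v = v.
Proof. by rewrite expr0 scale1r. Qed.
Let sgn1 (V : lmodType R) (v : V) : (-1) ^+ 1 *: v = - v.
Proof. by rewrite expr1 scaleN1r. Qed.
Let sgn2 (V : lmodType R) (v : V) : (-1) ^+ 2 *: v = v.
Proof. by rewrite sqrrN expr1n scale1r. Qed.
Let comp_zero (V W : vectType R) (i : int) x (f : 'Hom(Ad G i x, W))
    (f' : 'Hom(V, Ad G i x)) (r : R) :
  i != 0 -> i != 1 -> r *: (f \o f')%VF = 0.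
Proof.
move=> i0 i1; rewrite (zero_cod f' 0 i0 i1); apply/lfunP => v.
by rewrite scale_lfunE comp_lfunE !zero_lfunE linear0 scaler0.
Qed.

Let eq2 (V : zmodType) (a b a' b' : V) : a = a' -> b = b' -> a + b = a' + b'.
Proof. by move=> -> ->. Qed.

Let eq3 (V : zmodType) (a b c a' b' c' : V) :
  a = a' -> b = b' -> c = c' -> a + b + c = a' + b' + c'.
Proof. by move=> -> -> ->. Qed.

Let eq4 (V : zmodType) (a b c d a' b' c' d' : V) :
  a = a' -> b = b' -> c = c' -> d = d' -> a + b + c + d = a' + b' + c' + d'.
Proof. by move=> -> -> -> ->. Qed.

Let shuffle (V : zmodType) (a b c d : V) : b + c = a + d -> - a + b = - c + d.
Proof.
by move=> E; rewrite [RHS]addrC -[d](addKr a) -E addrA addrK.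
Qed.

(** Source degree [i] and target degree [i + 2 - k] must both be 0 or 1. This leaves [k = 1, 2] for
    [i = 0], settled by [hom_anchor_A] and [hom_A_mul], and [k = 2, 3] for [i = 1], settled by
    [hom_anchor_K] and [hom_K_cocycle]. *)
Lemma Ad_ruth_eq k (gs : seq G) x y (i : int) :
  size gs = k -> gpath x gs y ->
  \sum_(1 <= j < k)
    (-1) ^+ j *: Q k.-1 (Defs.contract j gs) x y i (i + 2 - k%:Z) =
  \sum_(0 <= j < k.+1)
    (-1) ^+ j *:
      (Q j (take j gs) (stgt x (drop j gs)) y
           (i + 1 - (k - j)%N%:Z) (i + 2 - k%:Z) \o
       Q (k - j)%N (drop j gs) x (stgt x (drop j gs))
           i (i + 1 - (k - j)%N%:Z))%VF.
Proof.
have [->|i0] := eqVneq i 0; last first.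
  have [->|i1] := eqVneq i 1; last by move=> *; exact: zero_dom.
  case: k gs => [|[|[|[|k]]]] gs.
  - by move=> *; apply: zero_cod.
  - by move=> *; apply: zero_cod.
  - case: gs => [|g [|h []]]// _ [gy [hg hx]]; subst y.
    have gh := esym hg.
    apply: etrans _ (esym (sum3 _)).
    apply: etrans (sum11 _) _.
    apply: etrans (sgn1 (hom_T sigma (mul g h) x (tgt g))) _.
    have E0 := sgn0 (anchor (tgt g) \o hom_K sigma g h x (tgt g))%VF.
    have E1 := sgn1 (hom_T sigma g (tgt h) (tgt g) \o hom_T sigma h x (tgt h))%VF.
    (* This summand factors through degree 2, where the fibre is zero; other summands below factor
       through degree -1. *)
    have E2 := @comp_zero _ _ 2 x (Q 2%N [:: g; h] x (tgt g) 2 1) (Q 0%N [::] x x 1 2) ((-1) ^+ 2) isT isT.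
    apply: etrans _ (esym (eq3 E0 E1 E2)).
    rewrite (hom_anchor_K hsigma gh hx erefl) addr0 addrAC subrr sub0r.
    reflexivity.
  - case: gs => [|g [|h [|l []]]]// _ [gy [hg [lh lx]]]; subst y.
    have gh := esym hg; have hl := esym lh.
    apply: etrans _ (esym (sum4 _)).
    apply: etrans (sum12 _) _.
    apply: etrans (eq2 (sgn1 (hom_K sigma (mul g h) l x (tgt g)))
      (sgn2 (hom_K sigma g (mul h l) x (tgt g)))) _.
    have E0 := @comp_zero _ _ (-1) (tgt g) (Q 0%N [::] (tgt g) (tgt g) (-1) 0)
      (Q 3%N [:: g; h; l] x (tgt g) 1 (-1)) ((-1) ^+ 0) isT isT.
    have E1 := sgn1 (hom_A sigma g (tgt h) (tgt g) \o hom_K sigma h l x (tgt h))%VF.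
    have E2 := sgn2 (hom_K sigma g h (tgt l) (tgt g) \o hom_T sigma l x (tgt l))%VF.
    have E3 := @comp_zero _ _ 2 x (Q 3%N [:: g; h; l] x (tgt g) 2 0) (Q 0%N [::] x x 1 2) ((-1) ^+ 3) isT isT.
    apply: etrans _ (esym (eq4 E0 E1 E2 E3)).
    have Ec := hom_K_cocycle hsigma gh hl lx erefl.
    rewrite add0r addr0; exact: shuffle Ec.
  - by move=> *; apply: zero_cod; lia.
case: k gs => [|[|[|k]]] gs.
- by move=> *; apply: zero_cod.
- case: gs => [|g []]// _ [gy gx]; subst y.
  apply: etrans _ (esym (sum2 _)).
  have E0 := sgn0 (anchor (tgt g) \o hom_A sigma g x (tgt g))%VF.
  have E1 := sgn1 (hom_T sigma g x (tgt g) \o anchor x)%VF.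
  apply: etrans _ (esym (eq2 E0 E1)).
  rewrite (hom_anchor_A hsigma gx erefl) subrr big_geq//.
- case: gs => [|g [|h []]]// _ [gy [hg hx]]; subst y.
  have gh := esym hg.
  apply: etrans _ (esym (sum3 _)).
  apply: etrans (sum11 _) _.
  apply: etrans (sgn1 (hom_A sigma (mul g h) x (tgt g))) _.
  have E0 := @comp_zero _ _ (-1) (tgt g) (Q 0%N [::] (tgt g) (tgt g) (-1) 0)
      (Q 2%N [:: g; h] x (tgt g) 0 (-1)) ((-1) ^+ 0) isT isT.
  have E1 := sgn1 (hom_A sigma g (tgt h) (tgt g) \o hom_A sigma h x (tgt h))%VF.
  have E2 := sgn2 (hom_K sigma g h x (tgt g) \o anchor x)%VF.
  apply: etrans _ (esym (eq3 E0 E1 E2)).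
  rewrite -(hom_A_mul hsigma gh hx erefl) add0r addrA addNr sub0r.
  reflexivity.
- by move=> *; apply: zero_cod; lia.
Qed.

Let ds_hl (g : G) (e : 'rV[R]_(mdim (gobj G))) :
  ds (tangent_groupoid_of G) g (hl sigma g e) = e.
Proof. exact: Dsrc_hlift. Qed.
Let hl_unt x (e : 'rV[R]_(mdim (gobj G))) :
  hl sigma (unt x) e = du (tangent_groupoid_of G) x e.
Proof. exact: hlift_unt. Qed.

Lemma Ad_unital : is_unital Q.
Proof.
split=> [x i|k gs gs' z x y i j k2 sz].
  have [->|i0] := eqVneq i 0.
    apply/lfunP => a; apply: aval_inj; rewrite id_lfunE.
    apply: etrans (hom_AE hsigma a (esym (src_unt x)) (tgt_unt x)) _.
    exact: (actA_unt ds_hl hl_unt (avalP a)).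
  have [->|i1] := eqVneq i 1; last exact: zero_dom.
  apply/lfunP => v; rewrite id_lfunE.
  apply: etrans (hom_TE sigma (unt x) x v) _.
  exact: (actT_unt hl_unt).
have K0 (g h : G) (w : gobj G) : src g = tgt h -> tgt g = w ->
    (forall e, bcurv (tangent_groupoid_of G) (hl sigma) g h e = 0) ->
    hom_K sigma g h x w = 0.
  move=> gh gw Ke; apply/lfunP => v; apply: aval_inj.
  apply: etrans (hom_KE hsigma v gh gw) _.
  by rewrite Ke zero_lfunE /aval (raddf0 vsval).
case: i => [[|[|i]]|i]; case: j => [[|[|j]]|j] //.
- by case: k k2 sz => [|[|k]].
- by case: k k2 sz => [|k].
(* Only [R_2] can be nonzero here, so the unit is either the left or the right arrow of a pair. *)
- case: k k2 sz => [|[|[|k]]] // _; case: gs => [|g [|g' gs]] //= [].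
    case: gs' => [|h []]//= _ [zy [hz hx]]; rewrite src_unt in hz; subst z.
    apply: K0 => [|//|e]; first by rewrite src_unt.
    exact: (bcurv_unt_l hl_unt).
    case: gs' => // _ [gy [zg zx]]; rewrite tgt_unt in zg; subst z.
    apply: K0 => [|//|e]; first by rewrite tgt_unt.
    exact: (bcurv_unt_r ds_hl hl_unt).
  by rewrite size_cat addnS.
- by case: k k2 sz => [|[|k]].
Qed.

End AdjointEquations.

(** * Smoothness of the operators applied to smooth families *)

Section AdjointSmoothness.
Variables (R : realType) (G : lie_groupoid R).
Local Notation dG := (mdim (garr G)).
Local Notation dM := (mdim (gobj G)).
Local Notation MG := (manifoldP (garr G)).
Local Notation MM := (manifoldP (gobj G)).
Local Notation TG := (tangent_groupoid_of G).
Variable sigma : forall g : G, 'Hom(tangent (src g), tangent g).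
Hypothesis hsigma : is_ehresmann sigma.
Local Notation hl := (hl sigma).
Local Notation Q := (Ad_ops sigma).

Section AtPoint.
Variables (N : charted R) (S : set N) (p : N).
Hypotheses (dp : mdom p p) (Sp : S p).

Lemma smooth_at_eq (P : charted R) (f f' : N -> P) :
  (forall q, S q -> f q = f' q) -> smooth_at S f p -> smooth_at S f' p.
Proof.
move=> ff' [ O [F [oO Op sF EF]]]; exists O, F; split => // q Sq dq Oq.
by rewrite -(ff' p Sp) -(ff' q Sq); exact: EF.
Qed.

(** [vsmooth] refers to the base points through [ctrans], so groupoid laws such as
    [mul g (inv g) = unt (tgt g)] have to be applied to the base map as well. *)
Lemma vsmooth_eq (P : manifold R) (f f' : N -> P) X :
  (forall q, S q -> f q = f' q) -> vsmooth S f p X -> vsmooth S f' p X.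
Proof.
move=> ff'; apply: csmooth_near.
apply: filterS (mnbhs_in S p) => q Sq.
by rewrite (ff' p Sp) (ff' q Sq).
Qed.

Lemma vsmooth_congr (P : manifold R) (f : N -> P) X Y :
  (forall q, S q -> X q = Y q) -> vsmooth S f p X -> vsmooth S f p Y.
Proof.
by move=> XY; apply: vsmooth_near; apply: filterS (mnbhs_in S p).
Qed.

Let sm_src (f : N -> G) : smooth_at S f p -> smooth_at S (fun q => src (f q)) p.
Proof. by move=> sf; apply: smooth_at_setT => //; exact: src_smooth. Qed.
Let sm_unt (f : N -> gobj G) : smooth_at S f p -> smooth_at S (fun q => unt (f q)) p.
Proof. by move=> sf; apply: smooth_at_setT => //; exact: unt_smooth. Qed.
Let sm_inv (f : N -> G) : smooth_at S f p -> smooth_at S (fun q => inv (f q)) p.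
Proof. by move=> sf; apply: smooth_at_setT => //; exact: inv_smooth. Qed.

Lemma vsmooth_rdivA (g : N -> G) X : smooth_at S g p ->
  (forall q, S q -> Dsrc (g q) (X q) = 0) -> vsmooth S g p X ->
  vsmooth S (fun q => unt (tgt (g q))) p (fun q => rdivA TG (g q) (X q)).
Proof.
move=> sg X0 sX.
apply: (@vsmooth_eq _ (fun q => mul (g q) (inv (g q)))) => [q _|].
  exact: mul_inv_r.
have c1 q : S q -> src (g q) = tgt (inv (g q)) by rewrite tgt_inv.
have c2 q : S q -> Dsrc (g q) (X q) = Dtgt (inv (g q)) 0.
  by move=> Sq; rewrite (X0 q Sq) linear0.
have := vsmooth_Dmul dp Sp sg (sm_inv sg) c1 c2 sX (vsmooth0 _ _ _).
exact.
Qed.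

Lemma vsmooth_anchor (f : N -> gobj G) A : smooth_at S f p ->
  vsmooth S (fun q => unt (f q)) p A ->
  vsmooth S f p (fun q => Dtgt (unt (f q)) (A q)).
Proof.
move=> sf sA.
apply: (@vsmooth_eq _ (fun q => tgt (unt (f q)))) => [q _|]; first exact: tgt_unt.
by apply: (vsmooth_mdiff dp Sp (sm_unt sf) (@tgt_smooth R G)).
Qed.

Lemma vsmooth_lmulA (g : N -> G) A : smooth_at S g p ->
  (forall q, S q -> Dsrc (unt (src (g q))) (A q) = 0) ->
  vsmooth S (fun q => unt (src (g q))) p A ->
  vsmooth S g p (fun q => lmulA TG (g q) (A q)).
Proof.
move=> sg A0 sA.
apply: (@vsmooth_eq _ (fun q => mul (g q) (unt (src (g q))))) => [q _|].
  exact: mul_unt_r.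
have c1 q : S q -> src (g q) = tgt (unt (src (g q))) by rewrite tgt_unt.
have c2 q : S q -> Dsrc (g q) 0 = Dtgt (unt (src (g q))) (Dinv (unt (src (g q))) (A q)).
  by move=> Sq; rewrite linear0; exact/esym/(dt_di_algd (tg := TG) (A0 q Sq)).
have sI : vsmooth S (fun q => unt (src (g q))) p (fun q => Dinv (unt (src (g q))) (A q)).
  apply: (@vsmooth_eq _ (fun q => inv (unt (src (g q))))) => [q _|]; first exact: inv_unt.
  exact: (vsmooth_mdiff dp Sp (sm_unt (sm_src sg)) (@inv_smooth R G) sA).
have := vsmooth_Dmul dp Sp sg (sm_unt (sm_src sg)) c1 c2 (vsmooth0 _ _ _) sI.
exact.
Qed.

Lemma vsmooth_actT (g : N -> G) X : smooth_at S g p ->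
  vsmooth S (fun q => src (g q)) p X ->
  vsmooth S (fun q => tgt (g q)) p (fun q => actT TG hl (g q) (X q)).
Proof.
move=> sg sX; apply: (vsmooth_mdiff dp Sp sg (@tgt_smooth R G)).
exact: vsmooth_hlift.
Qed.

Lemma vsmooth_actA (g : N -> G) A : smooth_at S g p ->
  (forall q, S q -> Dsrc (unt (src (g q))) (A q) = 0) ->
  vsmooth S (fun q => unt (src (g q))) p A ->
  vsmooth S (fun q => unt (tgt (g q))) p (fun q => actA TG hl (g q) (A q)).
Proof.
move=> sg A0 sA.
have sR := vsmooth_anchor (sm_src sg) sA.
have sH := vsmooth_hlift dp Sp hsigma sg sR.
have sB := vsmoothD sH (vsmoothN (vsmooth_lmulA sg A0 sA)).
have c q : S q -> Dsrc (g q) (hl (g q) (Dtgt (unt (src (g q))) (A q)) -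
    lmulA TG (g q) (A q)) = 0.
  move=> Sq; apply: (ds_actA_arg (tg := TG)) (A0 q Sq); exact: Dsrc_hlift.
exact: (vsmooth_rdivA sg c sB).
Qed.

Lemma vsmooth_bcurv (g h : N -> G) X : smooth_at S g p -> smooth_at S h p ->
  (forall q, S q -> src (g q) = tgt (h q)) ->
  vsmooth S (fun q => src (h q)) p X ->
  vsmooth S (fun q => unt (tgt (g q))) p (fun q => bcurv TG hl (g q) (h q) (X q)).
Proof.
move=> sg sh gh sX.
have sgh := smooth_at_mul dp Sp sg sh gh.
apply: (@vsmooth_eq _ (fun q => unt (tgt (mul (g q) (h q))))) => [q Sq|].
  by rewrite tgt_mul// gh.
have sT : vsmooth S (fun q => src (g q)) p (fun q => actT TG hl (h q) (X q)).
  apply: (@vsmooth_eq _ (fun q => tgt (h q))) => [q Sq|]; first by rewrite gh.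
  exact: vsmooth_actT.
have sX' : vsmooth S (fun q => src (mul (g q) (h q))) p X.
  apply: (@vsmooth_eq _ (fun q => src (h q))) => [q Sq|//].
  by rewrite src_mul// gh.
have c2 q : S q -> Dsrc (g q) (hlift sigma (g q) (actT TG hl (h q) (X q))) =
    Dtgt (h q) (hlift sigma (h q) (X q)).
  by move=> Sq; exact: (Dsrc_hlift hsigma).
have sD := vsmooth_Dmul dp Sp sg sh gh c2 (vsmooth_hlift dp Sp hsigma sg sT)
  (vsmooth_hlift dp Sp hsigma sh sX).
have sB := vsmoothD sD (vsmoothN (vsmooth_hlift dp Sp hsigma sgh sX')).
have c3 q : S q -> Dsrc (mul (g q) (h q)) (Dmul (g q) (h q) (hl (g q) (actT TG hl (h q) (X q)))
    (hl (h q) (X q)) - hl (mul (g q) (h q)) (X q)) = 0.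
  move=> Sq; apply: (ds_bcurv_arg (tg := TG)) (gh q Sq); exact: Dsrc_hlift.
exact: (vsmooth_rdivA sgh c3 sB).
Qed.

End AtPoint.
End AdjointSmoothness.

(** * Smoothness over the strings of arrows, and the theorem *)

Section AdjointSmooth.
Variables (R : realType) (G : lie_groupoid R).
Local Notation dG := (mdim (garr G)).
Local Notation dM := (mdim (gobj G)).
Local Notation MG := (manifoldP (garr G)).
Local Notation MM := (manifoldP (gobj G)).
Local Notation TG := (tangent_groupoid_of G).
Variable sigma : forall g : G, 'Hom(tangent (src g), tangent g).
Hypothesis hsigma : is_ehresmann sigma.
Local Notation hl := (hl sigma).
Local Notation Q := (Ad_ops sigma).
Local Notation strings k := (prodm (gobj G) (powm G k)).

Lemma strings_refl k (p : strings k) : mdom p p.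
Proof. by split; [exact: mdom_refl MM _|move=> i; exact: mdom_refl MG _]. Qed.

Lemma smooth_at_arrow k (S : set (strings k)) (p : strings k) (i : 'I_k) : S p ->
  @smooth_at R (strings k) G S (fun q => tnth q.2 i) p.
Proof.
move=> Sp; apply: (@smooth_at_comp R (strings k) (powm G k) G S setT snd
  (fun t : powm G k => tnth t i) p (strings_refl p) Sp) => //.
- exact: smooth_at_snd.
- exact: smooth_at_tnth.
Qed.

Lemma nerve0 (q : strings 0) : stgt q.1 (arrows q) = q.1.
Proof. by case: q => x [[|//] sz]. Qed.

Lemma nerve1 (q : strings 1) : nerve q ->
  [/\ (arrows q : seq G) = [:: tnth q.2 ord0], q.1 = src (tnth q.2 ord0) &
    stgt q.1 (arrows q) = tgt (tnth q.2 ord0)].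
Proof. by case: q => x [[|g [|//]] sz] //= [_ xg]. Qed.

Lemma nerve2 (q : strings 2) : nerve q ->
  let g := tnth q.2 ord0 in let h := tnth q.2 ord_max in
  [/\ (arrows q : seq G) = [:: g; h], src g = tgt h, q.1 = src h &
    stgt q.1 (arrows q) = tgt g].
Proof. by case: q => x [[|g [|h [|//]]] sz] //= [_ [gh xh]]. Qed.

Local Notation Phi k i j := (fun q : strings k =>
  Q k (arrows q) q.1 (stgt q.1 (arrows q)) i j).
Local Notation smooth_op k i j := (@smooth_hom R (strings k) (gobj G) (gobj G)
  (@nerve R G k) (fun q => q.1) (fun q => stgt q.1 (arrows q)) (Ad G i) (Ad G j)
  (Phi k i j)).

Lemma smooth_op_zero k i j :
  (forall q : strings k, Phi k i j q = 0) -> smooth_op k i j.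
Proof.
move=> Z e e' _ _; apply: smooth_coef_family => p _ _ _ a.
apply: smooth_family_near (smooth_family0 _ _ _ _).
by apply: nearW => q; rewrite Z zero_lfunE.
Qed.

Lemma smooth_op_dom k i j : i != 0 -> i != 1 -> smooth_op k i j.
Proof.
by move=> i0 i1; apply: smooth_op_zero => q; exact: zero_dom.
Qed.

Lemma smooth_op_cod k i j : j != 0 -> j != 1 -> smooth_op k i j.
Proof.
by move=> j0 j1; apply: smooth_op_zero => q; exact: zero_cod.
Qed.

Lemma smooth_op_anchor : smooth_op 0 0 1.
Proof.
move=> e _ fe [r _ <-]; apply: smooth_coef_family => p Sp ep dr a.
have dp := strings_refl p.
have s1 : @smooth_at R (strings 0) (gobj G) (@nerve R G 0) (fun q => q.1) p.
  exact: smooth_at_fst.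
have s2 : smooth_at (@nerve R G 0) (fun q => stgt q.1 (arrows q)) p.
  by apply: smooth_at_eq s1 => // q _; rewrite nerve0.
apply: smooth_family_tangent => //.
apply: (vsmooth_eq Sp (f := fun q => q.1)) => [q _|]; first by rewrite nerve0.
have := vsmooth_anchor dp Sp s1 (algd_frame_vsmooth dp Sp a fe s1 ep).
by apply: vsmooth_congr => q Sq; apply/esym; exact: anchorE.
Qed.

Lemma smooth_op_actT : smooth_op 1 1 1.
Proof.
move=> _ _ [r _ <-] [r' _ <-]; apply: smooth_coef_family => p Sp dr dr' a.
have dp := strings_refl p.
pose g (q : strings 1) := tnth q.2 ord0.
have sg : smooth_at (@nerve R G 1) g p by exact: smooth_at_arrow.
have st : smooth_at (@nerve R G 1) (fun q => tgt (g q)) p.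
  by apply: smooth_at_setT => //; exact: tgt_smooth.
have ss : smooth_at (@nerve R G 1) (fun q => src (g q)) p.
  by apply: smooth_at_setT => //; exact: src_smooth.
have s2 : smooth_at (@nerve R G 1) (fun q => stgt q.1 (arrows q)) p.
  by apply: smooth_at_eq st => // q /nerve1[].
apply: smooth_family_tangent => //.
apply: (vsmooth_eq Sp (f := fun q => tgt (g q))) => [q /nerve1[]//|].
have dr1 : mdom r (src (g p)) by have [_ <-] := nerve1 Sp.
have := vsmooth_actT hsigma dp Sp sg (vsmooth_coord dp Sp a ss dr1).
apply: vsmooth_congr => -[x [[|g0 [|? ?]] sz]] // [_ xg].
(* On the nerve the stored source is that of the last arrow; substituting it identifies the two
   fibres. *)
have {}xg : x = src g0 := xg; subst x.
apply/esym; exact: (hom_TE sigma g0 (tgt g0)).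
Qed.

Lemma smooth_op_actA : smooth_op 1 0 0.
Proof.
move=> e e' fe fe'; apply: smooth_coef_family => p Sp ep ep' a.
have dp := strings_refl p.
pose g (q : strings 1) := tnth q.2 ord0.
have sg : smooth_at (@nerve R G 1) g p by exact: smooth_at_arrow.
have st : smooth_at (@nerve R G 1) (fun q => tgt (g q)) p.
  by apply: smooth_at_setT => //; exact: tgt_smooth.
have ss : smooth_at (@nerve R G 1) (fun q => src (g q)) p.
  by apply: smooth_at_setT => //; exact: src_smooth.
have s2 : smooth_at (@nerve R G 1) (fun q => stgt q.1 (arrows q)) p.
  by apply: smooth_at_eq st => // q /nerve1[].
apply: (smooth_family_algd dp Sp fe' s2 ep').
apply: (vsmooth_eq Sp (f := fun q => unt (tgt (g q)))) => [q /nerve1[_ _ ->]//|].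
have ep1 : fdom e (src (g p)) by have [_ <-] := nerve1 Sp.
have sA := algd_frame_vsmooth dp Sp a fe ss ep1.
have := vsmooth_actA hsigma dp Sp sg (fun q _ => avalP _) sA.
apply: vsmooth_congr => -[x [[|g0 [|? ?]] sz]] // [_ xg].
have {}xg : x = src g0 := xg; subst x.
apply/esym; exact: (hom_AE hsigma _ erefl erefl).
Qed.

Lemma smooth_op_bcurv : smooth_op 2 1 0.
Proof.
move=> _ e' [r _ <-] fe'; apply: smooth_coef_family => p Sp dr ep' a.
have dp := strings_refl p.
pose g (q : strings 2) := tnth q.2 ord0.
pose h (q : strings 2) := tnth q.2 ord_max.
have sg : smooth_at (@nerve R G 2) g p by exact: smooth_at_arrow.
have sh : smooth_at (@nerve R G 2) h p by exact: smooth_at_arrow.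
have gh q : nerve q -> src (g q) = tgt (h q) by move=> /nerve2[].
have st : smooth_at (@nerve R G 2) (fun q => tgt (g q)) p.
  by apply: smooth_at_setT => //; exact: tgt_smooth.
have ss : smooth_at (@nerve R G 2) (fun q => src (h q)) p.
  by apply: smooth_at_setT => //; exact: src_smooth.
have s2 : smooth_at (@nerve R G 2) (fun q => stgt q.1 (arrows q)) p.
  by apply: smooth_at_eq st => // q /nerve2[].
apply: (smooth_family_algd dp Sp fe' s2 ep').
apply: (vsmooth_eq Sp (f := fun q => unt (tgt (g q)))) => [q /nerve2[_ _ _ ->]//|].
have dr1 : mdom r (src (h p)) by have [_ _ <-] := nerve2 Sp.
have := vsmooth_bcurv hsigma dp Sp sg sh gh (vsmooth_coord dp Sp a ss dr1).
apply: vsmooth_congr => -[x [[|g0 [|h0 [|? ?]]] sz]] // [_ [hg xh]].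
have {}xh : x = src h0 := xh; subst x.
apply/esym; exact: (hom_KE hsigma _ (esym hg) erefl).
Qed.

Lemma Ad_smooth k i j : smooth_op k i j.
Proof.
have [->|i0] := eqVneq i 0.
  have [->|j0] := eqVneq j 0.
    case: k => [|[|k]]; last by apply: smooth_op_zero.
    - exact: smooth_op_zero.
    - exact: smooth_op_actA.
  have [->|j1] := eqVneq j 1; last exact: smooth_op_cod.
  by case: k => [|k]; [exact: smooth_op_anchor|exact: smooth_op_zero].
have [->|i1] := eqVneq i 1; last exact: smooth_op_dom.
have [->|j0] := eqVneq j 0.
  case: k => [|[|[|k]]]; try exact: smooth_op_zero.
  exact: smooth_op_bcurv.
have [->|j1] := eqVneq j 1; last exact: smooth_op_cod.
case: k => [|[|k]]; try exact: smooth_op_zero.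
exact: smooth_op_actT.
Qed.

Lemma Ad_bundle : is_bounded_gbundle (Ad G).
Proof.
split=> [i|].
  have [->|i0] := eqVneq i 0; first exact: algebroid_vbundle.
  have [->|i1] := eqVneq i 1; first exact: tangent_vbundle.
  by case: i i0 i1 => [[|[|i]]|i] // _ _; exact: zero_vbundle.
exists 1%N => i x; case: i => [[|[|i]]|i] // _; rewrite dimvf; exact: muln0.
Qed.

End AdjointSmooth.

Theorem proposition3p14 (R : realType) (G : lie_groupoid R)
    (sigma : forall g : G, 'Hom(tangent (src g), tangent g))
    (hsigma : is_ehresmann sigma) :
  is_ruth (Ad_ops sigma) /\ is_unital (Ad_ops sigma).
Proof.
split; last exact: Ad_unital.
split.
- exact: Ad_bundle.
- by move=> k gs x y i j _ _; exact: Ad_degree.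
- exact: Ad_smooth.
- exact: Ad_ruth_eq.
Qed.
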